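(* Let $\Omega\subset\mathbb{C}$ be a domain, and let $f$ be a nonconstant holomorphic function on $\Omega$ such that $Z(f):=\{z\in\Omega: f(z)=0\}\neq\emptyset$ and $|f|<\frac{1}{10}$ on $\Omega$. Define $$u(z):=\log\bigl(-\log|f(z)|^2\bigr)\quad (z\in\Omega\setminus Z(f)),\qquad g_u(z):=\begin{cases}\Delta u(z), & z\notin Z(f),\\ 0, & z\in Z(f),\end{cases}$$ where $\Delta u$ is the classical Laplacian on $\Omega\setminus Z(f)$. Then: (1) $u\in W^{1,2}_{\mathrm{loc}}(\Omega)$, but for every $p>2$, every $a\in Z(f)$ and every open neighborhood $V\subset\Omega$ of $a$, $u\notin W^{1,p}_{\mathrm{loc}}(V)$; (2) $g_u\in L^1_{\mathrm{loc}}(\Omega)$; (3) $\Delta u=g_u$ on $\Omega$ in the sense of distributions; (4) for every $a\in Z(f)$ and every open neighborhood $V\subset\Omega$ of $a$, $u\notin W^{2,1}_{\mathrm{loc}}(V)$.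
   Context: $W^{k,p}_{\mathrm{loc}}(V)$ is the space of functions on $V$ whose weak derivatives of order $\le k$ exist and belong to $L^p_{\mathrm{loc}}(V)$. The Laplacian is $\Delta u = 4\frac{\partial^2 u}{\partial z\,\partial\bar z}$. The function $u$ is defined off the set $Z(f)$, which has Lebesgue measure zero, and is regarded as a function defined almost everywhere on $\Omega$. ''In the sense of distributions'' means $\int_\Omega u\,\Delta\varphi\,dA=\int_\Omega g_u\,\varphi\,dA$ for all $\varphi\in C_c^\infty(\Omega)$, with $dA$ Lebesgue measure. *)

(* Defs.v *)
From HB Require Import structures.
From mathcomp Require Import all_boot all_order all_algebra.
From mathcomp Require Import complex ring.
From mathcomp Require Import all_classical all_reals all_analysis.

Set Implicit Arguments.
Unset Strict Implicit.
Unset Printing Implicit Defensive.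

Import Order.TTheory GRing.Theory Num.Theory.
Import ComplexField.Normc.
Import numFieldNormedType.Exports.

Local Open Scope classical_set_scope.
Local Open Scope ring_scope.
Local Open Scope complex_scope.

(** * The complex plane *)

(* The topology and norm of [R[i]] are those of any [numFieldType], as given by
   the regular module [R[i]^o]. *)
#[non_forgetful_inheritance]
HB.instance Definition _ (R : realType) := NormedModule.copy R[i] R[i]^o.

Definition domain (R : realType) (Omega : set R[i]) : Prop :=
  [/\ open Omega, connected Omega & Omega !=set0].

Definition holomorphic_on (R : realType) (Omega : set R[i]) (f : R[i] -> R[i]) :
  Prop := forall z, Omega z -> derivable f z 1.

Definition nonconstant_on (R : realType) (Omega : set R[i]) (f : R[i] -> R[i]) :
  Prop := ~ exists c : R[i], forall z, Omega z -> f z = c.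

Definition zero_set (R : realType) (Omega : set R[i]) (f : R[i] -> R[i]) :
  set R[i] := [set z | Omega z /\ f z = 0].

(** * Real partial derivatives *)

Definition dx (R : realType) (h : R[i] -> R) (z : R[i]) : R :=
  derive1 (fun t : R => h (t +i* complex.Im z)) (complex.Re z).

Definition dy (R : realType) (h : R[i] -> R) (z : R[i]) : R :=
  derive1 (fun t : R => h (complex.Re z +i* t)) (complex.Im z).

Definition partial (R : realType) (a b : nat) (h : R[i] -> R) : R[i] -> R :=
  iter a (@dx R) (iter b (@dy R) h).

Definition has_partials (R : realType) (h : R[i] -> R) : Prop :=
  forall z, derivable (fun t : R => h (t +i* complex.Im z)) (complex.Re z) 1 /\
            derivable (fun t : R => h (complex.Re z +i* t)) (complex.Im z) 1.

Fixpoint C_k (R : realType) (k : nat) (h : R[i] -> R) : Prop :=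
  continuous h /\
  if k is k'.+1 then [/\ has_partials h, C_k k' (dx h) & C_k k' (dy h)] else True.

Definition smooth (R : realType) (h : R[i] -> R) : Prop := forall k, C_k k h.

(** * The Laplacian *)

Definition dxc (R : realType) (F : R[i] -> R[i]) (z : R[i]) : R[i] :=
  dx (fun w => complex.Re (F w)) z +i* dx (fun w => complex.Im (F w)) z.

Definition dyc (R : realType) (F : R[i] -> R[i]) (z : R[i]) : R[i] :=
  dy (fun w => complex.Re (F w)) z +i* dy (fun w => complex.Im (F w)) z.

Definition d_z (R : realType) (F : R[i] -> R[i]) (z : R[i]) : R[i] :=
  (dxc F z - 'i * dyc F z) / 2.

Definition d_zbar (R : realType) (F : R[i] -> R[i]) (z : R[i]) : R[i] :=
  (dxc F z + 'i * dyc F z) / 2.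

(* [4 * d_z (d_zbar h)] has zero imaginary part wherever [h] is C^2 (equality of
   mixed partials), so that taking the real part loses nothing there. *)
Definition laplacian (R : realType) (h : R[i] -> R) (z : R[i]) : R :=
  complex.Re (4 * d_z (d_zbar (fun w => (h w)%:C)) z).

Lemma laplacianE (R : realType) (h : R[i] -> R) (z : R[i]) :
  derivable (fun t : R => dx h (t +i* complex.Im z)) (complex.Re z) 1 ->
  derivable (fun t : R => dy h (complex.Re z +i* t)) (complex.Im z) 1 ->
  laplacian h z = partial 2 0 h z + partial 0 2 h z.
Proof.
move=> hx hy.
have half (a : R[i]) : a / 2 = (complex.Re a / 2) +i* (complex.Im a / 2).
  have -> : (2 : R[i]) = (2 : R)%:C by rewrite rmorphMn.
  by rewrite -fmorphV; case: a => a b; simpc.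
have d0 : derive1 (fun=> 0 : R) = fun=> 0 by apply/funext => t; exact: derive1_cst.
have G w : d_zbar (fun w => (h w)%:C) w = (2^-1 * dx h w) +i* (2^-1 * dy h w).
  rewrite /d_zbar half /dxc /dyc /=.
  rewrite [dx (fun=> 0) w]/dx [dy (fun=> 0) w]/dy !d0.
  by congr (_ +i* _); ring.
have GE : d_zbar (fun w => (h w)%:C) =
   fun w => (2^-1 * dx h w) +i* (2^-1 * dy h w) by apply/funext.
have four : (4 : R[i]) = (4 : R)%:C by rewrite rmorphMn.
rewrite /laplacian GE four /d_z half /dxc /dyc /=.
have -> : dx (fun w => 2^-1 * dx h w) z = 2^-1 * dx (dx h) z.
  by rewrite [LHS]/dx [dx (dx h) z]/dx !derive1E; exact: (deriveZ 2^-1 hx).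
have -> : dy (fun w => 2^-1 * dy h w) z = 2^-1 * dy (dy h) z.
  by rewrite [LHS]/dy [dy (dy h) z]/dy !derive1E; exact: (deriveZ 2^-1 hy).
rewrite /partial /=.
by field.
Qed.

(** * Lebesgue measure and locally integrable functions *)

Definition plane (R : realType) : measurableType _ :=
  (measurableTypeR R * measurableTypeR R)%type.

Definition to_C (R : realType) (q : plane R) : R[i] := q.1 +i* q.2.

Definition dA (R : realType) : {measure set (plane R) -> \bar R} :=
  (@lebesgue_measure R \x @lebesgue_measure R)%E.

Definition intC (R : realType) (A : set R[i]) (h : R[i] -> R) : \bar R :=
  (\int[dA R]_(q in @to_C R @^-1` A) (h (to_C q))%:E)%E.

(* Restricting to Borel measurable functions is harmless: every Lebesgue
   measurable function has a Borel measurable representative. *)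
Definition Lp_loc (R : realType) (p : \bar R) (V : set R[i]) (h : R[i] -> R) :
  Prop :=
  measurable_fun (@to_C R @^-1` V) (h \o @to_C R) /\
  forall K : set R[i], compact K -> K `<=` V ->
    ('N[dA R]_p[EFin \o (h \* \1_K)%R \o @to_C R] < +oo)%E.

(** * Distributions and Sobolev spaces *)

Definition test_function (R : realType) (V : set R[i]) (phi : R[i] -> R) :
  Prop :=
  let supp := closure [set z | phi z != 0] in
  [/\ smooth phi, compact supp & supp `<=` V].

Definition weak_derivative (R : realType) (V : set R[i]) (a b : nat)
    (h v : R[i] -> R) : Prop :=
  [/\ Lp_loc 1%E V h, Lp_loc 1%E V v &
    forall phi, test_function V phi ->
      intC V (fun z => h z * partial a b phi z) =
      (((-1) ^+ (a + b))%:E * intC V (fun z => v z * phi z)%R)%E].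

(* The derivative of order 0 of [h] is [h] itself. *)
Definition Sobolev_loc (R : realType) (k : nat) (p : \bar R) (V : set R[i])
    (h : R[i] -> R) : Prop :=
  Lp_loc p V h /\
  forall a b : nat, (0 < a + b <= k)%N ->
    exists2 v, weak_derivative V a b h v & Lp_loc p V v.

Definition distributional_laplacian (R : realType) (Omega : set R[i])
    (h g : R[i] -> R) : Prop :=
  forall phi, test_function Omega phi ->
    intC Omega (fun z => h z * laplacian phi z) =
    intC Omega (fun z => g z * phi z).

(** * The functions of the theorem *)

(* [ln] is 0 on nonpositive numbers, hence [u_of f] is 0 on the zeros of [f];
   this is an arbitrary value on a set of measure zero. *)
Definition u_of (R : realType) (f : R[i] -> R[i]) (z : R[i]) : R :=
  ln (- ln (normc (f z) ^+ 2)).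

Definition g_of (R : realType) (f : R[i] -> R[i]) (z : R[i]) : R :=
  if f z == 0 then 0 else laplacian (u_of f) z.

(* Main.v *)
(* Write L = - log |f|^2, so that u = log L. Near a zero a of order m, f = (z - a)^m h with h nonvanishing; hence L differs
   from - m log |z - a|^2, and the derivatives of L up to order two from those of the latter, by bounded functions, and
   |grad u| = |grad L| / L is at most a constant times 1 / (|z - a| |log |z - a||), whose square is integrable. Integrating by
   parts on the lines that avoid the isolated zeros shows that grad u is the weak gradient of u.

   Since L is harmonic off the zeros, the classical Laplacian of u is - |grad u|^2, which is locally integrable. The second
   derivatives of u are not, so grad u is first multiplied by N / (N + L), which is integrated by parts without boundary
   terms; letting N tend to infinity, dominated convergence gives the distributional Laplacian.

   Conversely, on the square with corners a + 2^-k (2, 0) and a + 2^-k (3, 1) one has - u_x >= c 2^k / k and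
   u_xx >= c 4^k / k. Testing against a bump function supported there, a weak derivative v has mass at least B 2^-k / k
   (order one), respectively B / k (order two), on that square, of area 4^-k. The former is incompatible with v in L^p,
   p > 2, as k tends to infinity; the latter with v in L^1, as the squares are disjoint and the harmonic series diverges. *)

(* The local form f = (z - a)^m h comes from Cauchy's theory, built on Goursat's argument for
   rectangles. One exceptional point is allowed there, since the difference quotient in Cauchy's
   formula is a priori only continuous at its centre. The obstacle to the distributional Laplacian
   is that u_xx = L_xx / L - u_x^2 has size 1 / (|z - a|^2 |log |z - a||), just short of integrable.
   As N / (N + L) <= N / L, the damping supplies the missing factor 1 / L, but with constants
   depending on N. The passage to the limit is saved by harmonicity: L_xx and L_yy cancel in the sum
   of the two damped derivatives, which is g_u times a factor between 0 and 2 tending to 1. The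
   squares lie in the sector 0 <= y <= x / 2 at a, where Re 1 / z and Re 1 / z^2 are positive and
   comparable to 1 / |z| and 1 / |z|^2. There L is of order k, so u_x^2 is smaller than L_xx / L by
   a factor of order 1 / k and cannot spoil the sign of u_xx. *)
Require Import Defs.
From HB Require Import structures.
From mathcomp Require Import all_boot all_order all_algebra.
From mathcomp Require Import complex.
From mathcomp Require Import all_classical all_reals all_analysis.
From mathcomp Require Import ring lra measurable_realfun ess_sup_inf.
Import Order.TTheory GRing.Theory Num.Theory.
Import ComplexField.Normc.
Import numFieldNormedType.Exports.
Local Open Scope classical_set_scope.
Local Open Scope ring_scope.
Local Open Scope complex_scope.

Set Implicit Arguments.
Unset Strict Implicit.
Unset Printing Implicit Defensive.

(** * Boxes and complex derivatives *)

Section plane_topology.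
Variable R : realType.
Implicit Types (z w : R[i]) (A : set R[i]) (e : R).

Lemma normcE z : `|z| = (normc z)%:C.
Proof. by case: z. Qed.

Lemma normc_ge0 z : 0 <= normc z.
Proof. by case: z => a b /=; exact: sqrtr_ge0. Qed.

Lemma normc_gt0 z : (0 < normc z) = (z != 0).
Proof.
rewrite lt_neqAle normc_ge0 andbT eq_sym; congr (~~ _).
by apply/eqP/eqP => [/eq0_normc//|->]; exact: normc0.
Qed.

Lemma normc_sqr z : normc z ^+ 2 = complex.Re z ^+ 2 + complex.Im z ^+ 2.
Proof. by case: z => a b /=; rewrite sqr_sqrtr// addr_ge0// sqr_ge0. Qed.

Lemma Re_le_normc z : `|complex.Re z| <= normc z.
Proof.
by case: z => a b /=; rewrite -sqrtr_sqr ler_wsqrtr// lerDl sqr_ge0.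
Qed.

Lemma Im_le_normc z : `|complex.Im z| <= normc z.
Proof.
by case: z => a b /=; rewrite -sqrtr_sqr ler_wsqrtr// lerDr sqr_ge0.
Qed.

Lemma normc_le_abs z : normc z <= `|complex.Re z| + `|complex.Im z|.
Proof.
rewrite -(@ler_pXn2r _ 2)// ?nnegrE ?normc_ge0// ?addr_ge0// normc_sqr.
rewrite sqrrD !real_normK ?num_real//.
have : 0 <= `|complex.Re z| * `|complex.Im z| by rewrite mulr_ge0.
by lra.
Qed.

Lemma normcB z w : normc (z - w) = normc (w - z).
Proof. by rewrite -normcN opprB. Qed.

Lemma ball_normcP z w e : 0 < e -> ball z e%:C w <-> normc (w - z) < e.
Proof.
by move=> e0; rewrite -ball_normE /= normcE normcB ltcR.
Qed.

(** The norm of [R[i]] has values in [R[i]], so a ball has a complex radius. Positivity in the order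
    of [R[i]] forces the radius to be real, and from here on only real radii appear. *)
Lemma nbhs_normcP z A :
  nbhs z A <-> exists2 e, 0 < e & forall w, normc (w - z) < e -> A w.
Proof.
split.
  move/nbhs_ballP => [[e x] /=]; rewrite ltcE/= => /andP[/eqP -> e0] h.
  by exists e => // w /(ball_normcP _ _ e0); exact: h.
move=> [e e0 h]; apply/nbhs_ballP; exists e%:C => /=; first by rewrite ltcR.
by move=> w /(ball_normcP _ _ e0); exact: h.
Qed.

Lemma continuous_ReP (T : topologicalType) (F : T -> R[i]) x :
  {for x, continuous F} <->
  {for x, continuous (fun t => complex.Re (F t))} /\ {for x, continuous (fun t => complex.Im (F t))}.
Proof.
split=> [cF|[cR cI]].
  split; apply/cvgrPdist_lt => e e0.
    have /cF h : nbhs (F x) [set w | normc (w - F x) < e].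
      by apply/nbhs_normcP; exists e.
    near=> t.
    have : normc (F t - F x) < e by near: t; exact: h.
    apply: le_lt_trans; rewrite distrC; have := Re_le_normc (F t - F x).
    by case: (F t) (F x) => [a b] [c d].
  have /cF h : nbhs (F x) [set w | normc (w - F x) < e].
    by apply/nbhs_normcP; exists e.
  near=> t.
  have : normc (F t - F x) < e by near: t; exact: h.
  apply: le_lt_trans; rewrite distrC; have := Im_le_normc (F t - F x).
  by case: (F t) (F x) => [a b] [c d].
move=> A /nbhs_normcP[e e0 h]; rewrite /nbhs /=.
have e20 : 0 < e / 2 by rewrite divr_gt0.
move/cvgrPdist_lt : cR => /(_ _ e20) cR.
move/cvgrPdist_lt : cI => /(_ _ e20) cI.
near=> t; apply: h; apply: le_lt_trans (normc_le_abs _) _.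
rewrite [ltRHS](splitr e); apply: ltrD.
  have : `|complex.Re (F x) - complex.Re (F t)| < e / 2 by near: t.
  by rewrite distrC; case: (F t) (F x) => [a b] [c d].
have : `|complex.Im (F x) - complex.Im (F t)| < e / 2 by near: t.
by rewrite distrC; case: (F t) (F x) => [a b] [c d].
Unshelve. all: by end_near. Qed.

Lemma continuous_Re : continuous (@complex.Re R).
Proof. by move=> z; have [] := (continuous_ReP (@id R[i]) z).1 (@cvg_id _ _). Qed.

Lemma continuous_Im : continuous (@complex.Im R).
Proof. by move=> z; have [] := (continuous_ReP (@id R[i]) z).1 (@cvg_id _ _). Qed.

(** Sup-norm balls replace discs: they contain the axis-parallel segments needed for primitives, and
    their Lebesgue measure is that of a product of intervals. *)
Definition box z e := [set w | `|complex.Re w - complex.Re z| < e /\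
                              `|complex.Im w - complex.Im z| < e].

Lemma box_open z e : open (box z e).
Proof.
rewrite openE => w [h1 h2]; apply/nbhs_normcP.
exists (Num.min (e - `|complex.Re w - complex.Re z|) (e - `|complex.Im w - complex.Im z|)).
  by rewrite lt_min !subr_gt0 h1 h2.
move=> v; rewrite lt_min => /andP[k1 k2]; split.
  rewrite -(subrK (complex.Re w) (complex.Re v)) -addrA; apply: le_lt_trans (ler_normD _ _) _.
  rewrite -ltrBrDr; apply: le_lt_trans k1; have := Re_le_normc (v - w).
  by case: (v) (w) => [a b] [c d].
rewrite -(subrK (complex.Im w) (complex.Im v)) -addrA; apply: le_lt_trans (ler_normD _ _) _.
rewrite -ltrBrDr; apply: le_lt_trans k2; have := Im_le_normc (v - w).
by case: (v) (w) => [a b] [c d].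
Qed.

Lemma box_center z e : 0 < e -> box z e z.
Proof. by move=> e0; split; rewrite subrr normr0. Qed.

Lemma nbhs_boxP z A : nbhs z A <-> exists2 e, 0 < e & box z e `<=` A.
Proof.
split=> [/nbhs_normcP[e e0 h]|[e e0 h]].
  exists (e / 2); first by rewrite divr_gt0.
  move=> w [h1 h2]; apply: h; apply: le_lt_trans (normc_le_abs _) _.
  by rewrite [ltRHS](splitr e); apply: ltrD; case: (w) (z) h1 h2 => [a b] [c d].
apply: (filterS h); apply: open_nbhs_nbhs.
by split; [exact: box_open|exact: box_center].
Qed.

(** Multiplied-out complex differentiability: no quotient has to be interpreted at [w = z], and the
    estimates compose directly. *)
Definition cdiff (f : R[i] -> R[i]) z d := forall e, 0 < e ->
  exists2 r, 0 < r & forall w, normc (w - z) < r ->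
    normc (f w - f z - d * (w - z)) <= e * normc (w - z).

Lemma factor_quotient (x d y : R[i]) : x != 0 ->
  y - d * x = x * ((x^-1 *: (y : R[i]^o)) - d).
Proof. by move=> x0; rewrite mulrBr [x * d]mulrC [_ *: _]mulrC mulrCA divff// mulr1. Qed.

Lemma cdiffP (f : R[i] -> R[i]) z d : cdiff f z d <-> is_derive z 1 f d.
Proof.
split=> [h|[df]]; last move=> dE.
  have k : (h^-1 *: (f (h + z) - f z)) @[h --> (0:R[i])^'] --> d.
    apply/cvgrPdist_le => -[e x] /=; rewrite ltcE/= => /andP[/eqP -> e0].
    have [r r0 hr] := h _ e0.
    apply/nbhs_normcP; exists r => // w; rewrite subr0 => wr w0.
    rewrite normcE lecR normcB.
    have wz : w + z - z = w by rewrite addrK.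
    have := hr (w + z); rewrite wz => /(_ wr).
    rewrite (factor_quotient _ _ w0).
    by rewrite normcM [leLHS]mulrC ler_pM2r// normc_gt0.
  have E : (fun h : R[i] => h^-1 *: ((f \o shift z) (h *: 1) - f z)) =
           (fun h : R[i] => h^-1 *: (f (h + z) - f z)).
    apply/funext => w /=; congr (_ *: (f (_ + _) - _)).
    exact: mulr1.
  split; last by apply: cvg_lim => //; rewrite E.
  by apply/cvg_ex; exists d; rewrite E.
have k : (h^-1 *: (f (h + z) - f z)) @[h --> (0:R[i])^'] --> d.
  have E : (fun h : R[i] => h^-1 *: ((f \o shift z) (h *: 1) - f z)) =
           (fun h : R[i] => h^-1 *: (f (h + z) - f z)).
    apply/funext => w /=; congr (_ *: (f (_ + _) - _)).
    exact: mulr1.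
  by rewrite -dE -E; exact: df.
move=> e e0; move/cvgrPdist_le : k => /(_ e%:C); rewrite ltcR => /(_ e0).
move/nbhs_normcP => [r r0 hr]; exists r => // w wr.
have [->|wz] := eqVneq w z.
  by rewrite !subrr mulr0 subrr normc0 mulr0.
have := hr (w - z); rewrite subr0 subr_eq0 => /(_ wr wz).
rewrite subrK normcE lecR => H.
have wz0 : w - z != 0 by rewrite subr_eq0.
rewrite (factor_quotient _ _ wz0) normcM [X in _ * X]normcB [leLHS]mulrC.
exact: ler_wpM2r (normc_ge0 _) _ _ H.
Qed.

Lemma cdiff_continuous (f : R[i] -> R[i]) z d :
  cdiff f z d -> {for z, continuous f}.
Proof.
move/cdiffP => [h _]; apply: differentiable_continuous.
exact/derivable1_diffP.
Qed.

Lemma cdiffM (f g : R[i] -> R[i]) z df dg : cdiff f z df -> cdiff g z dg ->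
  cdiff (fun w => f w * g w) z (f z * dg + g z * df).
Proof. by move=> /cdiffP hf /cdiffP hg; apply/cdiffP; exact: is_deriveM. Qed.

Lemma cdiffV (f : R[i] -> R[i]) z d : f z != 0 -> cdiff f z d ->
  cdiff (fun w => (f w)^-1) z (- d / f z ^+ 2).
Proof.
move=> f0 /cdiffP[df <-]; apply/cdiffP.
have -> : - 'D_1 f z / f z ^+ 2 = 'D_1 (fun w => (f w)^-1) z.
  have E (c y : R[i]) : - c / y = - y^-1 * c by rewrite mulrC mulrN mulNr.
  by rewrite deriveV//; exact: E.
exact/derivableP/derivableV.
Qed.

Lemma cdiffB (f g : R[i] -> R[i]) z df dg : cdiff f z df -> cdiff g z dg ->
  cdiff (fun w => f w - g w) z (df - dg).
Proof. by move=> /cdiffP hf /cdiffP hg; apply/cdiffP; exact: is_deriveB. Qed.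

Lemma cdiff_cst c z : cdiff (fun=> c) z 0.
Proof. by move=> e e0; exists 1 => // w _; rewrite subrr mul0r subrr normc0 mulr_ge0 ?normc_ge0// ltW. Qed.

Lemma cdiff_id z : cdiff id z 1.
Proof. by move=> e e0; exists 1 => // w _; rewrite mul1r subrr normc0 mulr_ge0 ?normc_ge0// ltW. Qed.

Lemma cdiff_near (f g : R[i] -> R[i]) z d : (\forall w \near z, f w = g w) ->
  cdiff f z d -> cdiff g z d.
Proof.
move=> fg h e e0; have [r r0 hr] := h _ e0.
have gz : f z = g z by exact: (nbhs_singleton fg).
move/nbhs_normcP : fg => [s s0 fg].
exists (Num.min r s); first by rewrite lt_min r0.
by move=> w; rewrite lt_min => /andP[wr ws]; rewrite -fg// -gz; exact: hr.
Qed.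

End plane_topology.

(** * Real partial derivatives *)

Section curves.
Variable R : realType.
Implicit Types (z w d v : R[i]) (e t : R) (h : R -> R) (g : R -> R[i]).

Let factor_quotientR (x d y : R) : x != 0 ->
  y - d * x = x * ((x^-1 *: (y : R^o)) - d).
Proof. by move=> x0; rewrite mulrBr [x * d]mulrC [_ *: _]mulrC mulrCA divff// mulr1. Qed.

Lemma is_deriveP h t a : is_derive t 1 h a <-> forall e, 0 < e ->
  exists2 r, 0 < r & forall s, `|s - t| < r ->
    `|h s - h t - a * (s - t)| <= e * `|s - t|.
Proof.
have E : (fun x : R => x^-1 *: ((h \o shift t) (x *: 1) - h t)) =
         (fun x : R => x^-1 *: (h (x + t) - h t)).
  by apply/funext => x /=; rewrite [x *: 1]mulr1.
split=> [[dh hE] e e0|H].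
  have k : (x^-1 *: (h (x + t) - h t)) @[x --> 0^'] --> a by rewrite -hE -E.
  move/cvgrPdist_le : k => /(_ _ e0) [r /= r0 hr]; exists r => // s st.
  have [->|s0] := eqVneq s t; first by rewrite !subrr mulr0 subrr normr0 mulr0.
  have s0' : s - t != 0 by rewrite subr_eq0.
  have := hr (s - t); rewrite /= sub0r normrN => /(_ st s0').
  rewrite subrK distrC => H.
  rewrite (factor_quotientR _ _ s0').
  by rewrite normrM mulrC ler_wpM2r.
have k : (x^-1 *: (h (x + t) - h t)) @[x --> 0^'] --> a.
  apply/cvgrPdist_le => e e0; have [r r0 hr] := H _ e0.
  exists r => // x /=; rewrite sub0r normrN => xr x0.
  have := hr (x + t); rewrite addrK => /(_ xr).
  rewrite (factor_quotientR _ _ x0).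
  by rewrite normrM mulrC ler_pM2r ?normr_gt0// distrC.
split; last by apply: cvg_lim => //; rewrite E.
by apply/cvg_ex; exists a; rewrite E.
Qed.

Lemma is_derive_near h1 h2 t a : (\forall s \near t, h1 s = h2 s) ->
  is_derive t 1 h1 a -> is_derive t 1 h2 a.
Proof.
move=> E /is_deriveP H; apply/is_deriveP => e /H[r r0 hr].
have E0 := nbhs_singleton E.
move: E => [r' /= r'0 E]; exists (Num.min r r'); first by rewrite lt_min r0.
move=> s; rewrite lt_min => /andP[s1 s2].
by rewrite -E0 -E ?hr//= /ball_/= distrC.
Qed.

(** Curves are differentiated by components, so that the real mean value theorem and fundamental
    theorem of calculus apply. *)
Definition cder g t d := is_derive t 1 (fun s => complex.Re (g s)) (complex.Re d) /\
  is_derive t 1 (fun s => complex.Im (g s)) (complex.Im d).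

Lemma Re_real_mul d a : complex.Re (d * a%:C) = complex.Re d * a.
Proof. by case: d => x y /=; rewrite mulr0 subr0. Qed.

Lemma Im_real_mul d a : complex.Im (d * a%:C) = complex.Im d * a.
Proof. by case: d => x y /=; rewrite mulr0 add0r. Qed.

Lemma ReB z w : complex.Re (z - w) = complex.Re z - complex.Re w.
Proof. by case: z w => [? ?] [? ?]. Qed.

Lemma ImB z w : complex.Im (z - w) = complex.Im z - complex.Im w.
Proof. by case: z w => [? ?] [? ?]. Qed.

Lemma cderP g t d : cder g t d <-> forall e, 0 < e ->
  exists2 r, 0 < r & forall s, `|s - t| < r ->
    normc (g s - g t - d * (s - t)%:C) <= e * `|s - t|.
Proof.
split=> [[/is_deriveP h1 /is_deriveP h2] e e0|H].
  have e20 : 0 < e / 2 by rewrite divr_gt0.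
  have [r r0 hr] := h1 _ e20; have [r' r'0 hr'] := h2 _ e20.
  exists (Num.min r r'); first by rewrite lt_min r0.
  move=> s; rewrite lt_min => /andP[s1 s2].
  apply: le_trans (normc_le_abs _) _; rewrite !ReB !ImB Re_real_mul Im_real_mul.
  have := lerD (hr _ s1) (hr' _ s2); congr (_ <= _).
  by rewrite -mulrDl -splitr.
split; apply/is_deriveP => e /H[r r0 hr]; exists r => // s /hr; apply: le_trans.
  by apply: le_trans (Re_le_normc _); rewrite !ReB Re_real_mul.
by apply: le_trans (Im_le_normc _); rewrite !ImB Im_real_mul.
Qed.

Lemma cder_comp F g t d v : cdiff F (g t) d -> cder g t v ->
  cder (F \o g) t (d * v).
Proof.
move=> HF /cderP Hg; apply/cderP => e e0.
have v0 := normc_ge0 v; have d0 := normc_ge0 d.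
pose e1 := e / (2 * (normc v + 1)); have e10 : 0 < e1.
  by rewrite divr_gt0// mulr_gt0// ltr_wpDl.
(* The bound by 1 makes [g] Lipschitz at [t] with constant [normc v + 1]; the other bound absorbs
   the factor [d] in front of the error of [g]. *)
pose e2 := Num.min 1 (e / (2 * (normc d + 1))).
have e20 : 0 < e2 by rewrite lt_min ltr01/= divr_gt0// mulr_gt0// ltr_wpDl.
have [r r0 hr] := HF _ e10; have [r' r'0 hr'] := Hg _ e20.
pose M := normc v + 1; have M0 : 0 < M by rewrite ltr_wpDl.
exists (Num.min r' (r / M)); first by rewrite lt_min r'0 divr_gt0.
move=> s; rewrite lt_min => /andP[s1 s2].
have gM : normc (g s - g t) <= M * `|s - t|.
  rewrite -(subrK (v * (s - t)%:C) (g s - g t)).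
  apply: le_trans (le_normcD _ _) _; rewrite normcM.
  have -> : normc (s - t)%:C = `|s - t| by rewrite /= expr0n addr0 sqrtr_sqr.
  rewrite /M mulrDl addrC lerD2l; apply: le_trans (hr' _ s1) _.
  by rewrite ler_wpM2r// ge_min lexx.
have := hr (g s); rewrite (le_lt_trans gM) => [/(_ isT) H1|]; last first.
  by rewrite mulrC -ltr_pdivlMr.
have -> : (F \o g) s - (F \o g) t - d * v * (s - t)%:C =
  (F (g s) - F (g t) - d * (g s - g t)) + d * (g s - g t - v * (s - t)%:C).
  by rewrite /=; ring.
apply: le_trans (le_normcD _ _) _.
rewrite [in leRHS](splitr e) mulrDl; apply: lerD.
  apply: le_trans H1 _; apply: le_trans (ler_wpM2l (ltW e10) gM) _.
  rewrite mulrA /e1 /M ler_wpM2r// invfM mulrA -[leLHS]mulrA mulVf ?mulr1//.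
  by rewrite gt_eqF.
rewrite normcM; apply: le_trans (ler_wpM2l d0 (hr' _ s1)) _.
rewrite mulrA ler_wpM2r//.
apply: (@le_trans _ _ ((normc d + 1) * e2)).
  by rewrite ler_wpM2r ?lerDl// ltW.
apply: (@le_trans _ _ ((normc d + 1) * (e / (2 * (normc d + 1))))).
  by rewrite ler_wpM2l ?addr_ge0// ge_min lexx orbT.
have : normc d + 1 != 0 by rewrite gt_eqF// ltr_wpDl.
by move=> ?; rewrite le_eqVlt; apply/orP; left; apply/eqP; field.
Qed.

(** Unlike [dx], which has a default value where the derivative fails to exist, this relation also
    asserts that the derivative exists. *)
Definition pdx (U : R[i] -> R) z a := is_derive (complex.Re z) 1 (fun t => U (t +i* complex.Im z)) a.
Definition pdy (U : R[i] -> R) z a := is_derive (complex.Im z) 1 (fun t => U (complex.Re z +i* t)) a.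

Lemma cder_hline z : cder (fun t => t +i* complex.Im z) (complex.Re z) 1.
Proof. by split => /=; [exact: is_derive_id|exact: is_derive_cst]. Qed.

Lemma cder_vline z : cder (fun t => complex.Re z +i* t) (complex.Im z) 'i.
Proof. by split => /=; [exact: is_derive_cst|exact: is_derive_id]. Qed.

(** The Cauchy-Riemann equations: the horizontal line has velocity 1 and the vertical one velocity
    ['i], so the derivatives along them are [d] and [d * 'i]. *)
Lemma cdiff_partials F z d : cdiff F z d ->
  [/\ pdx (fun w => complex.Re (F w)) z (complex.Re d),
      pdx (fun w => complex.Im (F w)) z (complex.Im d),
      pdy (fun w => complex.Re (F w)) z (- complex.Im d) &
      pdy (fun w => complex.Im (F w)) z (complex.Re d)].
Proof.
move=> H; have ez : complex.Re z +i* complex.Im z = z by case: z H.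
have Hz : cdiff F (complex.Re z +i* complex.Im z) d by rewrite ez.
have [h1 h2] := cder_comp (g := fun t => t +i* complex.Im z) Hz (cder_hline z).
have [h3 h4] := cder_comp (g := fun t => complex.Re z +i* t) Hz (cder_vline z).
move: h1 h2 h3 h4; have -> : d * 'i = (- complex.Im d) +i* complex.Re d.
  by case: d {H Hz} => a b; simpc.
by rewrite mulr1.
Qed.

Lemma mean_value_le (h h' : R -> R) a b M : a <= b ->
  (forall t, a <= t <= b -> is_derive t 1 h (h' t)) ->
  (forall t, a <= t <= b -> `|h' t| <= M) -> `|h b - h a| <= M * (b - a).
Proof.
rewrite le_eqVlt => /predU1P[<-|ab] dh hM; first by rewrite !subrr normr0 mulr0.
have [||c /[!in_itv]/= /andP[ac cb] ->] := @MVT _ h h' _ _ ab.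
- by move=> x /[!in_itv]/= /andP[? ?]; apply: dh; rewrite !ltW.
- apply: derivable_within_continuous => x /[!in_itv]/= xab.
  by have [] := dh _ xab.
have ba : 0 <= b - a by rewrite subr_ge0 ltW.
by rewrite normrM (ger0_norm ba) ler_wpM2r// hM// (ltW ac) (ltW cb).
Qed.

Lemma is_derive_continuous h t a : is_derive t 1 h a -> {for t, continuous h}.
Proof. by move=> [h0 _]; apply: differentiable_continuous; exact/derivable1_diffP. Qed.

Lemma antiderivative_integral h a b : (forall t, a <= t <= b -> {for t, continuous h}) ->
  forall x, a < x < b ->
  is_derive x 1 (fun t => \int[@lebesgue_measure R]_(s in `[a, t]) h s)%R (h x).
Proof.
move=> ch x /andP[ax xb].
have ih : (@lebesgue_measure R).-integrable `[a, b] (EFin \o h).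
  apply: continuous_compact_integrable; first exact: segment_compact.
  apply: continuous_in_subspaceT => t /[!inE]/= /[!in_itv]/=.
  exact: ch.
have [] := continuous_FTC1_closed xb ih ax (ch x _); first by rewrite !ltW.
by move=> d <-; rewrite derive1E; exact: derivableP.
Qed.

End curves.

(** * Goursat's lemma *)

Section goursat.
Variable R : realType.
Implicit Types (z w : R[i]) (e : R) (T U A B : R[i] -> R).

Definition frechet U z a b := forall e, 0 < e ->
  exists2 r, 0 < r & forall w, normc (w - z) < r ->
  `|U w - U z - (a * (complex.Re w - complex.Re z) + b * (complex.Im w - complex.Im z))|
    <= e * normc (w - z).

(** For [T = PB - PA], with [PA] a primitive of [A] in x and [PB] a primitive of [B] in y, this is
    the integral of [A dx + B dy] around the rectangle, expressed without any integral. *)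
Definition rect_diff T (x0 x1 y0 y1 : R) :=
  T (x1 +i* y1) - T (x1 +i* y0) - T (x0 +i* y1) + T (x0 +i* y0).

Definition in_rect (x0 x1 y0 y1 : R) := [set w | x0 <= complex.Re w <= x1 /\ y0 <= complex.Im w <= y1].

(** The square of the size is what the subdivision argument needs: each halving loses a factor 4,
    and the squared size shrinks by the same factor. *)
Definition negligible_at T z := forall e, 0 < e -> exists2 r, 0 < r &
  forall x0 x1 y0 y1, in_rect x0 x1 y0 y1 z -> x1 - x0 + (y1 - y0) < r ->
  `|rect_diff T x0 x1 y0 y1| <= e * (x1 - x0 + (y1 - y0)) ^+ 2.

Let quarter T (x y w h : R) : exists s : R * R,
  [/\ (s.1 = x \/ s.1 = x + w / 2), (s.2 = y \/ s.2 = y + h / 2) &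
  `|rect_diff T x (x + w) y (y + h)| <=
    4 * `|rect_diff T s.1 (s.1 + w / 2) s.2 (s.2 + h / 2)|].
Proof.
set D := `|rect_diff T x (x + w) y (y + h)|.
pose Q a b := `|rect_diff T a (a + w / 2) b (b + h / 2)|.
have DQ : D <= Q x y + Q (x + w / 2) y + Q x (y + h / 2) + Q (x + w / 2) (y + h / 2).
  rewrite /D /Q.
  have -> : x + w = x + w / 2 + w / 2 by rewrite -addrA -splitr.
  have -> : y + h = y + h / 2 + h / 2 by rewrite -addrA -splitr.
  set a := x + w / 2; set b := y + h / 2; set c := a + _; set d := b + _.
  have -> : rect_diff T x c y d = rect_diff T x a y b + rect_diff T a c y b +
      rect_diff T x a b d + rect_diff T a c b d by rewrite /rect_diff; ring.
  apply: le_trans (ler_normD _ _) _; rewrite lerD2r.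
  apply: le_trans (ler_normD _ _) _; rewrite lerD2r.
  exact: ler_normD.
have [h1|h1] := leP D (4 * Q x y); first by exists (x, y); split => //; left.
have [h2|h2] := leP D (4 * Q (x + w / 2) y).
  by exists (x + w / 2, y); split => //; [right|left].
have [h3|h3] := leP D (4 * Q x (y + h / 2)).
  by exists (x, y + h / 2); split => //; [left|right].
have [h4|h4] := leP D (4 * Q (x + w / 2) (y + h / 2)).
  by exists (x + w / 2, y + h / 2); split => //; right.
by exfalso; lra.
Qed.

Lemma nested_intervals (a l : nat -> R) :
  (forall n, a n <= a n.+1) -> (forall n, a n.+1 + l n.+1 <= a n + l n) ->
  (forall n, 0 <= l n) -> exists c, forall n, a n <= c <= a n + l n.
Proof.
move=> a1 a2 l0.
have amono m n : (m <= n)%N -> a m <= a n.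
  by apply: (@homo_leq _ a <=%R) => // ? ? ?; exact: le_trans.
have bmono m n : (m <= n)%N -> a n + l n <= a m + l m.
  by apply: (@homo_leq _ (fun k => a k + l k) (fun x y => y <= x)) => // ? ? ? h1 h2; exact: le_trans h2 h1.
have ub n : ubound (range a) (a n + l n).
  move=> _ [m _ <-]; have [mn|nm] := leqP m n.
    by rewrite (le_trans (amono _ _ mn))// lerDl.
  by rewrite (le_trans _ (bmono _ _ (ltnW nm)))// lerDl.
exists (sup (range a)) => n; apply/andP; split.
  by apply: ub_le_sup; [exists (a 0%N + l 0%N)|exists n].
by apply: ge_sup; [exists (a 0%N); exists 0%N|].
Qed.

(* One of the four quarters of a rectangle carries at least a quarter of its difference, and the differences of
   nested quarters are negligible at their common point. *)
Lemma rect_diff_eq0 T x0 x1 y0 y1 : x0 <= x1 -> y0 <= y1 ->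
  (forall z, in_rect x0 x1 y0 y1 z -> negligible_at T z) ->
  rect_diff T x0 x1 y0 y1 = 0.
Proof.
move=> x01 y01 HT; set w := x1 - x0; set h := y1 - y0.
have w0 : 0 <= w by rewrite subr_ge0.
have h0 : 0 <= h by rewrite subr_ge0.
pose W n := w / 2 ^+ n; pose H n := h / 2 ^+ n.
have WS n : W n.+1 = W n / 2 by rewrite /W exprS invfM mulrA mulrAC.
have HS n : H n.+1 = H n / 2 by rewrite /H exprS invfM mulrA mulrAC.
have W0 n : 0 <= W n by rewrite divr_ge0// exprn_ge0.
have H0 n : 0 <= H n by rewrite divr_ge0// exprn_ge0.
(* A state is a level together with a lower left corner. The level is part of the state because the
   sides [W] and [H] of the current rectangle depend on it. *)
pose P (p s : nat * (R * R)) := [/\ s.1 = p.1.+1,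
  (s.2.1 = p.2.1 \/ s.2.1 = p.2.1 + W p.1 / 2), (s.2.2 = p.2.2 \/ s.2.2 = p.2.2 + H p.1 / 2) &
  `|rect_diff T p.2.1 (p.2.1 + W p.1) p.2.2 (p.2.2 + H p.1)| <=
    4 * `|rect_diff T s.2.1 (s.2.1 + W p.1 / 2) s.2.2 (s.2.2 + H p.1 / 2)|].
have ex p : exists s, P p s.
  case: p => n [x y].
  by have [s [s1 s2 s3]] := quarter T x y (W n) (H n); exists (n.+1, s).
have [F HF] := choice ex.
pose S n := iter n F (0%N, (x0, y0)).
have S1 n : (S n).1 = n by elim: n => // n IH; have [-> _ _ _] := HF (S n); rewrite IH.
pose a n := (S n).2.1; pose b n := (S n).2.2.
have step n : [/\ a n.+1 = a n \/ a n.+1 = a n + W n / 2, b n.+1 = b n \/ b n.+1 = b n + H n / 2 &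
   `|rect_diff T (a n) (a n + W n) (b n) (b n + H n)| <=
    4 * `|rect_diff T (a n.+1) (a n.+1 + W n.+1) (b n.+1) (b n.+1 + H n.+1)|].
  by have [_] := HF (S n); rewrite -/(S n.+1) S1 -WS -HS.
have [p Hp] : exists c, forall n, a n <= c <= a n + W n.
  apply: nested_intervals => // n; have := W0 n; have := WS n;
  by have [[|] -> _ _] := step n; lra.
have [q Hq] : exists c, forall n, b n <= c <= b n + H n.
  apply: nested_intervals => // n; have := H0 n; have := HS n;
  by have [_ [|] -> _] := step n; lra.
have low n : `|rect_diff T x0 x1 y0 y1| <=
    4 ^+ n * `|rect_diff T (a n) (a n + W n) (b n) (b n + H n)|.
  elim: n => [|n IH].
    rewrite expr0 mul1r /W /H expr0 !divr1 /a /b /=.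
    by rewrite /w /h ![_ + (_ - _)]addrC !subrK.
  apply: le_trans IH _; rewrite exprSr -mulrA ler_pM2l ?exprn_gt0//.
  by have [] := step n.
have pq : in_rect x0 x1 y0 y1 (p +i* q).
  have := Hp 0%N; have := Hq 0%N; rewrite /W /H expr0 !divr1 /a /b /= /w /h.
  by rewrite ![_ + (_ - _)]addrC !subrK.
apply/eqP; rewrite -normr_le0; apply/ler_addgt0Pl => e e0; rewrite addr0.
(* The factor [4 ^+ n] exactly cancels the decay of the squared size, leaving [(w + h) ^+ 2];
   dividing [e] by [M] compensates, and the summand 1 keeps [M] positive for a degenerate
   rectangle. *)
pose M := (w + h) ^+ 2 + 1; have M0 : 0 < M by rewrite ltr_wpDl// sqr_ge0.
have [|r r0 hr] := HT _ pq (e / M); first by rewrite divr_gt0.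
have [n hn] : exists n, (w + h) / 2 ^+ n < r.
  exists (Num.bound ((w + h) / r)).
  by rewrite ltr_pdivrMr ?exprn_gt0// -ltr_pdivrMl// mulrC; exact: upper_nthrootP.
apply: le_trans (low n) _.
have wh : a n + W n - a n + (b n + H n - b n) = (w + h) / 2 ^+ n.
  by rewrite /W /H; set i := (2 ^+ n)^-1; ring.
have := hr (a n) (a n + W n) (b n) (b n + H n); rewrite wh => /(_ _ hn) H1.
apply: le_trans (ler_wpM2l _ (H1 _)) _; [by rewrite exprn_ge0|by split|].
have -> : (4 : R) ^+ n = (2 ^+ n) ^+ 2.
  by rewrite -exprM mulnC exprM; congr (_ ^+ _); rewrite -natrX.
have -> : (2 ^+ n) ^+ 2 * (e / M * ((w + h) / 2 ^+ n) ^+ 2) = e * ((w + h) ^+ 2 / M).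
  by field; rewrite gt_eqF//= expf_neq0.
apply: ler_piMr; first exact: ltW.
by rewrite ler_pdivrMr// mul1r /M lerDl.
Qed.

(** The alternative [a = x \/ a < p] says that the strip cut off is either degenerate or disjoint
    from the line through [p]; its rectangle difference vanishes in both cases. *)
Let cut_left (x p d : R) : x <= p -> 0 < d ->
  exists a, [/\ x <= a, a <= p, p - d <= a & a = x \/ a < p].
Proof.
move=> xp d0; have [h|h] := leP x (p - d); last by exists x; split => //; [exact: ltW|left].
by exists (p - d); split => //; [lra|right; lra].
Qed.

Let cut_right (x p d : R) : p <= x -> 0 < d ->
  exists b, [/\ b <= x, p <= b, b <= p + d & b = x \/ p < b].
Proof.
move=> xp d0; have [h|h] := leP (p + d) x; last by exists x; split => //; [exact: ltW|left].
by exists (p + d); split => //; [lra|right; lra].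
Qed.

Let sub_itv (x0 x1 a b t : R) : x0 <= a -> b <= x1 -> a <= t <= b -> x0 <= t <= x1.
Proof. by move=> h1 h2 /andP[h3 h4]; rewrite (le_trans h1 h3) (le_trans h4 h2). Qed.

Let itv_dist (a b p d t : R) : p - d <= a -> b <= p + d -> a <= t <= b -> `|t - p| <= d.
Proof. by move=> h1 h2 /andP[h3 h4]; rewrite ler_norml; apply/andP; split; lra. Qed.

Let double_lt (r d : R) : 0 < r -> d <= r / 5 -> d + d < r.
Proof. by move=> *; lra. Qed.

Let len_le (a b p d : R) : p - d <= a -> b <= p + d -> b - a <= 2 * d.
Proof. by move=> *; lra. Qed.

Section primitive.
Variables (A B PA PB : R[i] -> R) (z0 : R[i]) (rho : R).
Hypothesis dPA : forall z, box z0 rho z -> pdx PA z (A z).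
Hypothesis dPB : forall z, box z0 rho z -> pdy PB z (B z).
Let T w := PB w - PA w.

(** The shared coefficient [b] is the closedness of [A dx + B dy]: it makes the affine
    approximations of [A] and [B] at [z] contribute nothing to the rectangle difference. The
    remainders are small against the size, and are integrated over sides of at most that size. *)
Lemma closed_form_negligible z a b c : box z0 rho z ->
  frechet A z a b -> frechet B z b c -> negligible_at T z.
Proof.
move=> zbox fA fB e e0.
have [s s0 sbox] : exists2 s, 0 < s & forall w, normc (w - z) < s -> box z0 rho w.
  by apply/nbhs_normcP; apply: open_nbhs_nbhs; split => //; exact: box_open.
have e20 : 0 < e / 2 by rewrite divr_gt0.
have [r1 r10 h1] := fA _ e20; have [r2 r20 h2] := fB _ e20.
exists (Num.min s (Num.min r1 r2)); first by rewrite !lt_min s0 r10 r20.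
move=> x0 x1 y0 y1 [/andP[x0z zx1] /andP[y0z zy1]]; rewrite !lt_min.
move: x0z zx1 y0z zy1; set p := complex.Re z; set q := complex.Im z.
move=> x0z zx1 y0z zy1; set S := x1 - x0 + (y1 - y0).
move=> /andP[Ss /andP[S1 S2]].
have near x y : x0 <= x <= x1 -> y0 <= y <= y1 -> normc (x +i* y - z) <= S.
  move=> /andP[? ?] /andP[? ?]; apply: le_trans (normc_le_abs _) _.
  rewrite ReB ImB /= -/p -/q /S; apply: lerD; rewrite ler_norml; apply/andP; split; lra.
have inb x y : x0 <= x <= x1 -> y0 <= y <= y1 -> box z0 rho (x +i* y).
  by move=> hx hy; apply: sbox; exact: le_lt_trans (near _ _ hx hy) Ss.
have HA y : y0 <= y <= y1 -> `|(PA (x1 +i* y) - (A z * x1 + a * (x1 - p) ^+ 2 / 2 + b * (y - q) * x1)) -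
    (PA (x0 +i* y) - (A z * x0 + a * (x0 - p) ^+ 2 / 2 + b * (y - q) * x0))| <= (e / 2 * S) * (x1 - x0).
  move=> hy.
  apply: (@mean_value_le R (fun t => PA (t +i* y) - (A z * t + a * (t - p) ^+ 2 / 2 + b * (y - q) * t))
    (fun t => A (t +i* y) - (A z + a * (t - p) + b * (y - q)))); first lra.
    move=> t ht; have d0 : is_derive t 1 (fun t => PA (t +i* y)) (A (t +i* y)).
      exact: dPA (inb _ _ ht hy).
    apply: is_deriveB.
    by apply: is_derive_eq; rewrite /GRing.scale/=; field.
  move=> t ht; have := h1 (t +i* y); rewrite (le_lt_trans (near _ _ ht hy) S1) => /(_ isT) /=.
  rewrite -/p -/q => H; rewrite [X in `|X|](_ : _ = A (t +i* y) - A z - (a * (t - p) + b * (y - q))); last by ring.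
  apply: le_trans H _.
  by apply: ler_wpM2l; [exact: ltW|exact: near].
have HB x : x0 <= x <= x1 -> `|(PB (x +i* y1) - (B z * y1 + c * (y1 - q) ^+ 2 / 2 + b * (x - p) * y1)) -
    (PB (x +i* y0) - (B z * y0 + c * (y0 - q) ^+ 2 / 2 + b * (x - p) * y0))| <= (e / 2 * S) * (y1 - y0).
  move=> hx.
  apply: (@mean_value_le R (fun t => PB (x +i* t) - (B z * t + c * (t - q) ^+ 2 / 2 + b * (x - p) * t))
    (fun t => B (x +i* t) - (B z + c * (t - q) + b * (x - p)))); first lra.
    move=> t ht; have d0 : is_derive t 1 (fun t => PB (x +i* t)) (B (x +i* t)).
      exact: dPB (inb _ _ hx ht).
    apply: is_deriveB.
    by apply: is_derive_eq; rewrite /GRing.scale/=; field.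
  move=> t ht; have := h2 (x +i* t); rewrite (le_lt_trans (near _ _ hx ht) S2) => /(_ isT) /=.
  rewrite -/p -/q => H; rewrite [X in `|X|](_ : _ = B (x +i* t) - B z - (b * (x - p) + c * (t - q))); last by ring.
  apply: le_trans H _.
  by apply: ler_wpM2l; [exact: ltW|exact: near].
have y00 : y0 <= y0 <= y1 by apply/andP; split; lra.
have y11 : y0 <= y1 <= y1 by apply/andP; split; lra.
have x00 : x0 <= x0 <= x1 by apply/andP; split; lra.
have x11 : x0 <= x1 <= x1 by apply/andP; split; lra.
move: (HA _ y00) (HA _ y11) (HB _ x00) (HB _ x11).
set A0 := (X in `|X| <= _ -> _); set A1 := (X in _ -> `|X| <= _ -> _).
set B0 := (X in _ -> _ -> `|X| <= _ -> _); set B1 := (X in _ -> _ -> _ -> `|X| <= _ -> _).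
have -> : rect_diff T x0 x1 y0 y1 = (B1 - B0) - (A1 - A0).
  by rewrite /rect_diff /T /A0 /A1 /B0 /B1; ring.
move=> k1 k2 k3 k4; apply: le_trans (ler_normB _ _) _.
apply: (@le_trans _ _ ((`|B1| + `|B0|) + (`|A1| + `|A0|))).
  by apply: lerD; exact: ler_normB.
have -> : e * S ^+ 2 = (e / 2 * S * (y1 - y0) + e / 2 * S * (y1 - y0)) +
   (e / 2 * S * (x1 - x0) + e / 2 * S * (x1 - x0)).
  by rewrite /S; field.
by apply: lerD; exact: lerD.
Qed.

Variable w0 : R[i].
Hypothesis cA : {for w0, continuous A}.
Hypothesis cB : {for w0, continuous B}.
Hypothesis closedAB : forall z, box z0 rho z -> z != w0 -> exists a b c, frechet A z a b /\ frechet B z b c.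

Let inb x0 x1 y0 y1 := forall x y, x0 <= x <= x1 -> y0 <= y <= y1 -> box z0 rho (x +i* y).

Lemma rect_diff_regular x0 x1 y0 y1 : x0 <= x1 -> y0 <= y1 -> inb x0 x1 y0 y1 ->
  ~ in_rect x0 x1 y0 y1 w0 -> rect_diff T x0 x1 y0 y1 = 0.
Proof.
move=> x01 y01 ib nw; apply: rect_diff_eq0 => // z zr.
have zb : box z0 rho z by case: z zr => x y [hx hy]; exact: ib.
have zw : z != w0 by apply: contra_notN nw => /eqP <-.
by have [a [b [c [fA fB]]]] := closedAB zb zw; exact: closed_form_negligible fA fB.
Qed.

(* The exceptional point [w0] is cut out by a small square, on which [A] and [B] are bounded. *)
Lemma rect_diff_box x0 x1 y0 y1 : x0 <= x1 -> y0 <= y1 -> inb x0 x1 y0 y1 ->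
  rect_diff T x0 x1 y0 y1 = 0.
Proof.
move=> x01 y01 ib; have [w0r|] := pselect (in_rect x0 x1 y0 y1 w0); last exact: rect_diff_regular.
have [M [r [r0 M0 AM BM]]] : exists M r, [/\ 0 < r, 0 <= M,
    (forall w, normc (w - w0) < r -> `|A w| <= M) &
    (forall w, normc (w - w0) < r -> `|B w| <= M)].
  move/cvgrPdist_lt : cA => /(_ 1 ltr01) /nbhs_normcP[r r0 hr].
  move/cvgrPdist_lt : cB => /(_ 1 ltr01) /nbhs_normcP[s s0 hs].
  exists (1 + (`|A w0| + `|B w0|)), (Num.min r s); split.
  - by rewrite lt_min r0.
  - by rewrite !addr_ge0.
  - move=> w; rewrite lt_min => /andP[/hr + _]; rewrite distrC => H.
    rewrite -(subrK (A w0) (A w)) (le_trans (ler_normD _ _))//.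
    by apply: lerD; [exact: ltW|rewrite lerDl].
  - move=> w; rewrite lt_min => /andP[_ /hs +]; rewrite distrC => H.
    rewrite -(subrK (B w0) (B w)) (le_trans (ler_normD _ _))//.
    by apply: lerD; [exact: ltW|rewrite lerDr].
apply/eqP; rewrite -normr_le0; apply/ler_addgt0Pl => e e0; rewrite addr0.
(* [r / 5] keeps the square around [w0] in the disc where [A] and [B] are at most [M]. Its four
   sides have length at most [2 * d], whence the constant [8 * M]. *)
pose d := Num.min (r / 5) (e / (8 * M + 1)).
have d0 : 0 < d by rewrite lt_min !divr_gt0// ltr_wpDl// mulr_ge0.
have d5 : d <= r / 5 by rewrite ge_min lexx.
have d8 : d <= e / (8 * M + 1) by rewrite ge_min lexx orbT.
clearbody d.
case: w0r; set p := complex.Re w0; set q := complex.Im w0 => /andP[px0 px1] /andP[qy0 qy1].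
have [a [xa ap pa Da]] := cut_left px0 d0.
have [b [bx pb bp Db]] := cut_right px1 d0.
have [c [yc cq qc Dc]] := cut_left qy0 d0.
have [c' [cy qc' cq' Dc']] := cut_right qy1 d0.
have ab : a <= b by exact: le_trans ap pb.
have cc : c <= c' by exact: le_trans cq qc'.
have Z1 : rect_diff T x0 a y0 y1 = 0.
  case: Da => [->|ltap]; first by rewrite /rect_diff; ring.
  apply: rect_diff_regular => //.
    by move=> x y hx hy; apply: ib => //; apply: sub_itv hx => //; exact: le_trans ab bx.
  by move=> [/andP[_ +] _]; apply/negP; rewrite -ltNge.
have Z2 : rect_diff T b x1 y0 y1 = 0.
  case: Db => [->|ltap]; first by rewrite /rect_diff; ring.
  apply: rect_diff_regular => //.
    by move=> x y hx hy; apply: ib => //; apply: sub_itv hx => //; exact: le_trans xa ab.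
  by move=> [/andP[+ _] _]; apply/negP; rewrite -ltNge.
have Z3 : rect_diff T a b y0 c = 0.
  case: Dc => [->|ltap]; first by rewrite /rect_diff; ring.
  apply: rect_diff_regular => //.
    move=> x y hx hy; apply: ib; first exact: sub_itv hx.
    by apply: sub_itv hy => //; exact: le_trans cc cy.
  by move=> [_ /andP[_ +]]; apply/negP; rewrite -ltNge.
have Z4 : rect_diff T a b c' y1 = 0.
  case: Dc' => [->|ltap]; first by rewrite /rect_diff; ring.
  apply: rect_diff_regular => //.
    move=> x y hx hy; apply: ib; first exact: sub_itv hx.
    by apply: sub_itv hy => //; exact: le_trans yc cc.
  by move=> [_ /andP[+ _]]; apply/negP; rewrite -ltNge.
have -> : rect_diff T x0 x1 y0 y1 = rect_diff T x0 a y0 y1 + rect_diff T b x1 y0 y1 +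
   rect_diff T a b y0 c + rect_diff T a b c' y1 + rect_diff T a b c c'.
  by rewrite /rect_diff; ring.
rewrite Z1 Z2 Z3 Z4 !add0r.
have near x y : a <= x <= b -> c <= y <= c' -> normc (x +i* y - w0) < r.
  move=> hx hy; apply: le_lt_trans (normc_le_abs _) _.
  rewrite ReB ImB /= -/p -/q; apply: (@le_lt_trans _ _ (d + d)).
    by apply: lerD; [exact: itv_dist hx|exact: itv_dist hy].
  exact: double_lt r0 d5.
have HA y : c <= y <= c' -> `|PA (b +i* y) - PA (a +i* y)| <= M * (b - a).
  move=> hy; apply: (@mean_value_le R (fun t => PA (t +i* y)) (fun t => A (t +i* y))) => //.
    move=> t ht; apply: (dPA (z := t +i* y)).
    by apply: ib; [exact: sub_itv ht|exact: sub_itv hy].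
  by move=> t ht; apply: AM; exact: near.
have HB x : a <= x <= b -> `|PB (x +i* c') - PB (x +i* c)| <= M * (c' - c).
  move=> hx; apply: (@mean_value_le R (fun t => PB (x +i* t)) (fun t => B (x +i* t))) => //.
    move=> t ht; apply: (dPB (z := x +i* t)).
    by apply: ib; [exact: sub_itv hx|exact: sub_itv ht].
  by move=> t ht; apply: BM; exact: near.
have caa : c <= c <= c' by rewrite lexx.
have cbb : c <= c' <= c' by rewrite lexx andbT.
have aaa : a <= a <= b by rewrite lexx.
have abb : a <= b <= b by rewrite lexx andbT.
have k1 := HA _ caa; have k2 := HA _ cbb; have k3 := HB _ aaa; have k4 := HB _ abb.
have -> : rect_diff T a b c c' = ((PB (b +i* c') - PB (b +i* c)) - (PB (a +i* c') - PB (a +i* c))) -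
   ((PA (b +i* c') - PA (a +i* c')) - (PA (b +i* c) - PA (a +i* c))) by rewrite /rect_diff /T; ring.
apply: le_trans (ler_normB _ _) _.
apply: le_trans (lerD (ler_normB _ _) (ler_normB _ _)) _.
apply: le_trans (lerD (lerD k4 k3) (lerD k2 k1)) _.
apply: (@le_trans _ _ (8 * M * d)).
  have H1 : M * (c' - c) <= M * (2 * d) by rewrite ler_wpM2l//; exact: len_le qc cq'.
  have H2 : M * (b - a) <= M * (2 * d) by rewrite ler_wpM2l//; exact: len_le pa bp.
  by move: H1 H2; set X := M * _; set Y := M * (b - a); rewrite mulrCA -!mulrA; set Z := M * d; lra.
apply: (@le_trans _ _ ((8 * M + 1) * d)); first by apply: ler_wpM2r; [exact: ltW|rewrite lerDl].
have M1 : 0 < 8 * M + 1 by rewrite ltr_wpDl// mulr_ge0.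
by rewrite -ler_pdivlMl// mulrC.
Qed.

End primitive.

Let between_dist (x y c d t : R) : `|x - c| < d -> `|y - c| < d ->
  Num.min x y <= t <= Num.max x y -> `|t - c| < d.
Proof.
rewrite !ltr_norml ge_min le_max.
move=> /andP[? ?] /andP[? ?] /andP[/orP[|] ? /orP[|] ?]; apply/andP; split; lra.
Qed.

Lemma box_in z0 rho x y z w : box z0 rho z -> box z0 rho w ->
  Num.min (complex.Re z) (complex.Re w) <= x <= Num.max (complex.Re z) (complex.Re w) ->
  Num.min (complex.Im z) (complex.Im w) <= y <= Num.max (complex.Im z) (complex.Im w) ->
  box z0 rho (x +i* y).
Proof.
by move=> [zx zy] [wx wy] hx hy; split; [exact: between_dist hx|exact: between_dist hy].
Qed.

(** Vanishing rectangle differences mean that [PB - PA] is a function of x plus a function of y, so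
    the two partial primitives can be corrected into a single one. *)
Lemma closed_form_primitive A B z0 rho rho' w0 : 0 < rho < rho' ->
  (forall z, box z0 rho' z -> {for z, continuous A} /\ {for z, continuous B}) ->
  box z0 rho w0 ->
  (forall z, box z0 rho z -> z != w0 -> exists a b c, frechet A z a b /\ frechet B z b c) ->
  exists U, forall z, box z0 rho z -> pdx U z (A z) /\ pdy U z (B z).
Proof.
move=> /andP[rho0 rr] cAB w0b clAB.
(* Integration starts outside the inner box but inside the outer one: points of the inner box are
   then interior to the interval of integration, and the integrand is still continuous. *)
pose s := (rho + rho') / 2.
have hs : rho < s < rho' by rewrite /s; apply/andP; split; lra.
have /andP[hs1 hs2] := hs.
pose PA w := (\int[@lebesgue_measure R]_(t in `[(complex.Re z0 - s)%R, complex.Re w]) A (t +i* complex.Im w))%R.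
pose PB w := (\int[@lebesgue_measure R]_(t in `[(complex.Im z0 - s)%R, complex.Im w]) B (complex.Re w +i* t))%R.
have chl z : continuous (fun t => t +i* complex.Im z).
  by move=> t; apply/continuous_ReP; split => /=; [exact: cvg_id|exact: cvg_cst].
have cvl z : continuous (fun t => complex.Re z +i* t).
  by move=> t; apply/continuous_ReP; split => /=; [exact: cvg_cst|exact: cvg_id].
have dPA z : box z0 rho z -> pdx PA z (A z).
  move=> [zx zy].
  have -> : A z = (fun t => A (t +i* complex.Im z)) (complex.Re z) by case: (z).
  apply: (@antiderivative_integral R (fun t => A (t +i* complex.Im z)) _ (complex.Re z0 + s)).
    move=> t ht; apply: (continuous_comp (@chl z t)) => /=.
    have [] // : {for t +i* complex.Im z, continuous A} /\ {for t +i* complex.Im z, continuous B}.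
    apply: cAB; split => /=; last lra.
    rewrite ltr_norml; move/andP : ht => [? ?]; apply/andP; split; lra.
  by move: zx; rewrite ltr_norml => /andP[? ?]; apply/andP; split; lra.
have dPB z : box z0 rho z -> pdy PB z (B z).
  move=> [zx zy].
  have -> : B z = (fun t => B (complex.Re z +i* t)) (complex.Im z) by case: (z).
  apply: (@antiderivative_integral R (fun t => B (complex.Re z +i* t)) _ (complex.Im z0 + s)).
    move=> t ht; apply: (continuous_comp (@cvl z t)) => /=.
    have [] // : {for complex.Re z +i* t, continuous A} /\ {for complex.Re z +i* t, continuous B}.
    apply: cAB; split => /=; first lra.
    rewrite ltr_norml; move/andP : ht => [? ?]; apply/andP; split; lra.
  by move: zy; rewrite ltr_norml => /andP[? ?]; apply/andP; split; lra.
have w0b' : box z0 rho' w0 by case: w0b => ? ?; split; lra.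
have [cA cB] := cAB _ w0b'.
have RD := rect_diff_box dPA dPB cA cB clAB.
pose T w := PB w - PA w.
have z0b : box z0 rho z0 by exact: box_center.
have TE z : box z0 rho z -> T z = T (complex.Re z +i* complex.Im z0) +
    T (complex.Re z0 +i* complex.Im z) - T z0.
  move=> zb.
  have k (x0 x1 y0 y1 : R) : x0 <= x1 -> y0 <= y1 ->
     (x0 = Num.min (complex.Re z) (complex.Re z0)) -> x1 = Num.max (complex.Re z) (complex.Re z0) ->
     y0 = Num.min (complex.Im z) (complex.Im z0) -> y1 = Num.max (complex.Im z) (complex.Im z0) ->
     rect_diff T x0 x1 y0 y1 = 0.
    by move=> h1 h2 e1 e2 e3 e4; apply: RD => // x y; rewrite e1 e2 e3 e4; exact: box_in.
  have ez : z = complex.Re z +i* complex.Im z by case: (z).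
  have ez0 : z0 = complex.Re z0 +i* complex.Im z0 by case: (z0).
  rewrite {1}ez [T z0](congr1 T ez0).
  have [xx|xx] := leP (complex.Re z) (complex.Re z0); have [yy|yy] := leP (complex.Im z) (complex.Im z0).
  - have := k _ _ _ _ xx yy; rewrite (min_l xx) (max_r xx) (min_l yy) (max_r yy).
    by move=> /(_ erefl erefl erefl erefl); rewrite /rect_diff; lra.
  - have := k _ _ _ _ xx (ltW yy); rewrite (min_l xx) (max_r xx) (min_r (ltW yy)) (max_l (ltW yy)).
    by move=> /(_ erefl erefl erefl erefl); rewrite /rect_diff; lra.
  - have := k _ _ _ _ (ltW xx) yy; rewrite (min_r (ltW xx)) (max_l (ltW xx)) (min_l yy) (max_r yy).
    by move=> /(_ erefl erefl erefl erefl); rewrite /rect_diff; lra.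
  - have := k _ _ _ _ (ltW xx) (ltW yy); rewrite (min_r (ltW xx)) (max_l (ltW xx)) (min_r (ltW yy)) (max_l (ltW yy)).
    by move=> /(_ erefl erefl erefl erefl); rewrite /rect_diff; lra.
(* The added term depends on y only and leaves the x-derivative unchanged; by [TE], [U] differs from
   [PB] by a function of x only. *)
pose U w := PA w + T (complex.Re z0 +i* complex.Im w).
exists U => z zb; split.
  have d0 := dPA _ zb.
  have d1 : is_derive (complex.Re z) (1 : R) (fun=> T (complex.Re z0 +i* complex.Im z)) 0.
    exact: is_derive_cst.
  by rewrite -[A z]addr0; exact: (is_deriveD d0 d1).
have d0 := dPB _ zb.
have : is_derive (complex.Im z) 1 (fun t => PB (complex.Re z +i* t) - (T (complex.Re z +i* complex.Im z0) - T z0)) (B z).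
  have d1 : is_derive (complex.Im z) (1 : R) (fun=> T (complex.Re z +i* complex.Im z0) - T z0) 0.
    exact: is_derive_cst.
  by rewrite -[B z]subr0; exact: (is_deriveB d0 d1).
apply: is_derive_near.
have nb : nbhs (complex.Im z) [set t | box z0 rho (complex.Re z +i* t)].
  apply: (cvl z); apply: open_nbhs_nbhs; split; first exact: box_open.
  by case: (z) zb.
apply: filterS nb => t tb; rewrite /U /=.
by have := TE _ tb; rewrite /T /=; lra.
Qed.

End goursat.

(** * Complex primitives and integrals over a period *)

Section cauchy.
Variable R : realType.
Implicit Types (z w : R[i]) (e : R) (f g F : R[i] -> R[i]).

Lemma mean_value_dist (h h' : R -> R) (a b M : R) :
  (forall t, Num.min a b <= t <= Num.max a b -> is_derive t 1 h (h' t)) ->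
  (forall t, Num.min a b <= t <= Num.max a b -> `|h' t| <= M) -> `|h b - h a| <= M * `|b - a|.
Proof.
have [ab|ab] := leP a b.
  by move=> dh hM; rewrite [X in _ * X]ger0_norm ?subr_ge0//; exact: mean_value_le dh hM.
by move=> dh hM; rewrite distrC [X in _ * X]distrC [X in _ * X]ger0_norm ?subr_ge0 ?(ltW ab)//; exact: mean_value_le (ltW ab) dh hM.
Qed.

(** The increment is split at the corner [complex.Re z +i* complex.Im w], and the mean value theorem
    is applied on each leg after subtracting the linear part. *)
Lemma frechet_of_partials (U A B : R[i] -> R) z rho : 0 < rho ->
  (forall w, box z rho w -> pdx U w (A w)) -> (forall w, box z rho w -> pdy U w (B w)) ->
  {for z, continuous A} -> {for z, continuous B} -> frechet U z (A z) (B z).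
Proof.
move=> rho0 dU dV cA cB e e0; have e20 : 0 < e / 2 by rewrite divr_gt0.
move/cvgrPdist_lt : cA => /(_ _ e20) /nbhs_boxP[r r0 hr].
move/cvgrPdist_lt : cB => /(_ _ e20) /nbhs_boxP[s s0 hs].
pose m := Num.min rho (Num.min r s).
have m0 : 0 < m by rewrite !lt_min rho0 r0.
exists m => // w wm.
have zw t c : Num.min (complex.Re z) (complex.Re w) <= t <= Num.max (complex.Re z) (complex.Re w) ->
  Num.min (complex.Im z) (complex.Im w) <= c <= Num.max (complex.Im z) (complex.Im w) ->
  box z m (t +i* c).
  apply: box_in; first exact: box_center.
  by split; apply: le_lt_trans wm; rewrite -?ReB -?ImB ?Re_le_normc ?Im_le_normc.
have m1 v : box z m v -> [/\ box z rho v, box z r v & box z s v].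
  have [k1 k2 k3] : [/\ m <= rho, m <= r & m <= s] by rewrite /m !ge_min !lexx !orbT.
  move=> [h1 h2]; have Bm y : m <= y -> box z y v.
    by move=> my; split; [exact: lt_le_trans h1 my|exact: lt_le_trans h2 my].
  by split; exact: Bm.
have mi (x y : R) : Num.min x y <= y <= Num.max x y by rewrite ge_min le_max !lexx !orbT.
have mi' (x y : R) : Num.min x y <= x <= Num.max x y by rewrite ge_min le_max !lexx.
have H1 : `|(U w - A z * complex.Re w) - (U (complex.Re z +i* complex.Im w) - A z * complex.Re z)| <= e / 2 * `|complex.Re w - complex.Re z|.
  have -> : U w = U (complex.Re w +i* complex.Im w) by case: (w).
  apply: (@mean_value_dist (fun t => U (t +i* complex.Im w) - A z * t) (fun t => A (t +i* complex.Im w) - A z)) => t ht.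
    have [tb _ _] := m1 _ (zw _ _ ht (mi _ _)); have d0 := dU _ tb.
    apply: is_deriveB d0 _.
    by apply: is_derive_eq; rewrite /GRing.scale/= mulr1.
  have [_ tb _] := m1 _ (zw _ _ ht (mi _ _)).
  by rewrite distrC ltW// hr.
have H2 : `|(U (complex.Re z +i* complex.Im w) - B z * complex.Im w) - (U z - B z * complex.Im z)| <= e / 2 * `|complex.Im w - complex.Im z|.
  have -> : U z = U (complex.Re z +i* complex.Im z) by case: (z).
  apply: (@mean_value_dist (fun t => U (complex.Re z +i* t) - B z * t) (fun t => B (complex.Re z +i* t) - B z)) => t ht.
    have [tb _ _] := m1 _ (zw _ _ (mi' _ _) ht); have d0 := dV _ tb.
    apply: is_deriveB d0 _.
    by apply: is_derive_eq; rewrite /GRing.scale/= mulr1.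
  have [_ _ tb] := m1 _ (zw _ _ (mi' _ _) ht).
  by rewrite distrC ltW// hs.
rewrite [X in `|X|](_ : _ = ((U w - A z * complex.Re w) - (U (complex.Re z +i* complex.Im w) - A z * complex.Re z)) + ((U (complex.Re z +i* complex.Im w) - B z * complex.Im w) - (U z - B z * complex.Im z))); last by ring.
apply: le_trans (ler_normD _ _) _; apply: le_trans (lerD H1 H2) _.
rewrite [in leRHS](splitr e) [in leRHS]mulrDl; apply: lerD; apply: ler_wpM2l; try exact: ltW.
  by rewrite -ReB Re_le_normc.
by rewrite -ImB Im_le_normc.
Qed.

Lemma cdiff_frechet f z d : cdiff f z d <->
  frechet (fun w => complex.Re (f w)) z (complex.Re d) (- complex.Im d) /\
  frechet (fun w => complex.Im (f w)) z (complex.Im d) (complex.Re d).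
Proof.
have E w : f w - f z - d * (w - z) =
 (complex.Re (f w) - complex.Re (f z) - (complex.Re d * (complex.Re w - complex.Re z) + (- complex.Im d) * (complex.Im w - complex.Im z)))
 +i* (complex.Im (f w) - complex.Im (f z) - (complex.Im d * (complex.Re w - complex.Re z) + complex.Re d * (complex.Im w - complex.Im z))).
  by case: d w z (f w) (f z) => [d1 d2] [x y] [x' y'] [a b] [a' b'];
  apply/eqP; rewrite eq_complex /=; apply/andP; split; apply/eqP; ring.
split=> [H|[H1 H2] e e0].
  split=> e e0; have [r r0 hr] := H _ e0; exists r => // w wr; apply: le_trans (hr _ wr); rewrite E.
    exact: (Re_le_normc (_ +i* _)).
  exact: (Im_le_normc (_ +i* _)).
have e20 : 0 < e / 2 by rewrite divr_gt0.
have [r r0 hr] := H1 _ e20; have [s s0 hs] := H2 _ e20.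
exists (Num.min r s); first by rewrite lt_min r0.
move=> w; rewrite lt_min E => /andP[/hr k1 /hs k2].
apply: le_trans (normc_le_abs _) _ => /=; apply: le_trans (lerD k1 k2) _.
by rewrite -mulrDl -splitr.
Qed.

(** With f = p + iq, f dz = (p dx - q dy) + i (q dx + p dy); by the Cauchy-Riemann equations both
    real forms are closed off [w0], and their primitives are the components of [F]. *)
Lemma complex_primitive f z0 rho rho' w0 : 0 < rho < rho' ->
  (forall z, box z0 rho' z -> {for z, continuous f}) -> box z0 rho w0 ->
  (forall z, box z0 rho z -> z != w0 -> exists d, cdiff f z d) ->
  exists F, forall z, box z0 rho z -> cdiff F z (f z).
Proof.
move=> rr cf w0b df.
have cRe z : box z0 rho' z -> {for z, continuous (fun w => complex.Re (f w))}.
  by move=> /cf /continuous_ReP[].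
have cIm z : box z0 rho' z -> {for z, continuous (fun w => complex.Im (f w))}.
  by move=> /cf /continuous_ReP[].
have b' z : box z0 rho z -> box z0 rho' z.
  by case/andP : rr => _ rr [h1 h2]; split; apply: lt_trans rr.
have frN (V : R[i] -> R) z x y : frechet V z x y -> frechet (fun w => - V w) z (- x) (- y).
  move=> H e e0; have [r r0 hr] := H _ e0; exists r => // w wr.
  by rewrite -normrN; apply: le_trans (hr _ wr); rewrite le_eqVlt; apply/orP; left; apply/eqP; congr (`|_|); ring.
have [U HU] : exists U, forall z, box z0 rho z -> pdx U z (complex.Re (f z)) /\ pdy U z (- complex.Im (f z)).
  apply: (closed_form_primitive rr _ w0b).
    by move=> z zb; split; [exact: cRe|apply: continuousN; exact: cIm].
  move=> z zb zw; have [d /cdiff_frechet[d1 d2]] := df _ zb zw.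
  by exists (complex.Re d), (- complex.Im d), (- complex.Re d); split => //; exact: frN.
have [V HV] : exists V, forall z, box z0 rho z -> pdx V z (complex.Im (f z)) /\ pdy V z (complex.Re (f z)).
  apply: (closed_form_primitive rr _ w0b).
    by move=> z zb; split; [exact: cIm|exact: cRe].
  move=> z zb zw; have [d /cdiff_frechet[d1 d2]] := df _ zb zw.
  by exists (complex.Im d), (complex.Re d), (- complex.Im d).
exists (fun z => U z +i* V z) => z zb.
have [s s0 sb] : exists2 s, 0 < s & box z s `<=` box z0 rho.
  by apply/nbhs_boxP; apply: open_nbhs_nbhs; split => //; exact: box_open.
apply/cdiff_frechet; split => /=.
  apply: (frechet_of_partials s0 (A := fun w => complex.Re (f w)) (B := fun w => - complex.Im (f w))).
  - by move=> w /sb /HU[].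
  - by move=> w /sb /HU[].
  - exact/cRe/b'.
  - by apply: continuousN; exact/cIm/b'.
apply: (frechet_of_partials s0 (A := fun w => complex.Im (f w)) (B := fun w => complex.Re (f w))).
- by move=> w /sb /HV[].
- by move=> w /sb /HV[].
- exact/cIm/b'.
- exact/cRe/b'.
Qed.

(** Continuity by components, which reduces products and inverses of complex functions to the real
    ones. *)
Definition ccont (T : topologicalType) (g : T -> R[i]) t :=
  {for t, continuous (fun s => complex.Re (g s))} /\ {for t, continuous (fun s => complex.Im (g s))}.

Lemma ccontP (T : topologicalType) (g : T -> R[i]) t : ccont g t <-> {for t, continuous g}.
Proof. by split=> /continuous_ReP. Qed.

Lemma ccont_cst (T : topologicalType) c (t : T) : ccont (fun=> c) t.
Proof. by split; exact: cst_continuous. Qed.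

Lemma ccontD (T : topologicalType) (g h : T -> R[i]) t : ccont g t -> ccont h t ->
  ccont (fun s => g s + h s) t.
Proof.
move=> [gr gi] [hr hi]; split.
  rewrite (_ : (fun s => complex.Re _) = (fun s => complex.Re (g s) + complex.Re (h s))).
    exact: continuousD.
  by apply/funext => s; case: (g s) (h s) => [? ?] [? ?].
rewrite (_ : (fun s => complex.Im _) = (fun s => complex.Im (g s) + complex.Im (h s))).
  exact: continuousD.
by apply/funext => s; case: (g s) (h s) => [? ?] [? ?].
Qed.

Lemma ccontM (T : topologicalType) (g h : T -> R[i]) t : ccont g t -> ccont h t ->
  ccont (fun s => g s * h s) t.
Proof.
move=> [gr gi] [hr hi]; split.
  rewrite (_ : (fun s => complex.Re _) =
      (fun s => complex.Re (g s) * complex.Re (h s) - complex.Im (g s) * complex.Im (h s))).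
    by apply: continuousB; exact: continuousM.
  by apply/funext => s; case: (g s) (h s) => [? ?] [? ?].
rewrite (_ : (fun s => complex.Im _) =
    (fun s => complex.Re (g s) * complex.Im (h s) + complex.Im (g s) * complex.Re (h s))).
  by apply: continuousD; exact: continuousM.
by apply/funext => s; case: (g s) (h s) => [? ?] [? ?].
Qed.

Lemma ccontN (T : topologicalType) (g : T -> R[i]) t : ccont g t -> ccont (fun s => - g s) t.
Proof.
move=> [gr gi]; split.
  rewrite (_ : (fun s => complex.Re _) = (fun s => - complex.Re (g s))).
    exact: continuousN.
  by apply/funext => s; case: (g s) => [? ?].
rewrite (_ : (fun s => complex.Im _) = (fun s => - complex.Im (g s))).
  exact: continuousN.
by apply/funext => s; case: (g s) => [? ?].
Qed.

Lemma ccontB (T : topologicalType) (g h : T -> R[i]) t : ccont g t -> ccont h t ->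
  ccont (fun s => g s - h s) t.
Proof. by move=> cg ch; exact: ccontD cg (ccontN ch). Qed.

Lemma Re_inv z : complex.Re z^-1 = complex.Re z / normc z ^+ 2.
Proof. by rewrite normc_sqr; case: z => a b. Qed.

Lemma Im_inv z : complex.Im z^-1 = - complex.Im z / normc z ^+ 2.
Proof. by rewrite normc_sqr mulNr; case: z => a b. Qed.

Lemma ccontV (T : topologicalType) (g : T -> R[i]) t : g t != 0 -> ccont g t ->
  ccont (fun s => (g s)^-1) t.
Proof.
move=> g0 [gr gi].
have n0 : complex.Re (g t) ^+ 2 + complex.Im (g t) ^+ 2 != 0.
  by rewrite -normc_sqr expf_neq0// gt_eqF// normc_gt0.
have nV : {for t, continuous (fun s => (complex.Re (g s) ^+ 2 + complex.Im (g s) ^+ 2)^-1)}.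
  apply: continuousV => //.
  by apply: continuousD; [exact: (continuousM gr gr)|exact: (continuousM gi gi)].
split.
  rewrite (_ : (fun s => complex.Re _) =
      (fun s => complex.Re (g s) * (complex.Re (g s) ^+ 2 + complex.Im (g s) ^+ 2)^-1)).
    exact: continuousM.
  by apply/funext => s; rewrite Re_inv normc_sqr.
rewrite (_ : (fun s => complex.Im _) =
    (fun s => - complex.Im (g s) * (complex.Re (g s) ^+ 2 + complex.Im (g s) ^+ 2)^-1)).
  by apply: continuousM => //; exact: continuousN.
by apply/funext => s; rewrite Im_inv normc_sqr.
Qed.

Lemma ccontX (T : topologicalType) (g : T -> R[i]) t n : ccont g t -> ccont (fun s => g s ^+ n) t.
Proof.
move=> cg; elim: n => [|n IH]; first exact: ccont_cst.
have -> : (fun s => g s ^+ n.+1) = (fun s => g s * g s ^+ n) by apply/funext => s; rewrite exprS.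
exact: ccontM.
Qed.

Definition cint (g : R -> R[i]) : R[i] :=
  (\int[@lebesgue_measure R]_(t in `[0%R, (2 * pi)%R]) complex.Re (g t))%R +i*
  (\int[@lebesgue_measure R]_(t in `[0%R, (2 * pi)%R]) complex.Im (g t))%R.

Let twopi_gt0 : 0 < 2 * pi :> R.
Proof. by rewrite mulr_gt0// pi_gt0. Qed.

Lemma ereal_integral_derivative (a b : R) (h H : R -> R) : a < b ->
  (forall t, a <= t <= b -> {for t, continuous h}) ->
  (forall t, a <= t <= b -> is_derive t 1 H (h t)) ->
  (\int[@lebesgue_measure R]_(t in `[a, b]) (h t)%:E)%E = (H b - H a)%:E.
Proof.
move=> ab ch dH; rewrite (@continuous_FTC2 _ h H) ?EFinB//.
- apply: continuous_in_subspaceT => t /[!inE]/= /[!in_itv]/=; exact: ch.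
- split.
  + by move=> t /[!in_itv]/= /andP[? ?]; have [|] := dH t; first by rewrite !ltW.
  + apply: cvg_at_right_filter; apply: (is_derive_continuous (dH a _)).
    by rewrite lexx ltW.
  + apply: cvg_at_left_filter; apply: (is_derive_continuous (dH b _)).
    by rewrite lexx ltW.
- move=> t /[!in_itv]/= /andP[? ?]; rewrite derive1E.
  by have [|_ ->] := dH t; first by rewrite !ltW.
Qed.

Lemma integral_derivative (a b : R) (h H : R -> R) : a < b ->
  (forall t, a <= t <= b -> {for t, continuous h}) ->
  (forall t, a <= t <= b -> is_derive t 1 H (h t)) ->
  (\int[@lebesgue_measure R]_(t in `[a, b]) h t)%R = H b - H a.
Proof. by move=> ab ch dH; rewrite /Rintegral (ereal_integral_derivative ab ch dH). Qed.

Lemma cint_derivative (g G : R -> R[i]) : (forall t, ccont g t) ->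
  (forall t, 0 <= t <= 2 * pi -> cder G t (g t)) -> cint g = G (2 * pi) - G 0.
Proof.
move=> cg dG.
have HR := @integral_derivative 0 _ _ (fun t => complex.Re (G t)) twopi_gt0
  (fun t _ => (cg t).1) (fun t ht => (dG t ht).1).
have HI := @integral_derivative 0 _ _ (fun t => complex.Im (G t)) twopi_gt0
  (fun t _ => (cg t).2) (fun t ht => (dG t ht).2).
rewrite /cint HR HI.
by case: (G (2 * pi)) (G 0) => [a b] [a' b'].
Qed.

Lemma cint_antiderivative (g : R -> R[i]) : (forall t, ccont g t) -> exists G,
  (forall t, 0 <= t <= 2 * pi -> cder G t (g t)) /\ cint g = G (2 * pi) - G 0.
Proof.
move=> cg.
(* Starting at -1 instead of 0 makes every point of [[0, 2 * pi]] interior, so that two-sided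
   derivatives are available at the end points too. *)
pose J (h : R -> R) x := (\int[@lebesgue_measure R]_(s in `[(-1)%R, x]) h s)%R.
have dJ (h : R -> R) t : continuous h -> 0 <= t <= 2 * pi -> is_derive t 1 (J h) (h t).
  move=> ch /andP[t0 t2]; apply: (@antiderivative_integral R h (-1) (2 * pi + 1)).
    by move=> s _; exact: ch.
  by apply/andP; split; lra.
have dG t : 0 <= t <= 2 * pi ->
   cder (fun t => J (fun s => complex.Re (g s)) t +i* J (fun s => complex.Im (g s)) t) t (g t).
  move=> ht; split => /=; (apply: (dJ (fun s => _ (g s)) t _ ht)) => s; first by have [] := cg s.
  by have [] := cg s.
eexists; split; first exact: dG.
exact: cint_derivative dG.
Qed.

Lemma cderD (g h : R -> R[i]) t d d' : cder g t d -> cder h t d' -> cder (fun s => g s + h s) t (d + d').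
Proof.
have ER (x y : R[i]) : complex.Re (x + y) = complex.Re x + complex.Re y by case: x y => [? ?] [? ?].
have EI (x y : R[i]) : complex.Im (x + y) = complex.Im x + complex.Im y by case: x y => [? ?] [? ?].
move=> [a b] [a' b']; split.
  by under eq_fun do rewrite ER; rewrite ER; exact: is_deriveD.
by under eq_fun do rewrite EI; rewrite EI; exact: is_deriveD.
Qed.

Lemma cderZ (g : R -> R[i]) t c d : cder g t d -> cder (fun s => c * g s) t (c * d).
Proof.
move=> H; apply: (cder_comp (F := fun w => c * w) _ H).
apply/cdiffP; have := is_deriveM (is_derive_cst c (g t) (1 : R[i])) (is_derive_id (g t) (1 : R[i])).
rewrite /GRing.scale/= mulr1 mulr0 addr0; exact.
Qed.

Lemma cintD (g h : R -> R[i]) : (forall t, ccont g t) -> (forall t, ccont h t) ->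
  cint (fun t => g t + h t) = cint g + cint h.
Proof.
move=> cg ch; have [G [dG ->]] := cint_antiderivative cg.
have [H [dH ->]] := cint_antiderivative ch.
rewrite (cint_derivative (G := fun t => G t + H t)); first by ring.
  by move=> t; exact: ccontD.
by move=> t ht; apply: cderD; [exact: dG|exact: dH].
Qed.

Lemma cintZ (g : R -> R[i]) c : (forall t, ccont g t) -> cint (fun t => c * g t) = c * cint g.
Proof.
move=> cg; have [G [dG ->]] := cint_antiderivative cg.
rewrite (cint_derivative (G := fun t => c * G t)); first by ring.
  by move=> t; apply: ccontM => //; exact: ccont_cst.
by move=> t ht; apply: cderZ; exact: dG.
Qed.

Lemma cintB (g h : R -> R[i]) : (forall t, ccont g t) -> (forall t, ccont h t) ->
  cint (fun t => g t - h t) = cint g - cint h.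
Proof.
move=> cg ch.
have cNh : forall t, ccont (fun t => -1 * h t) t.
  by move=> t; apply: ccontM => //; exact: ccont_cst.
have -> : (fun t => g t - h t) = (fun t => g t + (-1) * h t).
  by apply/funext => t; rewrite mulN1r.
by rewrite (cintD cg cNh) (cintZ _ ch) mulN1r.
Qed.

(** The constant is twice the length of the interval because real and imaginary parts are estimated
    separately. *)
Lemma cint_le (g : R -> R[i]) M : (forall t, ccont g t) ->
  (forall t, 0 <= t <= 2 * pi -> normc (g t) <= M) ->
  normc (cint g) <= 4 * pi * M.
Proof.
move=> cg gM; have [G [dG ->]] := cint_antiderivative cg.
have p0 : 0 <= 2 * pi :> R by exact: ltW.
apply: le_trans (normc_le_abs _) _; rewrite ReB ImB.
have h1 := @mean_value_le R (fun t => complex.Re (G t)) (fun t => complex.Re (g t)) 0 (2 * pi) M p0.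
have h2 := @mean_value_le R (fun t => complex.Im (G t)) (fun t => complex.Im (g t)) 0 (2 * pi) M p0.
apply: le_trans (lerD (h1 _ _) (h2 _ _)) _.
- by move=> t /dG[].
- by move=> t /gM; apply: le_trans (Re_le_normc _).
- by move=> t /dG[].
- by move=> t /gM; apply: le_trans (Im_le_normc _).
by rewrite subr0; lra.
Qed.

End cauchy.

(** * Cauchy's formula *)

Section cauchy_formula.
Variable R : realType.
Implicit Types (z w a : R[i]) (e : R) (f g F : R[i] -> R[i]).

Definition circle a (r : R) (t : R) : R[i] := a + r%:C * (cos t +i* sin t).

Lemma circle_sub a r t : circle a r t - a = r%:C * (cos t +i* sin t).
Proof. by rewrite /circle addrC addKr. Qed.

Lemma normc_real (r : R) : normc r%:C = `|r|.
Proof. by rewrite /= expr0n addr0 sqrtr_sqr. Qed.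

Lemma normc_circle a r t : 0 <= r -> normc (circle a r t - a) = r.
Proof.
by move=> r0; rewrite circle_sub normcM normc_real ger0_norm//= cos2Dsin2 sqrtr1 mulr1.
Qed.

Lemma circle_2pi a r : circle a r (2 * pi) = circle a r 0.
Proof. by rewrite /circle mulr_natl cos2pi sin2pi cos0 sin0. Qed.

Lemma cder_circle a r t : cder (circle a r) t ('i * (circle a r t - a)).
Proof.
have h : cder (fun t => cos t +i* sin t) t ('i * (cos t +i* sin t)).
  have -> : 'i * (cos t +i* sin t) = (- sin t) +i* cos t by simpc.
  by split; [exact: is_derive_cos|exact: is_derive_sin].
have -> : 'i * (circle a r t - a) = 0 + r%:C * ('i * (cos t +i* sin t)).
  by rewrite circle_sub; ring.
apply: cderD; last exact: cderZ.
by split; exact: is_derive_cst.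
Qed.

Lemma cder_ccont (g : R -> R[i]) t d : cder g t d -> ccont g t.
Proof. by move=> [/is_derive_continuous h1 /is_derive_continuous h2]. Qed.

Lemma ccont_circle a r t : ccont (circle a r) t.
Proof. exact: cder_ccont (cder_circle a r t). Qed.

Lemma circle_dist a r t w : 0 < r -> r - normc (w - a) <= normc (circle a r t - w).
Proof.
move=> r0; rewrite lerBlDr; have := le_normcD (circle a r t - w) (w - a).
by rewrite addrA subrK normc_circle// ltW.
Qed.

Lemma circle_neq a r t w : 0 < r -> normc (w - a) < r -> circle a r t - w != 0.
Proof.
move=> r0 wr; rewrite -normc_gt0; apply: lt_le_trans (circle_dist a t w r0).
by rewrite subr_gt0.
Qed.

Lemma ccont_kernel a r w t n : 0 < r -> normc (w - a) < r ->
  ccont (fun t => (circle a r t - w)^-1 ^+ n) t.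
Proof.
move=> r0 wr; apply: ccontX; apply: ccontV; first exact: circle_neq.
by apply: ccontB; [exact: ccont_circle|exact: ccont_cst].
Qed.

Definition ctype (phi : R -> R[i]) a r n w := cint (fun t => phi t * (circle a r t - w)^-1 ^+ n).

(** A second order Taylor estimate for the n-th power of the kernel: with [p] and [q] the inverses
    of [circle a r t - v] and [circle a r t - w], the relation [p - q = h * p * q] holds for
    [h = v - w]. *)
Let kernel_le (p q h : R[i]) B n : 0 <= B -> normc p <= B -> normc q <= B -> p - q = h * p * q ->
  normc (p ^+ n - q ^+ n - n%:R * q ^+ n.+1 * h) <= (\sum_(k < n) k.+1%:R) * B ^+ n.+2 * normc h ^+ 2.
Proof.
move=> B0 pB qB pq; elim: n => [|n IH].
  by rewrite !expr0 subrr !mul0r subr0 normc0 big_ord0 !mul0r.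
have -> : p ^+ n.+1 - q ^+ n.+1 - n.+1%:R * q ^+ n.+2 * h =
   p * (p ^+ n - q ^+ n - n%:R * q ^+ n.+1 * h) + n.+1%:R * h * q ^+ n.+1 * (p - q) +
   (q ^+ n * (p - q) - h * p * q ^+ n.+1).
  by rewrite !exprS -[n.+1]addn1 natrD; ring.
have -> : q ^+ n * (p - q) - h * p * q ^+ n.+1 = 0 by rewrite pq exprS; ring.
rewrite addr0 pq; apply: le_trans (le_normcD _ _) _.
have nX (x : R[i]) m : normc (x ^+ m) = normc x ^+ m.
  by elim: m => [|m IHm]; rewrite ?expr0 ?normc1// !exprS normcM IHm.
rewrite big_ord_recr /= !mulrDl; apply: lerD.
  rewrite normcM [B ^+ _]exprS; apply: le_trans (ler_pM _ _ pB IH) _; rewrite ?normc_ge0//.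
  by rewrite le_eqVlt; apply/orP; left; apply/eqP; ring.
rewrite !normcM nX.
have -> : normc (n.+1%:R : R[i]) = n.+1%:R.
  by rewrite -(rmorph_nat (real_complex R)) normc_real ger0_norm.
have -> : n.+1%:R * normc h * normc q ^+ n.+1 * (normc h * normc p * normc q) =
  (n.+1%:R * (normc p * normc q ^+ n.+2)) * normc h ^+ 2.
  by rewrite [normc q ^+ n.+2]exprSr; ring.
apply: ler_wpM2r; first by rewrite exprn_ge0 ?normc_ge0.
apply: ler_wpM2l; first by [].
rewrite [B ^+ _]exprS; apply: ler_pM; rewrite ?normc_ge0 ?exprn_ge0 ?normc_ge0//.
by apply: lerXn2r; rewrite ?nnegrE ?normc_ge0.
Qed.

Lemma cdiff_ctype phi a r n w M : 0 < r -> normc (w - a) < r -> (forall t, ccont phi t) ->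
  (forall t, 0 <= t <= 2 * pi -> normc (phi t) <= M) ->
  cdiff (ctype phi a r n) w (n%:R * ctype phi a r n.+1 w).
Proof.
move=> r0 wr cphi phiM.
(* Half the distance from [w] to the circle: for [v] within [d] of [w], both kernels are bounded by
   [d^-1]. *)
pose d := (r - normc (w - a)) / 2; have d0 : 0 < d by rewrite divr_gt0// subr_gt0.
have M0 : 0 <= M.
  by apply: le_trans (phiM 0 _); rewrite ?normc_ge0// lexx mulr_ge0// pi_ge0.
pose B := d^-1; pose C := 4 * pi * (M * ((\sum_(k < n) k.+1%:R) * B ^+ n.+2)).
have B0 : 0 <= B by rewrite invr_ge0 ltW.
have C0 : 0 <= C.
  apply: mulr_ge0; first by rewrite mulr_ge0// pi_ge0.
  by apply: mulr_ge0 => //; apply: mulr_ge0; [exact: sumr_ge0|exact: exprn_ge0].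
have est v : normc (v - w) < d ->
   normc (ctype phi a r n v - ctype phi a r n w - n%:R * ctype phi a r n.+1 w * (v - w)) <= C * normc (v - w) ^+ 2.
  move=> vd.
  have vr : normc (v - a) < r.
    rewrite -(subrK w v) -addrA; apply: le_lt_trans (le_normcD _ _) _.
    by move: vd; rewrite /d; lra.
  have ck m u : normc (u - a) < r -> forall t, ccont (fun t => phi t * (circle a r t - u)^-1 ^+ m) t.
    by move=> ur t; apply: ccontM; [exact: cphi|exact: ccont_kernel].
  pose c := n%:R * (v - w).
  have -> : ctype phi a r n v - ctype phi a r n w - n%:R * ctype phi a r n.+1 w * (v - w) =
      cint (fun t => (phi t * (circle a r t - v)^-1 ^+ n - phi t * (circle a r t - w)^-1 ^+ n) - c * (phi t * (circle a r t - w)^-1 ^+ n.+1)).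
    rewrite cintB; last 2 first.
    - by move=> t; apply: ccontB; exact: ck.
    - by move=> t; apply: ccontM; [exact: ccont_cst|exact: ck].
    rewrite cintB; [|exact: ck|exact: ck]; rewrite cintZ; last exact: ck.
    by rewrite /ctype /c [in RHS]mulrAC.
  rewrite /C -[leRHS]mulrA; apply: cint_le.
    move=> t; apply: ccontB; first by apply: ccontB; exact: ck.
    by apply: ccontM; [exact: ccont_cst|exact: ck].
  move=> t ht.
  have -> : phi t * (circle a r t - v)^-1 ^+ n - phi t * (circle a r t - w)^-1 ^+ n - c * (phi t * (circle a r t - w)^-1 ^+ n.+1) =
    phi t * ((circle a r t - v)^-1 ^+ n - (circle a r t - w)^-1 ^+ n - n%:R * (circle a r t - w)^-1 ^+ n.+1 * (v - w)).
    by rewrite /c; ring.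
  rewrite normcM -[leRHS]mulrA; apply: ler_pM; rewrite ?normc_ge0 ?phiM//.
  have pn := circle_neq t r0 vr; have qn := circle_neq t r0 wr.
  apply: kernel_le => //.
  - rewrite normcV lef_pV2 ?posrE ?normc_gt0//.
    apply: le_trans (circle_dist a t v r0).
    have : normc (v - a) <= normc (v - w) + normc (w - a).
      by apply: le_trans (le_normcD _ _); rewrite addrA subrK.
    by move: vd; rewrite /d; lra.
  - rewrite normcV lef_pV2 ?posrE ?normc_gt0//.
    apply: le_trans (circle_dist a t w r0).
    by move: (d0); rewrite /d; lra.
  - by field; rewrite pn qn.
move=> e e0; pose s := Num.min d (e / (C + 1)).
have C1 : 0 < C + 1 by rewrite ltr_wpDl.
exists s; first by rewrite lt_min d0 divr_gt0.
move=> v; rewrite lt_min => /andP[vd ve]; apply: le_trans (est _ vd) _.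
rewrite expr2 mulrA; apply: ler_wpM2r; first exact: normc_ge0.
apply: (@le_trans _ _ ((C + 1) * normc (v - w))).
  by apply: ler_wpM2r; rewrite ?normc_ge0// lerDl.
by rewrite -ler_pdivlMl// mulrC ltW.
Qed.

(* The derivative in [w] vanishes, since [(circle - a) / (circle - w) ^ 2] is an exact derivative in [t]; hence the
   value is the one at [w = a]. *)
Let mean_kernel a r w : 0 < r -> normc (w - a) < r ->
  cint (fun t => (circle a r t - a) * (circle a r t - w)^-1 ^+ 1) = (2 * pi)%:C.
Proof.
move=> r0 wr; pose phi t := circle a r t - a.
have cphi t : ccont phi t by apply: ccontB; [exact: ccont_circle|exact: ccont_cst].
have phiM t : 0 <= t <= 2 * pi -> normc (phi t) <= r by rewrite normc_circle// ltW.
rewrite -[LHS]/(ctype phi a r 1 w).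
have dJ v : normc (v - a) < r -> cdiff (ctype phi a r 1) v 0.
  move=> vr; have := cdiff_ctype 1 r0 vr cphi phiM; rewrite mul1r.
  suff -> : ctype phi a r 2 v = 0 by [].
  rewrite /ctype.
  have dG t : 0 <= t <= 2 * pi ->
     cder (fun t => 'i * (circle a r t - v)^-1) t (phi t * (circle a r t - v)^-1 ^+ 2).
    move=> _.
    have vn := circle_neq t r0 vr.
    have dF := @cdiffV _ (fun z => z - v) (circle a r t) _ vn (cdiffB (@cdiff_id R _) (cdiff_cst v _)).
    have := cderZ 'i (cder_comp dF (cder_circle a r t)); congr cder.
    have -> : 'i * (- (1 - 0) / (circle a r t - v) ^+ 2 * ('i * (circle a r t - a))) = - ('i * 'i) * (phi t / (circle a r t - v) ^+ 2) by rewrite /phi; ring.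
    have -> : - ('i * 'i) = 1 :> R[i] by simpc.
    by rewrite mul1r exprVn.
  rewrite (cint_derivative _ dG); first by rewrite circle_2pi subrr.
  by move=> t; apply: ccontM; [exact: cphi|exact: ccont_kernel].
have -> : ctype phi a r 1 w = ctype phi a r 1 a.
  pose p s := a + (w - a) * s%:C.
  have pr s : 0 <= s <= 1 -> normc (p s - a) < r.
    move=> /andP[s0 s1]; rewrite /p addrC addKr normcM normc_real ger0_norm//.
    by apply: le_lt_trans wr; rewrite ler_piMr// normc_ge0.
  have dp s : cder p s (w - a).
    have -> : w - a = 0 + (w - a) * 1 by rewrite add0r mulr1.
    apply: cderD; first by split; exact: is_derive_cst.
    apply: cderZ; split => /=; [exact: is_derive_id|exact: is_derive_cst].
  have dc s : 0 <= s <= 1 -> cder (ctype phi a r 1 \o p) s 0.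
    by move=> hs; have := cder_comp (dJ _ (pr _ hs)) (dp s); rewrite mul0r.
  have p0 : p 0 = a by rewrite /p mulr0 addr0.
  have p1 : p 1 = w by rewrite /p mulr1 addrC subrK.
  have hR := @mean_value_le R (fun s => complex.Re (ctype phi a r 1 (p s))) (fun=> 0) 0 1 0 ler01
    (fun s hs => (dc s hs).1) (fun s _ => _).
  have hI := @mean_value_le R (fun s => complex.Im (ctype phi a r 1 (p s))) (fun=> 0) 0 1 0 ler01
    (fun s hs => (dc s hs).2) (fun s _ => _).
  move: hR hI; rewrite p0 p1 mul0r !normr_le0 !subr_eq0.
  move=> hR hI; apply/eqP; rewrite eq_complex hR ?hI// => *; exact: normr0.
rewrite /ctype (_ : (fun t => _) = fun=> 1).
  rewrite (@cint_derivative _ _ (fun t => t%:C)).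
  - by rewrite subr0.
  - by move=> t; exact: ccont_cst.
  - by move=> t _; split => /=; [exact: is_derive_id|exact: is_derive_cst].
apply/funext => t; rewrite expr1 /phi divff//; apply: circle_neq => //.
by rewrite subrr normc0.
Qed.

(** The difference quotient of [f] at [w], completed by the derivative, is continuous and
    differentiable off [w]. Hence it has a primitive and integrates to zero over the circle;
    splitting the quotient leaves [f w] times the integral computed in [mean_kernel]. *)
Theorem cauchy_formula f a r rho w : 0 < r -> r < rho ->
  (forall z, box a rho z -> exists d, cdiff f z d) -> normc (w - a) < r ->
  f w = ((2 * pi)^-1)%:C * ctype (fun t => f (circle a r t) * (circle a r t - a)) a r 1 w.
Proof.
move=> r0 rrho df wr.
have inbox z s : normc (z - a) < s -> box a s z.
  by move=> zr; split; rewrite -?ReB -?ImB; apply: le_lt_trans zr; [exact: Re_le_normc|exact: Im_le_normc].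
have [d hd] := df w (inbox _ _ (lt_trans wr rrho)).
pose g z := if z == w then d else (f z - f w) / (z - w).
have dg z : box a rho z -> z != w -> exists d, cdiff g z d.
  move=> zb zw; have [d' hd'] := df _ zb.
  have zw0 : z - w != 0 by rewrite subr_eq0.
  eexists; apply: (@cdiff_near _ (fun z => (f z - f w) * (z - w)^-1)).
    apply/nbhs_normcP; exists (normc (z - w)); first by rewrite normc_gt0.
    move=> v vz; rewrite /g ifF//; apply/eqP => vw; move: vz; rewrite vw normcB.
    by rewrite ltxx.
  apply: cdiffM; first exact: cdiffB hd' (cdiff_cst _ _).
  by apply: cdiffV => //; exact: cdiffB (@cdiff_id R _) (cdiff_cst _ _).
have cg z : box a rho z -> {for z, continuous g}.
  move=> zb; have [->|zw] := eqVneq z w; last first.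
    by have [d' /cdiff_continuous] := dg _ zb zw.
  move=> A /nbhs_normcP[e e0 eA].
  have [s s0 hs] := hd (e / 2) (divr_gt0 e0 (ltr0n _ 2)).
  apply/nbhs_normcP; exists s => // v vs; apply: eA.
  rewrite /g eqxx; case: eqVneq => [_|vw]; first by rewrite subrr normc0.
  have vw0 : v - w != 0 by rewrite subr_eq0.
  have -> : (f v - f w) / (v - w) - d = (f v - f w - d * (v - w)) / (v - w).
    by field.
  rewrite normcM normcV; have n0 : 0 < normc (v - w) by rewrite normc_gt0.
  rewrite -[_ / _]/(_ * _) ltr_pdivrMr//.
  by apply: le_lt_trans (hs _ vs) _; rewrite ltr_pM2r//; lra.
pose rho1 := (r + rho) / 2.
have [F hF] : exists F, forall z, box a rho1 z -> cdiff F z (g z).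
  apply: (@complex_primitive _ g a rho1 rho w) => //.
  - by rewrite /rho1; apply/andP; split; lra.
  - by apply: inbox; apply: lt_trans wr _; rewrite /rho1; lra.
  - move=> z [z1 z2]; apply: dg; split; [apply: lt_trans z1 _|apply: lt_trans z2 _]; rewrite /rho1; lra.
have cb t : box a rho1 (circle a r t).
  by apply: inbox; rewrite normc_circle ?ltW// /rho1; lra.
have gE t : g (circle a r t) * ('i * (circle a r t - a)) =
   'i * ((f (circle a r t) * (circle a r t - a)) * (circle a r t - w)^-1 ^+ 1 - f w * ((circle a r t - a) * (circle a r t - w)^-1 ^+ 1)).
  have := circle_neq t r0 wr; rewrite subr_eq0 => cw.
  rewrite /g (negbTE cw); ring.
have cfc t : ccont (fun t => f (circle a r t)) t.
  have [|d' hd'] := df (circle a r t).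
    by apply: inbox; rewrite normc_circle// ltW.
  exact: cder_ccont (cder_comp hd' (cder_circle a r t)).
have ca t : ccont (fun t => circle a r t - a) t.
  by apply: ccontB; [exact: ccont_circle|exact: ccont_cst].
have ck t : ccont (fun t => (circle a r t - w)^-1 ^+ 1) t by exact: ccont_kernel.
have c1 t : ccont (fun t => f (circle a r t) * (circle a r t - a) * (circle a r t - w)^-1 ^+ 1) t.
  by apply: ccontM (ccontM (cfc t) (ca t)) (ck t).
have c2 t : ccont (fun t => (circle a r t - a) * (circle a r t - w)^-1 ^+ 1) t.
  exact: ccontM (ca t) (ck t).
have c3 t : ccont (fun t => f w * ((circle a r t - a) * (circle a r t - w)^-1 ^+ 1)) t.
  exact: ccontM (ccont_cst _ t) (c2 t).
have : cint (fun t => g (circle a r t) * ('i * (circle a r t - a))) = 0.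
  rewrite (@cint_derivative _ _ (F \o circle a r)).
  - by rewrite /= circle_2pi subrr.
  - under eq_fun do rewrite gE; move=> t.
    by apply: ccontM (ccont_cst _ t) (ccontB (c1 t) (c3 t)).
  - by move=> t _; apply: cder_comp (cder_circle a r t); exact: hF.
under eq_fun do rewrite gE.
rewrite (cintZ _ (fun t => ccontB (c1 t) (c3 t))) (cintB c1 c3) (cintZ _ c2) (mean_kernel r0 wr).
move=> /eqP; rewrite mulf_eq0 => /orP[/eqP|]; first by move=> /(congr1 (@complex.Im R)) /= /eqP; rewrite oner_eq0.
rewrite subr_eq0 /ctype => /eqP ->; rewrite mulrC -mulrA.
have -> : (2 * pi)%:C * ((2 * pi)^-1)%:C = 1 :> R[i]; last by rewrite mulr1.
by rewrite -rmorphM divff// gt_eqF// mulr_gt0// pi_gt0.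
Qed.

End cauchy_formula.

(** * Factorization of holomorphic functions *)

Section factorization.
Variable R : realType.
Implicit Types (z w a : R[i]) (e : R) (f g F : R[i] -> R[i]) (Omega : set R[i]).

Definition cD f z : R[i] := 'D_1 f z.

Lemma cdiff_cD f z d : cdiff f z d -> cD f z = d.
Proof. by move/cdiffP => [_]. Qed.

Lemma holomorphic_cdiff Omega f z : holomorphic_on Omega f -> Omega z -> cdiff f z (cD f z).
Proof. by move=> h /h /derivableP /cdiffP. Qed.

Lemma cdiff_derivable f z d : cdiff f z d -> derivable f z 1.
Proof. by move/cdiffP => []. Qed.

Lemma open_box Omega a : open Omega -> Omega a -> exists2 rho, 0 < rho & box a rho `<=` Omega.
Proof. by move=> oO Oa; apply/nbhs_boxP; exact: open_nbhs_nbhs. Qed.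

Lemma ccont_bounded (phi : R -> R[i]) : (forall t, ccont phi t) ->
  exists M, forall t, 0 <= t <= 2 * pi -> normc (phi t) <= M.
Proof.
move=> cphi.
have p0 : 0 <= 2 * pi :> R by rewrite mulr_ge0// pi_ge0.
have [|c _ hc] := @EVT_max R (fun t => `|complex.Re (phi t)| + `|complex.Im (phi t)|) _ _ p0.
  apply: continuous_subspaceT => t.
  have [c1 c2] := cphi t.
  have h1 := continuous_comp c1 (@norm_continuous _ R^o _).
  have h2 := continuous_comp c2 (@norm_continuous _ R^o _).
  exact: (continuousD h1 h2).
exists (`|complex.Re (phi c)| + `|complex.Im (phi c)|) => t ht.
by apply: le_trans (normc_le_abs _) _; apply: hc; rewrite in_itv.
Qed.

Let c0 : R[i] := ((2 * pi)^-1)%:C.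

Lemma ball_box a r w : normc (w - a) < r -> box a r w.
Proof.
by move=> zr; split; rewrite -?ReB -?ImB; apply: le_lt_trans zr; [exact: Re_le_normc|exact: Im_le_normc].
Qed.

Lemma cdiffZ f z c d : cdiff f z d -> cdiff (fun w => c * f w) z (c * d).
Proof.
by move=> H; have := cdiffM (cdiff_cst c z) H; rewrite mulr0 addr0.
Qed.

(** On a small disc Cauchy's formula makes the derivative a Cauchy-type integral of order 2, which
    can be differentiated once more. *)
Lemma holomorphic_cD Omega f : open Omega -> holomorphic_on Omega f ->
  holomorphic_on Omega (cD f).
Proof.
move=> oO hf a Oa; have [rho rho0 rO] := open_box oO Oa.
have df z : box a rho z -> exists d, cdiff f z d.
  by move=> /rO Oz; exists (cD f z); exact: holomorphic_cdiff hf Oz.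
pose r := rho / 2; have r0 : 0 < r by rewrite divr_gt0.
have rr : r < rho by rewrite /r; lra.
pose phi t := f (circle a r t) * (circle a r t - a).
have cphi t : ccont phi t.
  apply: ccontM; last by apply: ccontB; [exact: ccont_circle|exact: ccont_cst].
  have [|d' hd'] := df (circle a r t).
    by apply: ball_box; rewrite normc_circle// ltW.
  exact: cder_ccont (cder_comp hd' (cder_circle a r t)).
have [M HM] := ccont_bounded cphi.
have fE w : normc (w - a) < r -> f w = c0 * ctype phi a r 1 w.
  exact: (cauchy_formula r0 rr df).
have dE w : normc (w - a) < r -> c0 * ctype phi a r 2 w = cD f w.
  move=> wr; symmetry; apply: cdiff_cD.
  have := cdiffZ c0 (cdiff_ctype 1 r0 wr cphi HM); rewrite mul1r.
  apply: cdiff_near; apply/nbhs_normcP; exists (r - normc (w - a)); first by rewrite subr_gt0.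
  move=> v vw; rewrite -fE//; have := le_normcD (v - w) (w - a).
  by rewrite addrA subrK; lra.
have aa : normc (a - a) < r by rewrite subrr normc0.
apply: (@cdiff_derivable _ a).
apply: cdiff_near (cdiffZ c0 (cdiff_ctype 2 r0 aa cphi HM)).
by apply/nbhs_normcP; exists r => // w /dE.
Qed.

(** [G n] is the n-th Taylor remainder of [f] at [a] divided by [(w - a) ^+ n], obtained by dividing
    the density by powers of [circle a r t - a]. If all [G n a] vanish, then
    [f w = (w - a) ^+ n * G n w] for all [n], and the bound of [phi n] by a multiple of [r ^- n]
    forces [f w = 0] by geometric decay. Otherwise the first nonzero [G m a] gives the
    factorization. *)
Lemma holomorphic_factor Omega f a : open Omega -> holomorphic_on Omega f -> Omega a ->
  exists2 r, 0 < r & (forall w, normc (w - a) < r -> Omega w) /\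
  ((forall w, normc (w - a) < r -> f w = 0) \/ exists m g, holomorphic_on [set w | normc (w - a) < r] g /\
    forall w, normc (w - a) < r -> f w = (w - a) ^+ m * g w /\ g w != 0).
Proof.
move=> oO hf Oa; have [rho rho0 rO] := open_box oO Oa.
have df z : box a rho z -> exists d, cdiff f z d.
  by move=> /rO Oz; exists (cD f z); exact: holomorphic_cdiff hf Oz.
pose r := rho / 2; have r0 : 0 < r by rewrite divr_gt0.
have rr : r < rho by rewrite /r; lra.
pose phi n t := f (circle a r t) * (circle a r t - a) * (circle a r t - a)^-1 ^+ n.
have aa : normc (a - a) < r by rewrite subrr normc0.
have cphi n t : ccont (phi n) t.
  apply: ccontM; last exact: ccont_kernel.
  apply: ccontM; last by apply: ccontB; [exact: ccont_circle|exact: ccont_cst].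
  have [|d' hd'] := df (circle a r t).
    by apply: ball_box; rewrite normc_circle// ltW.
  exact: cder_ccont (cder_comp hd' (cder_circle a r t)).
pose G n w := c0 * ctype (phi n) a r 1 w.
have G0 w : normc (w - a) < r -> f w = G 0%N w.
  have E : phi 0%N = fun t => f (circle a r t) * (circle a r t - a).
    by apply/funext => t; rewrite /phi expr0 mulr1.
  move=> wr; rewrite /G E; exact: (cauchy_formula r0 rr df wr).
have GS n w : normc (w - a) < r -> G n w = G n a + (w - a) * G n.+1 w.
  move=> wr; rewrite /G /ctype mulrCA -mulrDr; congr (_ * _).
  have k1 t : ccont (fun t => phi n t * (circle a r t - a)^-1 ^+ 1) t.
    by apply: ccontM; [exact: cphi|exact: ccont_kernel].
  have k2 t : ccont (fun t => phi n.+1 t * (circle a r t - w)^-1 ^+ 1) t.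
    by apply: ccontM; [exact: cphi|exact: ccont_kernel].
  rewrite -(cintZ _ k2) -cintD//; last first.
    by move=> t; apply: ccontM (ccont_cst _ t) (k2 t).
  congr cint; apply/funext => t.
  have n1 := circle_neq t r0 aa; have n2 := circle_neq t r0 wr.
  by rewrite /phi !expr1 exprS; field; rewrite n1 n2.
have dG n w : normc (w - a) < r -> exists d, cdiff (G n) w d.
  move=> wr; have [M HM] := ccont_bounded (cphi n).
  by exists (c0 * (1%:R * ctype (phi n) a r 2 w)); exact: (cdiffZ c0 (cdiff_ctype 1 r0 wr (cphi n) HM)).
have fG n : (forall k, (k < n)%N -> G k a = 0) -> forall w, normc (w - a) < r ->
    f w = (w - a) ^+ n * G n w.
  elim: n => [|n IH] Hn w wr; first by rewrite expr0 mul1r G0.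
  rewrite IH// => [|k kn]; last by apply: Hn; exact: ltnW.
  by rewrite GS// Hn// add0r mulrA -exprSr.
have [[n Gn]|Gz] := pselect (exists n, G n a != 0); last first.
  have {}Gz n : G n a = 0 by apply/eqP/negPn/negP => h; apply: Gz; exists n.
  exists r => //; split=> [w wr|]; first by apply: rO; apply: ball_box; exact: lt_trans wr rr.
  left => w wr.
  have [M HM] := ccont_bounded (cphi 0%N).
  have M0 : 0 <= M.
    by apply: le_trans (HM 0 _); rewrite ?normc_ge0// lexx mulr_ge0// pi_ge0.
  pose s := normc (w - a); pose K := normc c0 * (4 * pi * (M / (r - s))).
  have s0 : 0 <= s by exact: normc_ge0.
  have rs : 0 < r - s by rewrite subr_gt0.
  have nX (x : R[i]) m : normc (x ^+ m) = normc x ^+ m.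
    by elim: m => [|m IHm]; rewrite ?expr0 ?normc1// !exprS normcM IHm.
  have fK n : normc (f w) <= K * (s / r) ^+ n.
    rewrite (fG n)// normcM nX -/s /G normcM.
    have : normc (ctype (phi n) a r 1 w) <= 4 * pi * (M / r ^+ n / (r - s)).
      apply: cint_le => [t|t ht]; first by apply: ccontM; [exact: cphi|exact: ccont_kernel].
      have n1 := circle_neq t r0 aa; have n2 := circle_neq t r0 wr.
      rewrite expr1 normcM normcV; apply: ler_pM; rewrite ?normc_ge0 ?invr_ge0 ?normc_ge0//.
        rewrite /phi normcM nX normcV normc_circle ?(ltW r0)// exprVn.
        apply: ler_wpM2r; first by rewrite invr_ge0 exprn_ge0 ?ltW.
        by have := HM _ ht; rewrite /phi expr0 mulr1.
      by rewrite lef_pV2 ?posrE ?normc_gt0//; exact: circle_dist.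
    move=> /(ler_wpM2l (normc_ge0 c0)) /(ler_wpM2l (exprn_ge0 n s0)) /le_trans; apply.
    rewrite /K [(s / r) ^+ n]expr_div_n le_eqVlt; apply/orP; left; apply/eqP.
    by move: (normc c0) (s ^+ n) ((r - s)^-1) ((r ^+ n)^-1) => X Y Z W; ring.
  apply: eq0_normc; apply/eqP; rewrite eq_le normc_ge0 andbT.
  have q1 : `|s / r| < 1 by rewrite ger0_norm ?divr_ge0 ?ltr_pdivrMr ?mul1r// ltW.
  have := cvg_geometric K q1; rewrite /geometric /= => cv.
  by apply: (cvgr_to_ge cv); apply: nearW => n /=; exact: fK.
have ex : exists n, G n a != 0 by exists n.
case: (ex_minnP ex) => {Gn}n Gn nmin.
have Gk k : (k < n)%N -> G k a = 0.
  by move=> kn; apply/eqP/negPn/negP => /nmin; rewrite leqNgt kn.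
have [d /cdiff_continuous cG] := dG n a aa.
have nb : nbhs (G n a) [set v | v != 0].
  apply/nbhs_normcP; exists (normc (G n a)); first by rewrite normc_gt0.
  by move=> v /= h; apply/eqP => v0; move: h; rewrite v0 sub0r normcN ltxx.
have : nbhs a [set w | G n w != 0] by exact: (cG _ nb).
move=> /nbhs_normcP[s s0 hs]; exists (Num.min r s); first by rewrite lt_min r0.
split=> [w|].
  by rewrite lt_min => /andP[wr _]; apply: rO; apply: ball_box; exact: lt_trans wr rr.
right; exists n, (G n); split=> [w /=|w].
  by rewrite lt_min => /andP[/(dG n)[d' hd'] _]; exact: cdiff_derivable hd'.
rewrite lt_min => /andP[wr ws]; split; first exact: fG.
exact: (hs _ ws).
Qed.

Theorem holomorphic_local_form Omega f a : domain Omega -> holomorphic_on Omega f ->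
  nonconstant_on Omega f -> Omega a -> exists m g r,
  [/\ 0 < r, (forall w, normc (w - a) < r -> Omega w),
     holomorphic_on [set w | normc (w - a) < r] g &
     forall w, normc (w - a) < r -> f w = (w - a) ^+ m * g w /\ g w != 0].
Proof.
move=> [oO cO _] hf nf Oa; have [r r0 [rO [fa0|[m [g [hg fg]]]]]] := holomorphic_factor oO hf Oa; last first.
  by exists m, g, r.
exfalso; apply: nf; exists 0.
(* Identity theorem: if [f] vanished near [a], this set would be nonempty, open and closed in the
   connected [Omega], hence all of it. *)
pose A := [set z | Omega z /\ nbhs z [set w | f w = 0]].
suff -> : Omega = A by move=> z [_ /nbhs_singleton].
symmetry; apply: cO.
- by exists a; split => //; apply/nbhs_normcP; exists r.
- exists A; last by rewrite eqEsubset; split => z; [move=> [Oz Az]|move=> []].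
  rewrite openE => z [Oz Az].
  have : nbhs z [set w | Omega w /\ f w = 0] by apply: filterI => //; exact: open_nbhs_nbhs.
  move=> /nbhs_normcP[s s0 hs]; apply/nbhs_normcP; exists s; [exact: s0|move=> w ws].
  split; first by have [] := hs _ ws.
  apply/nbhs_normcP; exists (s - normc (w - z)); first by rewrite subr_gt0.
  move=> v vw; have [|//] := hs v.
  by have := le_normcD (v - w) (w - z); rewrite addrA subrK; lra.
exists (closure A); first exact: closed_closure.
rewrite eqEsubset; split=> z; first by move=> [Oz Az]; split => //; apply: subset_closure.
move=> [Oz clz]; split => //.
have [s s0 [sO [fz0|[m [g [hg fg]]]]]] := holomorphic_factor oO hf Oz.
  by apply/nbhs_normcP; exists s.
exfalso.
have [v [[_ Av] vs]] : A `&` [set w | normc (w - z) < s] !=set0.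
  by apply: clz; apply/nbhs_normcP; exists s.
have : nbhs v [set w | f w = 0 /\ normc (w - z) < s].
  apply: filterI => //; apply/nbhs_normcP; exists (s - normc (v - z)); first by rewrite subr_gt0.
  by move=> x xv /=; have := le_normcD (x - v) (v - z); rewrite addrA subrK; lra.
move=> /nbhs_normcP[t t0 ht].
(* The point [v] of [A] near [z] may be [z] itself, where [(x - z) ^+ m] can vanish; a point of the
   neighbourhood different from [z] is needed for the contradiction. *)
have [x xz [fx xs]] : exists2 x, x != z & f x = 0 /\ normc (x - z) < s.
  have [vz|vz] := eqVneq v z; last first.
    by exists v => //; apply: ht; rewrite subrr normc0.
  exists (z + (t / 2)%:C).
    rewrite -subr_eq0 addrC addKr -normc_gt0 normc_real normr_gt0 gt_eqF//.
    by rewrite divr_gt0.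
  by apply: ht; rewrite vz addrC addKr normc_real ger0_norm; lra.
have [] := fg _ xs; rewrite fx => /eqP; rewrite eq_sym mulf_eq0 expf_eq0 => /orP[/andP[_]|->//].
by rewrite subr_eq0 (negbTE xz).
Qed.

End factorization.

(** * The logarithm of the modulus *)

Section log_modulus.
Variable R : realType.
Implicit Types (z w a : R[i]) (e : R) (f g F : R[i] -> R[i]) (Omega : set R[i]).

Definition neglog f z : R := - ln (normc (f z) ^+ 2).

(** The logarithmic derivative carries the gradient of [neglog f], namely -2 times its real part and
    2 times its imaginary part. Harmonicity of [neglog f] thus becomes the Cauchy-Riemann equations
    of [lder f]. *)
Definition lder f z : R[i] := cD f z / f z.

Let neglog_line (P Q : R -> R) (x p q : R) : is_derive x 1 P p -> is_derive x 1 Q q ->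
  0 < P x ^+ 2 + Q x ^+ 2 ->
  is_derive x 1 (fun t => - ln (P t ^+ 2 + Q t ^+ 2))
    (- (2 * (P x * p + Q x * q) / (P x ^+ 2 + Q x ^+ 2))).
Proof.
move=> dP dQ PQ.
have dS : is_derive x 1 (fun t => P t ^+ 2 + Q t ^+ 2) (2 * (P x * p + Q x * q)).
  have -> : 2 * (P x * p + Q x * q) = (P x * p + P x * p) + (Q x * q + Q x * q) by ring.
  exact: (is_deriveD (is_deriveM dP dP) (is_deriveM dQ dQ)).
have dl := is_derive1_ln PQ.
have := is_deriveN (@is_derive1_comp R (@ln R) (fun t => P t ^+ 2 + Q t ^+ 2) x _ _ dl dS); congr (is_derive _ _ _ _).
by congr (- _); exact: mulrC.
Qed.

Lemma neglog_partials f z d : f z != 0 -> cdiff f z d ->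
  pdx (neglog f) z (- 2 * complex.Re (d / f z)) /\ pdy (neglog f) z (2 * complex.Im (d / f z)).
Proof.
move=> fz0 /cdiff_partials[Px Qx Py Qy].
have E : neglog f = fun w => - ln (complex.Re (f w) ^+ 2 + complex.Im (f w) ^+ 2).
  by apply/funext => w; rewrite /neglog normc_sqr.
have ez : complex.Re z +i* complex.Im z = z by case: (z).
have n0 : 0 < complex.Re (f z) ^+ 2 + complex.Im (f z) ^+ 2.
  by rewrite -normc_sqr exprn_gt0// normc_gt0.
split.
  have := neglog_line Px Qx; rewrite ez => /(_ n0); rewrite E; congr (is_derive _ _ _ _).
  move: n0; case: (f z) (d) => [p q] [d1 d2] /= n0; field.
  by rewrite gt_eqF.
have := neglog_line Py Qy; rewrite ez => /(_ n0); rewrite E; congr (is_derive _ _ _ _).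
move: n0; case: (f z) (d) => [p q] [d1 d2] /= n0; field.
by rewrite gt_eqF.
Qed.

Lemma open_nonzero Omega f : open Omega -> holomorphic_on Omega f ->
  open (Omega `&` [set z | f z != 0]).
Proof.
move=> oO hf; rewrite openE => z [Oz fz].
have /cdiff_continuous cf := holomorphic_cdiff hf Oz.
have nb : nbhs (f z) [set v | v != 0].
  apply/nbhs_normcP; exists (normc (f z)); first by rewrite normc_gt0.
  by move=> v /= h; apply/eqP => v0; move: h; rewrite v0 sub0r normcN ltxx.
apply: filterI; last exact: (cf _ nb).
exact: open_nbhs_nbhs.
Qed.

Lemma holomorphic_lder Omega f : open Omega -> holomorphic_on Omega f ->
  holomorphic_on (Omega `&` [set z | f z != 0]) (lder f).
Proof.
move=> oO hf z [Oz fz].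
have h1 := holomorphic_cdiff (holomorphic_cD oO hf) Oz.
have h2 := holomorphic_cdiff hf Oz.
exact: (cdiff_derivable (cdiffM h1 (cdiffV fz h2))).
Qed.

Lemma cdiff_lder Omega f z : open Omega -> holomorphic_on Omega f -> Omega z -> f z != 0 ->
  cdiff (lder f) z (cD (lder f) z).
Proof.
by move=> oO hf Oz fz; exact: (holomorphic_cdiff (holomorphic_lder oO hf) (conj Oz fz)).
Qed.

Lemma ccont_lder Omega f z : open Omega -> holomorphic_on Omega f -> Omega z -> f z != 0 ->
  ccont (lder f) z /\ ccont (cD (lder f)) z.
Proof.
move=> oO hf Oz fz; have oO' := open_nonzero oO hf; have hl := holomorphic_lder oO hf.
split; apply/ccontP.
  exact: cdiff_continuous (holomorphic_cdiff hl (conj Oz fz)).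
exact: cdiff_continuous (holomorphic_cdiff (holomorphic_cD oO' hl) (conj Oz fz)).
Qed.

Lemma continuous_neglog Omega f z : holomorphic_on Omega f -> Omega z -> f z != 0 ->
  {for z, continuous (neglog f)}.
Proof.
move=> hf Oz fz; have /ccontP[cr ci] := cdiff_continuous (holomorphic_cdiff hf Oz).
have -> : neglog f = fun w => - ln (complex.Re (f w) * complex.Re (f w) + complex.Im (f w) * complex.Im (f w)).
  by apply/funext => w; rewrite /neglog normc_sqr !expr2.
apply: continuousN; apply: continuous_comp.
  exact: continuousD (continuousM cr cr) (continuousM ci ci).
by apply: continuous_ln; rewrite -!expr2 -normc_sqr exprn_gt0// normc_gt0.
Qed.

Let cdiff_power a z m : z != a ->
  cdiff (fun w => (w - a) ^+ m) z (m%:R * (z - a) ^+ m / (z - a)).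
Proof.
move=> za; have za0 : z - a != 0 by rewrite subr_eq0.
elim: m => [|m IH]; first by rewrite !mul0r; exact: cdiff_cst.
have := cdiffM (cdiffB (@cdiff_id R z) (cdiff_cst a z)) IH.
have -> : (fun w => (w - a) ^+ m.+1) = (fun w => (w - a) * (w - a) ^+ m).
  by apply/funext => w; rewrite exprS.
by congr cdiff; rewrite exprS -[m.+1]addn1 natrD; field.
Qed.

(** For [f = (w - a) ^+ m * g], the functions [neglog f], [lder f] and [cD (lder f)] differ from
    those of the power by the same functions of [g], which are continuous at [a], hence bounded
    nearby. Points with [f a != 0] are covered as well, so that one statement serves everywhere in
    [Omega]. *)
Lemma log_singularity Omega f a : domain Omega -> holomorphic_on Omega f ->
  nonconstant_on Omega f -> Omega a -> exists (m : nat) (r C : R),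
  [/\ 0 < r, 0 < C, (f a = 0 -> (0 < m)%N) &
   forall w, 0 < normc (w - a) < r -> [/\ Omega w, f w != 0,
     `|neglog f w - m%:R * neglog (fun w => w - a) w| <= C,
     normc (lder f w - m%:R / (w - a)) <= C &
     normc (cD (lder f) w + m%:R / (w - a) ^+ 2) <= C]].
Proof.
move=> dO hf nf Oa; have [m [g [r [r0 rO hg fg]]]] := holomorphic_local_form dO hf nf Oa.
have oB : open [set w | normc (w - a) < r].
  rewrite openE => w /= wr; apply/nbhs_normcP; exists (r - normc (w - a)); first by rewrite subr_gt0.
  by move=> v vw; have := le_normcD (v - w) (w - a); rewrite addrA subrK /=; lra.
have Ba : normc (a - a) < r by rewrite subrr normc0.
have ga := (fg _ Ba).2.
have bounded_near (h : R[i] -> R) : {for a, continuous h} -> exists s M, 0 < s /\ forall w, normc (w - a) < s -> `|h w| <= M.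
  move/cvgrPdist_lt => /(_ 1 ltr01) /nbhs_normcP[s s0 hs]; exists s, (1 + `|h a|); split=> // w ws.
  rewrite -(subrK (h a) (h w)) (le_trans (ler_normD _ _))// lerD2r distrC ltW//.
  exact: hs.
have cbounded_near (h : R[i] -> R[i]) : ccont h a -> exists s M, 0 < s /\ forall w, normc (w - a) < s -> normc (h w) <= M.
  move=> [/bounded_near[s [M [s0 hs]]] /bounded_near[s' [M' [s0' hs']]]].
  exists (Num.min s s'), (M + M'); split; first by rewrite lt_min s0.
  move=> w; rewrite lt_min => /andP[/hs h1 /hs' h2].
  by apply: le_trans (normc_le_abs _) _; exact: lerD.
have [cl cl'] := ccont_lder oB hg Ba ga.
have [s1 [M1 [s10 h1]]] := bounded_near _ (continuous_neglog hg Ba ga).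
have [s2 [M2 [s20 h2]]] := cbounded_near _ cl.
have [s3 [M3 [s30 h3]]] := cbounded_near _ cl'.
pose C := `|M1| + `|M2| + `|M3| + 1.
have CM : [/\ 0 < C, M1 <= C, M2 <= C & M3 <= C].
  have := ler_norm M1; have := ler_norm M2; have := ler_norm M3.
  have := normr_ge0 M1; have := normr_ge0 M2; have := normr_ge0 M3.
  by rewrite /C => *; split; lra.
have [C0 C1 C2 C3] := CM.
exists m, (Num.min r (Num.min s1 (Num.min s2 s3))), C; split => //.
- by rewrite !lt_min r0 s10 s20 s30.
- move=> fa0; have [fE _] := fg _ Ba; rewrite lt0n; apply/eqP => m0.
  by move: fE; rewrite fa0 m0 expr0 mul1r => /esym/eqP; rewrite (negbTE ga).
have lE v : normc (v - a) < r -> v != a -> lder f v = m%:R / (v - a) + lder g v.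
  move=> vr va; have [fE gv] := fg _ vr; have va0 : v - a != 0 by rewrite subr_eq0.
  have dg := holomorphic_cdiff hg (vr : [set w | normc (w - a) < r] v).
  have near_f : \forall x \near v, (x - a) ^+ m * g x = f x.
    apply: filterS (open_nbhs_nbhs (conj oB vr)) => x xr.
    by have [->] := fg _ xr.
  have dfE := cdiff_cD (cdiff_near near_f (cdiffM (cdiff_power m va) dg)).
  rewrite /lder dfE.
  rewrite fE; field; rewrite gv va0 /=; exact: expf_neq0.
move=> w; rewrite !lt_min => /andP[w0 /andP[wr /andP[w1 /andP[w2 w3]]]].
have wa0 : w - a != 0 by rewrite -normc_gt0.
have wa : w != a by rewrite -subr_eq0.
have [fE gw] := fg _ wr.
have fw0 : f w != 0 by rewrite fE mulf_neq0// expf_neq0.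
split => //; first exact: rO.
- have -> : neglog f w - m%:R * neglog (fun w => w - a) w = neglog g w.
    rewrite /neglog fE normcM.
    have nX (x : R[i]) k : normc (x ^+ k) = normc x ^+ k.
      by elim: k => [|k IHk]; rewrite ?expr0 ?normc1// !exprS normcM IHk.
    have p1 : (normc (w - a) ^+ m) ^+ 2 \is Num.pos by rewrite posrE !exprn_gt0.
    have p2 : normc (g w) ^+ 2 \is Num.pos by rewrite posrE exprn_gt0// normc_gt0.
    have p3 : 0 < normc (w - a) ^+ 2 by rewrite exprn_gt0.
    rewrite nX exprMn lnM// -exprM mulnC exprM lnXn// mulr_natl; ring.
  exact: le_trans (h1 _ w1) C1.
- by rewrite lE// addrC addKr; exact: le_trans (h2 _ w2) C2.
have -> : cD (lder f) w = - m%:R / (w - a) ^+ 2 + cD (lder g) w; last first.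
  by rewrite mulNr addrAC addNr add0r; exact: le_trans (h3 _ w3) C3.
apply: cdiff_cD.
have d1 := @cdiffV _ (fun z => z - a) w _ wa0 (cdiffB (@cdiff_id R _) (cdiff_cst a _)).
have d2 := cdiffZ m%:R d1.
have d3 := @cdiff_lder _ _ w oB hg wr gw.
have d4 := cdiffB d2 (cdiffZ (-1) d3).
have -> : - m%:R / (w - a) ^+ 2 + cD (lder g) w = m%:R * (- (1 - 0) / (w - a) ^+ 2) - -1 * cD (lder g) w.
  by rewrite mulN1r opprK subr0; ring.
apply: cdiff_near d4.
have oBa : open ([set w | normc (w - a) < r] `&` [set w | w - a != 0]).
  apply: (@open_nonzero _ (fun w => w - a) oB) => z _.
  exact: (cdiff_derivable (cdiffB (@cdiff_id R _) (cdiff_cst a _))).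
apply: filterS (open_nbhs_nbhs (conj oBa (conj wr wa0))) => v [vr va].
by rewrite lE ?mulN1r ?opprK// -subr_eq0.
Qed.

End log_modulus.

(** * Lebesgue measure in the plane *)

Section plane_measure.
Variable R : realType.
Implicit Types (z w a : R[i]) (e : R) (h : R[i] -> R) (A B K V : set R[i]).
Notation mu := (@lebesgue_measure R).

Definition planeset A : set (plane R) := @to_C R @^-1` A.

(** Compactness as an induction principle: if [P K] failed, the sets [A] with [P (K \ A)] would form
    a proper filter, and the local hypothesis excludes a cluster point of it in [K]. *)
Lemma compact_ind (P : set R[i] -> Prop) K : P set0 ->
  (forall A B, A `<=` B -> P B -> P A) -> (forall A B, P A -> P B -> P (A `|` B)) ->
  (forall z, K z -> exists2 U, nbhs z U & P U) -> compact K -> P K.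
Proof.
move=> P0 PS PU loc cK; have [//|nPK] := pselect (P K); exfalso.
pose F : set_system R[i] := fun A => P (K `\` A).
have FF : ProperFilter F.
  split; first by rewrite /F setD0.
  split; first by rewrite /F setDT.
    by move=> A B FA FB; rewrite /F setDIr; exact: PU.
  by move=> A B AB; rewrite /F; apply: PS; exact: setDS.
have [|z [Kz clz]] := cK F FF; first by rewrite /F setDv.
have [U zU PUU] := loc z Kz.
have [|w [nU Uw]] := clz (~` U) U _ zU; last exact: nU.
by rewrite /F; apply: PS PUU => w [_ /contrapT].
Qed.

Lemma planeset_box z e : planeset (box z e) =
  `](complex.Re z - e), (complex.Re z + e)[%classic `*` `](complex.Im z - e), (complex.Im z + e)[%classic.
Proof.
apply/seteqP; split => -[x y] /=; rewrite /planeset /to_C /box /= !in_itv/= !ltr_distl.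
  by move=> [-> ->].
by move=> [-> ->].
Qed.

Lemma measurable_box z e : measurable (planeset (box z e)).
Proof. by rewrite planeset_box; exact: measurableX. Qed.

(** Measurability refers to the product sigma-algebra, so an open set is written as a countable
    union of boxes with rational centres and radii [1 / (n + 1)]. The centre is taken within one
    radius of the point, which is why twice the radius must stay below [e]. *)
Lemma measurable_open V : open V -> measurable (planeset V).
Proof.
move=> oV; pose F (p : rat * rat * nat) : set (plane R) :=
  let b := box (ratr p.1.1 +i* ratr p.1.2 : R[i]) p.2.+1%:R^-1 in
  if `[< b `<=` V >] then planeset b else set0.
have -> : planeset V = \bigcup_p F p.
  apply/seteqP; split => [[x y] Vxy|[x y] [p _]]; last first.
    by rewrite /F; case: asboolP => // bV; exact: bV.
  have [e e0 eV] : exists2 e, 0 < e & box (x +i* y) e `<=` V.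
    by apply/nbhs_boxP; exact: open_nbhs_nbhs.
  pose n := Num.bound (2 / e).
  have n2 : 2 * n.+1%:R^-1 < e.
    rewrite ltr_pdivrMr// -ltr_pdivrMl// mulrC.
    have := archi_boundP (ltW (divr_gt0 (ltr0n R 2) e0)); rewrite -/n => /lt_trans; apply.
    by rewrite ltr_nat.
  have n0 : 0 < (n.+1%:R : R)^-1 by rewrite invr_gt0.
  move: n2 n0; set d : R := n.+1%:R^-1 => n2 n0.
  have [q1 /[!in_itv]/= /andP[q1a q1b]] : exists q : rat, ratr q \in `]x - d, x + d[.
    by apply: rat_in_itvoo; lra.
  have [q2 /[!in_itv]/= /andP[q2a q2b]] : exists q : rat, ratr q \in `]y - d, y + d[.
    by apply: rat_in_itvoo; lra.
  exists (q1, q2, n) => //; rewrite /F /= -/d; case: asboolP => [_|]; last first.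
    move=> nb; exfalso; apply: nb => -[s t] [/= h1 h2]; apply: eV; split => /=.
      by move: h1; rewrite !ltr_distl => /andP[? ?]; apply/andP; split; lra.
    by move: h2; rewrite !ltr_distl => /andP[? ?]; apply/andP; split; lra.
  by split => /=; rewrite ltr_distl; apply/andP; split; lra.
apply: countable_bigcupT_measurable; first exact: countableP.
by move=> p; rewrite /F; case: ifP => // _; exact: measurable_box.
Qed.

Lemma compact_closedC K : compact K -> closed K.
Proof. by move=> cK; apply: compact_closed => //; exact: norm_hausdorff. Qed.

Lemma measurable_compact K : compact K -> measurable (planeset K).
Proof.
move=> /compact_closedC/closed_openC/measurable_open/measurableC.
by rewrite /planeset preimage_setC setCK.
Qed.

Lemma measurable_continuous V h : open V -> (forall z, V z -> {for z, continuous h}) ->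
  measurable_fun (planeset V) (h \o @to_C R).
Proof.
move=> oV ch; apply: (measurability _ (RGenOpens.measurableE R)).
move=> _ [_ [a [b ->] <-]].
pose U := [set z | V z /\ h z \in `]a, b[].
rewrite (_ : _ `&` _ = planeset U).
  apply: measurable_open; rewrite openE => z [Vz hz].
  apply: filterI; first exact: open_nbhs_nbhs.
  have nb : nbhs (h z) `]a, b[%classic.
    by apply: open_nbhs_nbhs; split; [exact: interval_open|exact: hz].
  exact: (ch _ Vz _ nb).
by apply/seteqP; split.
Qed.

Lemma dA_rect (a b c d : R) : a <= b -> c <= d ->
  dA R (`]a, b[%classic `*` `]c, d[%classic) = ((b - a) * (d - c))%:E.
Proof.
move=> ab cd.
have E := @product_measure1E _ _ (measurableTypeR R) (measurableTypeR R) R mu mu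
  `]a, b[%classic `]c, d[%classic (measurable_itv _) (measurable_itv _).
apply: etrans E _; rewrite /= !lebesgue_measure_itv/= !lte_fin.
have -> : (if a < b then (b%:E - a%:E)%E else 0%E) = (b - a)%:E.
  by case: ltP => //= ba; have -> : a = b by [apply/eqP; rewrite eq_le ab]; rewrite subrr.
have -> : (if c < d then (d%:E - c%:E)%E else 0%E) = (d - c)%:E.
  by case: ltP => //= ba; have -> : c = d by [apply/eqP; rewrite eq_le cd]; rewrite subrr.
by rewrite EFinM.
Qed.

Lemma dA_box z e : 0 <= e -> dA R (planeset (box z e)) = ((2 * e) ^+ 2)%:E.
Proof.
move=> e0; rewrite planeset_box dA_rect; [|lra|lra].
by congr EFin; ring.
Qed.

Lemma dA_compact K : compact K -> (dA R (planeset K) < +oo)%E.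
Proof.
move=> cK; pose P A := exists B, [/\ A `<=` B, measurable (planeset B) & (dA R (planeset B) < +oo)%E].
suff [B [KB mB Bfin]] : P K.
  apply: le_lt_trans Bfin; apply: le_measure; rewrite ?inE//; first exact: measurable_compact.
  by move=> q; exact: KB.
apply: compact_ind cK.
- by exists set0; split => //; rewrite /planeset preimage_set0 ?measure0.
- by move=> A B AB [C [BC mC Cfin]]; exists C; split => //; exact: subset_trans BC.
- move=> A B [A' [AA' mA' fA']] [B' [BB' mB' fB']]; exists (A' `|` B'); split.
  + exact: setUSS.
  + by rewrite /planeset preimage_setU; exact: measurableU.
  + rewrite /planeset preimage_setU; apply: le_lt_trans (measureU2 _ mA' mB') _.
    by rewrite lte_add_pinfty.
- move=> z _; exists (box z 1); first by apply: open_nbhs_nbhs; split; [exact: box_open|exact: box_center].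
  by exists (box z 1); split => //; [exact: measurable_box|rewrite dA_box// ltry].
Qed.

Lemma Lnorm_lty (p : R) h K : 0 < p -> measurable (planeset K) ->
  ('N[dA R]_(p%:E)[EFin \o (h \* \1_K)%R \o @to_C R] < +oo)%E <->
  (\int[dA R]_(q in planeset K) (`|h (to_C q)| `^ p)%:E < +oo)%E.
Proof.
move=> p0 mK.
have -> : (\int[dA R]_(q in planeset K) (`|h (to_C q)| `^ p)%:E)%E =
  (\int[dA R]_q (`| (EFin \o (h \* \1_K)%R \o @to_C R) q | `^ p))%E.
  rewrite integral_mkcond; apply: eq_integral => q _; rewrite /= patchE.
  case: ifPn => [|]; rewrite ?inE ?notin_setE => qK /=.
    by rewrite indicE mem_set ?mulr1.
  by rewrite indicE memNset ?mulr0 ?normr0 ?powR0// gt_eqF.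
split=> [|H].
  by rewrite unlock; apply: lty_poweRy; rewrite invr_neq0// gt_eqF.
by rewrite unlock; apply: poweR_lty.
Qed.

End plane_measure.

(** * Integrability of the model singularity *)

Section kernel.
Variable R : realType.
Implicit Types (z w a : R[i]) (e : R) (h : R[i] -> R) (A B K V : set R[i]).

(** Made for functions that are continuous off the zeros of [f] and take one default value on
    them. *)
Lemma measurable_off V U h c : open V -> open U -> U `<=` V ->
  (forall z, U z -> {for z, continuous h}) -> (forall z, V z -> ~ U z -> h z = c) ->
  measurable_fun (planeset V) (h \o @to_C R).
Proof.
move=> oV oU UV ch hc.
have mU := measurable_open oU.
have mD : measurable (planeset (V `\` U)).
  have -> : planeset (V `\` U) = planeset V `\` planeset U by [].
  by apply: measurableD => //; exact: measurable_open.
have -> : planeset V = planeset U `|` planeset (V `\` U).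
  by apply/seteqP; split=> [q Vq|q [/UV//|[]//]]; have [Uq|nUq] := pselect (U (to_C q)); [left|right].
apply/measurable_funU => //; split; first exact: measurable_continuous.
apply: (eq_measurable_fun (cst c)); last exact: measurable_cst.
by move=> q; rewrite inE => -[Vq nUq] /=; rewrite hc.
Qed.

Definition ell a : R[i] -> R := neglog (fun z => z - a).

(* Up to a constant factor, the squared gradient of [log (- log |w - a|^2)]. *)
Definition kap a w : R := (normc (w - a) ^+ 2 * ell a w ^+ 2)^-1.

Lemma holomorphic_subr V a : holomorphic_on V (fun z => z - a).
Proof. by move=> z _; exact: (cdiff_derivable (cdiffB (@cdiff_id R _) (cdiff_cst a _))). Qed.

Lemma continuous_ell a w : w != a -> {for w, continuous (ell a)}.
Proof.
move=> wa; apply: (@continuous_neglog _ setT); [exact: holomorphic_subr|by []|].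
by rewrite subr_eq0.
Qed.

Lemma ell_gt a w (k : nat) : 0 < normc (w - a) ^+ 2 ->
  normc (w - a) ^+ 2 <= 2^-1 ^+ k -> k%:R * ln 2 <= ell a w.
Proof.
move=> s0 sk; rewrite /ell /neglog lerNr mulr_natl -lnXn ?ltr0n// -lnV ?posrE ?exprn_gt0//.
by rewrite ler_ln ?posrE ?invr_gt0 ?s0 ?exprn_gt0// -exprVn.
Qed.

Lemma ln2_gt0 : 0 < ln 2 :> R.
Proof. by rewrite ln_gt0// ltr1n. Qed.

Lemma kap_ge0 a w : 0 <= kap a w.
Proof. by rewrite invr_ge0 mulr_ge0// sqr_ge0. Qed.

Lemma kap_center a : kap a a = 0.
Proof. by rewrite /kap subrr normc0 expr0n mul0r invr0. Qed.

Lemma box_normc_le a r w : box a r w -> 0 <= r -> normc (w - a) ^+ 2 <= 2 * r ^+ 2.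
Proof.
move=> [h1 h2] r0; rewrite normc_sqr ReB ImB mulr2n mulrDl mul1r.
by apply: lerD; rewrite -[leLHS]real_normK ?num_real//; apply: lerXn2r; rewrite ?nnegrE// ltW.
Qed.

Lemma ell_ge_ln2 a w : box a (4^-1) w -> w != a -> ln 2 <= ell a w.
Proof.
move=> wb wa; rewrite -[ln 2]mul1r; apply: (@ell_gt a w 1).
  by rewrite exprn_gt0// normc_gt0 subr_eq0.
by apply: le_trans (box_normc_le wb _) _ => //; lra.
Qed.

Lemma continuous_kap a w : box a (4^-1) w -> w != a -> {for w, continuous (kap a)}.
Proof.
move=> wb wa.
have n0 : 0 < normc (w - a) ^+ 2 by rewrite exprn_gt0// normc_gt0 subr_eq0.
have l0 : 0 < ell a w ^+ 2.
  by rewrite exprn_gt0//; apply: lt_le_trans (ell_ge_ln2 wb wa); exact: ln2_gt0.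
apply: continuousV; first by rewrite mulf_neq0// gt_eqF.
have -> : (fun w => normc (w - a) ^+ 2 * ell a w ^+ 2) =
  (fun w => ((complex.Re w - complex.Re a) * (complex.Re w - complex.Re a) + (complex.Im w - complex.Im a) * (complex.Im w - complex.Im a)) * (ell a w * ell a w)).
  by apply/funext => v; rewrite normc_sqr ReB ImB !expr2.
have cr := continuousB (@continuous_Re R w) (@cst_continuous _ _ (complex.Re a) w).
have ci := continuousB (@continuous_Im R w) (@cst_continuous _ _ (complex.Im a) w).
have cl := continuous_ell wa.
exact: continuousM (continuousD (continuousM cr cr) (continuousM ci ci)) (continuousM cl cl).
Qed.

Lemma measurable_kap a r : 0 < r <= 4^-1 -> measurable_fun (planeset (box a r)) (kap a \o @to_C R).
Proof.
move=> /andP[r0 r4].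
apply: (@measurable_off _ (box a r `&` [set w | w - a != 0]) _ 0).
- exact: box_open.
- by apply: open_nonzero; [exact: box_open|exact: holomorphic_subr].
- by move=> w [].
- move=> z [[z1 z2] /= za]; apply: continuous_kap; last by rewrite -subr_eq0.
  by split; exact: lt_le_trans r4.
- move=> z zb nz; have [->|za] := eqVneq z a; first exact: kap_center.
  by exfalso; apply: nz; split => //=; rewrite subr_eq0.
Qed.

(** [k] indexes the dyadic shell containing [w]: the sup-norm distance to [a] lies in
    [[2^-(k+1), 2^-k)]. There [normc (w - a) ^+ 2 >= 4^-(k+1)], and [ell a w >= (2k - 1) ln 2],
    which exceeds [(k + 1) ln 2 / 4] because [k >= 2] in the box of radius 1/4. *)
Lemma kap_le_series a w : box a (4^-1) w -> w != a -> exists2 k : nat, box a (2^-1 ^+ k) w &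
  kap a w <= (4 ^+ k.+1) / (k.+1%:R * ln 2 / 4) ^+ 2.
Proof.
move=> wb wa; pose n := Num.max `|complex.Re w - complex.Re a| `|complex.Im w - complex.Im a|.
have n0 : 0 < n.
  rewrite /n lt_max !normr_gt0 !subr_eq0 -negb_and; apply: contra wa => /andP[h1 h2].
  by rewrite eq_complex h1 h2.
have n4 : n < 4^-1 by rewrite /n gt_max; case: wb => -> ->.
have ex : exists k : nat, 2^-1 ^+ k <= n.
  exists (Num.bound n^-1); rewrite exprVn -[leRHS]invrK lef_pV2 ?posrE ?invr_gt0 ?exprn_gt0//.
  by apply: ltW; exact: upper_nthrootP.
case: (ex_minnP ex) => -[|k] kn kmin.
  by exfalso; move: kn; rewrite expr0; lra.
have nk : n < 2^-1 ^+ k by rewrite ltNge; apply/negP => /kmin; rewrite ltnn.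
exists k; first by move: nk; rewrite /n gt_max => /andP[].
have s0 : 0 < normc (w - a) ^+ 2 by rewrite exprn_gt0// normc_gt0 subr_eq0.
have sn : n ^+ 2 <= normc (w - a) ^+ 2.
  rewrite normc_sqr ReB ImB /n.
  have [_|_] := leP `|complex.Re w - complex.Re a| `|complex.Im w - complex.Im a|;
    rewrite real_normK ?num_real//.
    by rewrite lerDr sqr_ge0.
  by rewrite lerDl sqr_ge0.
have ns : normc (w - a) ^+ 2 <= 2 * n ^+ 2.
  rewrite normc_sqr ReB ImB mulr2n mulrDl mul1r; apply: lerD;
    rewrite -[leLHS]real_normK ?num_real//; apply: lerXn2r; rewrite ?nnegrE ?(ltW n0)//;
    by rewrite /n le_max lexx ?orbT.
have k2 : (1 < k)%N.
  case: k kn nk {kmin} => [|[|//]]; rewrite ?expr1; lra.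
have L : k.+1%:R * ln 2 / 4 <= ell a w.
  have : (k * 2 - 1)%:R * ln 2 <= ell a w.
    apply: ell_gt => //; apply: le_trans ns _.
    have : n ^+ 2 <= (2^-1 ^+ k) ^+ 2 by apply: lerXn2r; rewrite ?nnegrE ?exprn_ge0 ?ltW.
    have -> : (2^-1 ^+ k) ^+ 2 = 2^-1 * 2^-1 ^+ (k * 2 - 1) :> R.
      by rewrite -exprM -exprS -subSn ?subn1// muln_gt0 andbT ltnW.
    lra.
  apply: le_trans; rewrite mulrAC; apply: ler_wpM2r; first exact: ltW ln2_gt0.
  have kk : (k <= k * 2 - 1)%N by rewrite muln2 -addnn -addnBA ?(ltnW k2)// leq_addr.
  rewrite ler_pdivrMr// -natrM ler_nat; apply: leq_trans (leq_mul kk (leqnn 4)).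
  apply: (@leq_trans (k * 2)); last by rewrite leq_mul2l orbT.
  by rewrite muln2 -addnn -addn1 leq_add2l ltnW.
have L0 : 0 < k.+1%:R * ln 2 / 4 :> R by rewrite !mulr_gt0// ln2_gt0.
rewrite /kap -[4 ^+ _]invrK -invfM lef_pV2 ?posrE; last 2 first.
- by rewrite mulr_gt0// exprn_gt0//; exact: lt_le_trans L.
- by rewrite mulr_gt0 ?invr_gt0 ?exprn_gt0.
apply: ler_pM.
- by rewrite invr_ge0 exprn_ge0.
- by rewrite sqr_ge0.
- apply: le_trans sn; have -> : (4 ^+ k.+1)^-1 = (2^-1 ^+ k.+1) ^+ 2 :> R.
    rewrite -exprM mulnC exprM -exprVn; congr (_ ^+ _); rewrite exprVn.
    by congr (_^-1); rewrite -natrX.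
  by apply: lerXn2r; rewrite ?nnegrE ?exprn_ge0 ?(ltW n0).
- by apply: lerXn2r; rewrite ?nnegrE ?(ltW L0)//; exact: le_trans (ltW L0) L.
Qed.

(** The area [4 / 4 ^+ k] of the k-th box cancels the power [4 ^+ k.+1] in the shell bound, and the
    squared logarithm leaves the convergent series of [1 / (k + 1) ^ 2]. *)
Lemma kap_integral_lty a : (\int[dA R]_(q in planeset (box a (4^-1))) (kap a (to_C q))%:E < +oo)%E.
Proof.
pose D := planeset (box a (4^-1)).
have mD : measurable D by exact: measurable_box.
pose c (k : nat) : R := (4 ^+ k.+1) / (k.+1%:R * ln 2 / 4) ^+ 2.
have c0 k : 0 <= c k by apply: divr_ge0; [exact: exprn_ge0|exact: sqr_ge0].
pose b (k : nat) := planeset (box a (2^-1 ^+ k)).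
have mb k : measurable (b k) by exact: measurable_box.
pose F k (q : plane R) : \bar R := (c k * \1_(b k) q)%:E.
have mF k : measurable_fun D (F k).
  by apply/measurable_EFinP; apply: measurable_funM => //; exact: measurable_indic.
have F0 k q : D q -> (0 <= F k q)%E.
  by move=> _; rewrite lee_fin mulr_ge0.
have IF k : (\int[dA R]_(q in D) F k q <= ((256 / ln 2 ^+ 2) / k.+1%:R ^+ 2)%:E)%E.
  rewrite /F; under eq_integral do rewrite EFinM.
  rewrite ge0_integralZl//=; last 2 first.
  - by apply/measurable_EFinP; exact: measurable_indic.
  - by rewrite lee_fin.
  rewrite integral_indic//.
  apply: (@le_trans _ _ ((c k)%:E * dA R (b k))%E).
    apply: lee_pmul => //; first by rewrite lee_fin.
    by apply: le_measure; rewrite ?inE//; exact: measurableI.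
  rewrite /b dA_box ?exprn_ge0// -EFinM lee_fin /c.
  have -> : (2 * 2^-1 ^+ k) ^+ 2 = 4 / 4 ^+ k :> R.
    rewrite exprMn exprVn -exprVn -exprM mulnC exprM -exprVn.
    by congr (_ * _ ^+ _); rewrite ?exprVn -natrX.
  have k40 : 4 ^+ k != 0 :> R by rewrite expf_neq0.
  have l0 : ln 2 != 0 :> R by rewrite gt_eqF// ln2_gt0.
  rewrite exprS le_eqVlt; apply/orP; left; apply/eqP; field.
  by rewrite k40 l0 /= addrC natr1 pnatr_eq0.
apply: (@le_lt_trans _ _ (\int[dA R]_(q in D) (\sum_(k <oo) F k q))%E).
  apply: ge0_le_integral => //.
  - by move=> q _; rewrite lee_fin kap_ge0.
  - apply/measurable_EFinP; apply: measurable_kap; lra.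
  - apply: (ge0_emeasurable_sum (h := F) (P := xpredT)) => [k q Dq _|k _]; [exact: F0|exact: mF].
  move=> q Dq; have [qa|qa] := eqVneq (to_C q) a.
    by rewrite qa kap_center; apply: nneseries_ge0 => k _ _; exact: F0.
  have [k bk kk] := kap_le_series Dq qa.
  apply: (@le_trans _ _ (F k q)); first by rewrite /F indicE mem_set// mulr1 lee_fin.
  apply: le_trans (nneseries_lim_ge k.+1 _); last by move=> n *; exact: F0.
  by rewrite big_nat_recr//=; apply: leeDr; apply: sume_ge0 => n _; exact: F0.
rewrite integral_nneseries//.
pose M : R := 256 / ln 2 ^+ 2.
have M0 : 0 <= M by rewrite divr_ge0// sqr_ge0.
apply: (@le_lt_trans _ _ (M * 2)%:E); last exact: ltry.
apply: lime_le; first by apply: is_cvg_nneseries => k _ _; apply: integral_ge0 => q; exact: F0.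
apply: nearW => n; apply: (@le_trans _ _ (\sum_(0 <= k < n) (M / k.+1%:R ^+ 2)%:E)%E).
  by apply: lee_sum => k _; exact: IF.
rewrite sumEFin lee_fin -mulr_sumr; apply: ler_wpM2l => //.
case: n => [|n]; first by rewrite big_geq.
(* The telescoping bound [2 - 1 / n] for the partial sums of the inverse squares, proved by
   induction. *)
apply: (@le_trans _ _ (2 - n.+1%:R^-1)); last by rewrite gerBl invr_ge0.
elim: n => [|n IH]; first by rewrite big_nat1 expr1n invr1; lra.
rewrite big_nat_recr//=; apply: le_trans (lerD IH (lexx _)) _.
have n1 : 0 < n.+1%:R :> R by rewrite ltr0n.
have -> : n.+2%:R = n.+1%:R + 1 :> R by rewrite -natr1.
move: n1; set x := (n.+1%:R : R) => x0.
rewrite -subr_ge0.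
have -> : 2 - (x + 1)^-1 - (2 - x^-1 + (x + 1) ^- 2) = (x * (x + 1) ^+ 2)^-1.
  by field; rewrite !gt_eqF//; lra.
by rewrite invr_ge0 mulr_ge0 ?sqr_ge0 ?ltW.
Qed.

End kernel.

(** * Local integrability and test functions *)

Section local_integrability.
Variable R : realType.
Implicit Types (z w a : R[i]) (e : R) (h : R[i] -> R) (A B K V : set R[i]).

Lemma ge0_integral_setU_lty (f : plane R -> R) (A B : set (plane R)) :
  measurable A -> measurable B -> measurable_fun A f -> measurable_fun B f ->
  (forall q, 0 <= f q) -> (\int[dA R]_(q in A) (f q)%:E < +oo)%E -> (\int[dA R]_(q in B) (f q)%:E < +oo)%E ->
  (\int[dA R]_(q in A `|` B) (f q)%:E < +oo)%E.
Proof.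
move=> mA mB fA fB f0 iA iB.
have -> : A `|` B = A `|` (B `\` A).
  by apply/seteqP; split=> q; [move=> [|Bq]; [left|have [|] := pselect (A q); [left|right]]|move=> [|[]]; [left|right]].
have mBA : measurable (B `\` A) by exact: measurableD.
have fBA : measurable_fun (B `\` A) f by apply: measurable_funS fB => // q [].
rewrite ge0_integral_setU//=; last 3 first.
- by apply/measurable_EFinP; apply/measurable_funU.
- by move=> q _; rewrite lee_fin.
- by apply/disj_setPS => q [Aq [_ /(_ Aq)]].
rewrite lte_add_pinfty//; apply: le_lt_trans iB.
apply: ge0_subset_integral => //; first exact/measurable_EFinP.
by move=> q _; rewrite lee_fin.
Qed.

(** The criterion behind the local integrability statements: the additive constant handles points
    where [h] is bounded, the kernel handles the zeros. Radius at most 1/4 keeps [ell a] above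
    [ln 2], away from its own zeros on the unit circle around [a]. *)
Definition kap_dominated V h := forall a, V a -> exists r C D, 0 < r <= 4^-1 /\
  forall w, box a r w -> V w -> h w <= C * kap a w + D.

Lemma Lp_loc_intro (p : R) V h : 0 < p -> open V ->
  measurable_fun (planeset V) (h \o @to_C R) ->
  kap_dominated V (fun w => `|h w| `^ p) -> Lp_loc p%:E V h.
Proof.
move=> p0 oV mh dom; split => // K cK KV.
apply/Lnorm_lty => //; first exact: measurable_compact.
have mp A : measurable (planeset A) -> A `<=` V -> measurable_fun (planeset A) (fun q => `|h (to_C q)| `^ p).
  move=> mA AV; have mhA : measurable_fun (planeset A) (h \o @to_C R).
    by apply: measurable_funS mh; [exact: measurable_open|move=> q /AV].
  exact: (measurableT_comp (measurable_powR p) (measurableT_comp (@normr_measurable R setT) mhA)).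
pose Q A := exists B, [/\ A `<=` B, measurable (planeset B), B `<=` V &
  (\int[dA R]_(q in planeset B) (`|h (to_C q)| `^ p)%:E < +oo)%E].
suff [B [KB mB BV iB]] : Q K.
  apply: le_lt_trans iB; apply: ge0_subset_integral => //; first exact: measurable_compact.
    by apply/measurable_EFinP; exact: mp.
  by move=> q; exact: KB.
apply: compact_ind cK.
- by exists set0; split => //; [rewrite /planeset preimage_set0|rewrite /planeset preimage_set0 integral_set0].
- by move=> A B AB [C [BC mC CV iC]]; exists C; split => //; exact: subset_trans BC.
- move=> A B [A' [AA' mA' VA' iA']] [B' [BB' mB' VB' iB']]; exists (A' `|` B'); split.
  + exact: setUSS.
  + by rewrite /planeset preimage_setU; exact: measurableU.
  + by move=> w [/VA'|/VB'].
  + rewrite /planeset preimage_setU.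
    by apply: (ge0_integral_setU_lty (f := fun q => `|h (to_C q)| `^ p)) => //; exact: mp.
move=> a /KV Va; have [r [C [D [/andP[r0 r4] hD]]]] := dom a Va.
have [rho rho0 rhoV] := open_box oV Va.
pose s := Num.min r rho; have s0 : 0 < s by rewrite lt_min r0.
have sV : box a s `<=` V.
  by move=> w [w1 w2]; apply: rhoV; split; [apply: lt_le_trans w1 _|apply: lt_le_trans w2 _]; rewrite /s ge_min lexx orbT.
exists (box a s); first by apply: open_nbhs_nbhs; split; [exact: box_open|exact: box_center].
exists (box a s); split => //; first exact: measurable_box.
have s4 : s <= 4^-1 by rewrite /s ge_min r4.
have mb : measurable (planeset (box a s)) by exact: measurable_box.
have mk : measurable_fun (planeset (box a s)) (fun q => kap a (to_C q)).
  by apply: measurable_kap; rewrite s0.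
apply: (@le_lt_trans _ _ (\int[dA R]_(q in planeset (box a s)) ((`|C| * kap a (to_C q))%:E + `|D|%:E))%E).
  apply: ge0_le_integral => //.
  - by apply/measurable_EFinP; apply: mp.
  - by apply: emeasurable_funD => //; apply/measurable_EFinP; exact: measurable_funM.
  move=> q qs; rewrite -EFinD lee_fin.
  have qr : box a r (to_C q).
    by case: qs => [q1 q2]; split; [apply: lt_le_trans q1 _|apply: lt_le_trans q2 _]; rewrite /s ge_min lexx.
  apply: le_trans (hD _ qr (sV _ qs)) _; apply: lerD; last exact: ler_norm.
  by apply: ler_wpM2r; [exact: kap_ge0|exact: ler_norm].
have fin1 : (\int[dA R]_(q in planeset (box a s)) (kap a (to_C q))%:E < +oo)%E.
  apply: le_lt_trans (kap_integral_lty a); apply: ge0_subset_integral => //.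
  - exact: measurable_box.
  - by apply/measurable_EFinP; apply: measurable_kap; lra.
  - by move=> q _; rewrite lee_fin kap_ge0.
  - by move=> q [q1 q2]; split; exact: lt_le_trans s4.
rewrite ge0_integralD//; last 2 first.
- by move=> q _; rewrite lee_fin mulr_ge0// kap_ge0.
- by apply/measurable_EFinP; exact: measurable_funM.
rewrite lte_add_pinfty//.
  under eq_integral do rewrite EFinM.
  rewrite ge0_integralZl//; last 2 first.
  - exact/measurable_EFinP.
  - by move=> q _; rewrite lee_fin kap_ge0.
  by rewrite lte_mul_pinfty// lee_fin.
rewrite integral_cst// dA_box ?(ltW s0)//; exact: ltry.
Qed.

Lemma Lp_loc1_integrable V h K : open V -> Lp_loc 1%E V h -> compact K -> K `<=` V ->
  (dA R).-integrable (planeset K) (fun q => (h (to_C q))%:E).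
Proof.
move=> oV [mh hK] cK KV; have mK := measurable_compact cK.
have := hK K cK KV; rewrite (Lnorm_lty (p := 1) h ltr01 mK) => H.
apply/integrableP; split.
  apply/measurable_EFinP.
  by apply: measurable_funS mh; [exact: measurable_open|move=> q /KV].
under eq_integral do rewrite /= -[`|h _|]powRr1//.
exact: H.
Qed.

(** Expanding [(|h| - 1) ^ 2 >= 0] gives [|h| <= |h| ^ 2 + 1], so square domination yields local
    integrability at the cost of a constant. *)
Lemma kap_dominated_sqr V h : kap_dominated V (fun w => `|h w| `^ 2) ->
  kap_dominated V (fun w => `|h w| `^ 1).
Proof.
move=> H a /H[r [C [D [hr hD]]]]; exists r, C, (D + 1); split => // w wb wV.
have := hD w wb wV; rewrite powRr1// -[2]/(2%:R) powR_mulrn// => H2.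
have : 0 <= (`|h w| - 1) ^+ 2 by exact: sqr_ge0.
rewrite sqrrB1 -mulr_natl; have := normr_ge0 (h w); lra.
Qed.

Lemma continuous_compact_bounded K h : compact K -> continuous h ->
  exists M, forall w, K w -> `|h w| <= M.
Proof.
move=> cK ch; apply: (@compact_ind _ (fun A => exists M, forall w, A w -> `|h w| <= M)) cK.
- by exists 0.
- by move=> A B AB [M HM]; exists M => w /AB/HM.
- move=> A B [M HM] [M' HM']; exists (Num.max M M') => w [/HM|/HM']; rewrite le_max => ->//.
  by rewrite orbT.
move=> z _; exists [set w | `|h z - h w| < 1].
  by move/cvgrPdist_lt : (ch z) => /(_ 1 ltr01).
exists (1 + `|h z|) => w /= hw.
rewrite -(subrK (h z) (h w)) (le_trans (ler_normD _ _))// lerD2r distrC; exact: ltW.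
Qed.

End local_integrability.

(** * Supports of test functions and of their derivatives *)

Section test_functions.
Variable R : realType.
Implicit Types (z w a : R[i]) (phi h : R[i] -> R) (A B K V : set R[i]).

Definition supp phi := closure [set z | phi z != 0].

Lemma supp0 phi z : ~ supp phi z -> phi z = 0.
Proof. by move=> nz; apply/eqP/negPn/negP => h; apply: nz; exact: subset_closure. Qed.

Lemma supp0_near phi z : ~ supp phi z -> \forall w \near z, phi w = 0.
Proof.
move=> nz; have oC : open (~` supp phi) by apply: closed_openC; exact: closed_closure.
by apply: filterS (open_nbhs_nbhs (conj oC nz)) => w; exact: supp0.
Qed.

Lemma dx_pdx phi z d : pdx phi z d -> dx phi z = d.
Proof. by move=> [_ <-]; rewrite /dx derive1E. Qed.

Lemma dy_pdy phi z d : pdy phi z d -> dy phi z = d.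
Proof. by move=> [_ <-]; rewrite /dy derive1E. Qed.

Lemma pdx_near h h' z d : (\forall w \near z, h w = h' w) -> pdx h z d -> pdx h' z d.
Proof.
move=> E; apply: is_derive_near.
have /ccontP c : ccont (fun t => t +i* complex.Im z) (complex.Re z) := cder_ccont (cder_hline z).
have E' : nbhs (complex.Re z +i* complex.Im z) [set w | h w = h' w].
  by have -> : complex.Re z +i* complex.Im z = z by case: (z).
exact: (c _ E').
Qed.

Lemma pdy_near h h' z d : (\forall w \near z, h w = h' w) -> pdy h z d -> pdy h' z d.
Proof.
move=> E; apply: is_derive_near.
have /ccontP c : ccont (fun t => complex.Re z +i* t) (complex.Im z) := cder_ccont (cder_vline z).
have E' : nbhs (complex.Re z +i* complex.Im z) [set w | h w = h' w].
  by have -> : complex.Re z +i* complex.Im z = z by case: (z).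
exact: (c _ E').
Qed.

Lemma pdx0 z : pdx (fun=> 0) z 0. Proof. exact: is_derive_cst. Qed.
Lemma pdy0 z : pdy (fun=> 0) z 0. Proof. exact: is_derive_cst. Qed.

Section facts.
Variables (V : set R[i]) (phi : R[i] -> R).
Hypothesis tphi : test_function V phi.

Lemma test_compact : compact (supp phi). Proof. by case: tphi. Qed.
Lemma test_sub : supp phi `<=` V. Proof. by case: tphi. Qed.
Lemma test_continuous : continuous phi. Proof. by case: tphi => /(_ 0%N)[]. Qed.
Lemma test_pdx z : pdx phi z (dx phi z).
Proof. by case: tphi => /(_ 1%N)[_ [/(_ z)[h _] _ _]] _ _; rewrite /pdx /dx derive1E; exact: derivableP. Qed.
Lemma test_pdy z : pdy phi z (dy phi z).
Proof. by case: tphi => /(_ 1%N)[_ [/(_ z)[_ h] _ _]] _ _; rewrite /pdy /dy derive1E; exact: derivableP. Qed.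

Lemma test_dx_supp z : ~ supp phi z -> dx phi z = 0.
Proof.
move=> /supp0_near nz; apply: dx_pdx; apply: pdx_near (pdx0 z).
by apply: filterS nz => w ->.
Qed.
Lemma test_dy_supp z : ~ supp phi z -> dy phi z = 0.
Proof.
move=> /supp0_near nz; apply: dy_pdy; apply: pdy_near (pdy0 z).
by apply: filterS nz => w ->.
Qed.

Let test_sub_supp psi : smooth psi -> (forall z, ~ supp phi z -> psi z = 0) -> test_function V psi.
Proof.
move=> spsi psi0; have sub : supp psi `<=` supp phi.
  rewrite [supp phi](closure_id (supp phi)).1; last exact: closed_closure.
  apply: closure_subset => z /= pz; apply: contrapT => nz.
  by move: pz; rewrite psi0// eqxx.
split => //; last by move=> z /sub; exact: test_sub.
apply: subclosed_compact test_compact sub; exact: closed_closure.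
Qed.

Lemma test_dx : test_function V (dx phi).
Proof. by apply: test_sub_supp test_dx_supp => k; case: tphi => /(_ k.+1)[_ []]. Qed.
Lemma test_dy : test_function V (dy phi).
Proof. by apply: test_sub_supp test_dy_supp => k; case: tphi => /(_ k.+1)[_ []]. Qed.

End facts.
End test_functions.

(** * Integration by parts off isolated points *)

Section integration_by_parts.
Variable R : realType.
Implicit Types (z w a : R[i]) (phi psi h hx : R[i] -> R) (A B K V Z : set R[i]).
Notation mu := (@lebesgue_measure R).

(** Fubini is applied on the whole plane, whereas integrability and continuity are known on [V]
    only; extending the products by zero off the support bridges the two. *)
Definition cut K h z : R := if `[< K z >] then h z else 0.

Lemma cut_in K h z : K z -> cut K h z = h z.
Proof. by move=> Kz; rewrite /cut; case: asboolP. Qed.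

Lemma cut_out K h z : ~ K z -> cut K h z = 0.
Proof. by move=> Kz; rewrite /cut; case: asboolP. Qed.

Lemma cut_patch K h : (fun q : plane R => (cut K h (to_C q))%:E) = (fun q => (h (to_C q))%:E) \_ (planeset K).
Proof.
apply/funext => q; rewrite patchE; case: ifPn; rewrite ?inE ?notin_setE => qK.
  by rewrite cut_in.
by rewrite cut_out.
Qed.

Lemma intC_cut V K h : K `<=` V -> (forall z, V z -> ~ K z -> h z = 0) ->
  intC V h = (\int[dA R]_q (cut K h (to_C q))%:E)%E.
Proof.
move=> KV hK; rewrite /intC integral_mkcond; apply: eq_integral => q _; rewrite patchE.
have [Kq|nKq] := pselect (K (to_C q)); first by rewrite cut_in// mem_set//; exact: KV.
by rewrite cut_out//; case: ifPn => //; rewrite inE => Vq; rewrite hK.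
Qed.

Lemma integrable_cut V K h psi : open V -> compact K -> K `<=` V -> Lp_loc 1%E V h -> continuous psi ->
  (dA R).-integrable setT (fun q => (cut K (fun z => h z * psi z) (to_C q))%:E).
Proof.
move=> oV cK KV hh cpsi; rewrite cut_patch; have mK := measurable_compact cK.
apply/(integrable_mkcond _ mK).
have := @integrableMl _ _ _ (dA R) _ mK _ (psi \o @to_C R) (Lp_loc1_integrable oV hh cK KV).
apply.
  by apply: measurable_funS (measurable_continuous openT (fun z _ => cpsi z)); first exact: (measurable_open openT).
have [M HM] := continuous_compact_bounded cK cpsi.
by exists M; split; [exact: num_real|move=> x Mx q Kq; apply: le_trans (HM _ Kq) _; exact: ltW].
Qed.

Lemma integral_compact_derivative (H H' : R -> R) (M : R) : (forall t : R, is_derive t 1 H (H' t)) ->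
  continuous H' -> (forall t, M <= `|t| -> H t = 0 /\ H' t = 0) ->
  (\int[mu]_t (H' t)%:E = 0)%E.
Proof.
move=> dH cH' HM; pose N : R := `|M| + 1.
have N0 : 0 < N by rewrite ltr_wpDl.
have MN (t : R) : N <= `|t| -> M <= `|t|.
  by apply: le_trans; rewrite /N; have := ler_norm M; lra.
have -> : (\int[mu]_t (H' t)%:E = \int[mu]_(t in `[(- N)%R, N]) (H' t)%:E)%E.
  rewrite [RHS]integral_mkcond; apply: eq_integral => t _; rewrite patchE.
  case: ifPn => //; rewrite notin_setE /= in_itv /= => nt.
  have Mt : M <= `|t|.
    apply: MN; rewrite leNgt ltr_norml; apply/negP => /andP[? ?].
    by apply: nt; apply/andP; split; exact: ltW.
  by have [_ ->] := HM t Mt.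
rewrite (@ereal_integral_derivative _ (- N) N H' H).
- have NN : N <= `|N| by exact: ler_norm.
  have [-> _] := HM N (MN _ NN); rewrite -normrN in NN.
  by have [-> _] := HM (- N) (MN _ NN); rewrite subrr.
- lra.
- by move=> t _; exact: cH'.
Qed.

Lemma compact_bounded_coord K : compact K -> exists M, forall z, K z ->
  `|complex.Re z| < M /\ `|complex.Im z| < M.
Proof.
move=> cK; have [M HM] := continuous_compact_bounded cK (@continuous_Re R).
have [N HN] := continuous_compact_bounded cK (@continuous_Im R).
exists (Num.max M N + 1) => z Kz; split.
  by apply: le_lt_trans (HM _ Kz) _; rewrite ltr_pwDr// le_max lexx.
by apply: le_lt_trans (HN _ Kz) _; rewrite ltr_pwDr// le_max lexx orbT.
Qed.

(** The condition is imposed at all points of [V], not just at those of [Z]: thus [Z] has no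
    accumulation point in [V] and meets every compact subset in a finite set. *)
Definition isolated_in V Z := forall a, V a -> exists2 r, 0 < r & forall w, box a r w -> Z w -> w = a.

(** [c] will be a coordinate, and [S] the exceptional lines to be discarded in Fubini's theorem. *)
Lemma isolated_lines V Z K (c : R[i] -> R) : isolated_in V Z -> compact K -> K `<=` V ->
  exists S : set R, mu.-negligible S /\ forall z, K z -> Z z -> S (c z).
Proof.
move=> iZ cK KV.
suff [S [fS HS]] : exists S : set R, finite_set S /\ forall z, K z -> Z z -> S (c z).
  exists S; split => //; have cS := finite_set_countable fS.
  by exists S; split; [exact: countable_measurable|exact: countable_lebesgue_measure0|].
apply: (@compact_ind _ (fun A => exists S : set R, finite_set S /\ forall z, A z -> Z z -> S (c z))) cK.
- by exists set0.
- by move=> A B AB [S [fS HS]]; exists S; split => // z /AB; exact: HS.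
- move=> A B [S [fS HS]] [S' [fS' HS']]; exists (S `|` S'); split; first by rewrite finite_setU.
  by move=> z [Az|Bz] Zz; [left; exact: HS|right; exact: HS'].
move=> a /KV /iZ[r r0 hr]; exists (box a r).
  by apply: open_nbhs_nbhs; split; [exact: box_open|exact: box_center].
by exists [set c a]; split; [exact: finite_set1|move=> z zb Zz /=; rewrite (hr z)].
Qed.

Section ibp.
Variables (V Z : set R[i]) (h h' phi : R[i] -> R).
Hypothesis oV : open V.
Hypothesis iZ : isolated_in V Z.
Hypothesis ch : forall z, V z -> ~ Z z -> {for z, continuous h}.
Hypothesis ch' : forall z, V z -> ~ Z z -> {for z, continuous h'}.
Hypothesis Lh : Lp_loc 1%E V h.
Hypothesis Lh' : Lp_loc 1%E V h'.
Hypothesis tphi : test_function V phi.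

Let K := supp phi.
Let cK : compact K := test_compact tphi.
Let KV : K `<=` V := @test_sub _ _ _ tphi.

Let continuous_product (g psi : R[i] -> R) z : ~ (K z /\ Z z) ->
  (forall z, V z -> ~ Z z -> {for z, continuous g}) -> continuous psi ->
  (forall z, ~ K z -> psi z = 0) -> {for z, continuous (cut K (fun w => g w * psi w))}.
Proof.
move=> nKZ cg cpsi psi0.
have E : cut K (fun w => g w * psi w) = fun w => g w * psi w.
  apply/funext => w; have [Kw|nKw] := pselect (K w); first by rewrite cut_in.
  by rewrite (cut_out _ nKw) (psi0 _ nKw) mulr0.
have [Kz|nKz] := pselect (K z).
  rewrite E; apply: continuousM; last exact: cpsi.
  by apply: cg; [exact: KV|move=> Zz; apply: nKZ].
have N : \forall w \near z, 0 = cut K (fun w => g w * psi w) w.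
  have oC : open (~` K) by apply: closed_openC; exact: closed_closure.
  by apply: filterS (open_nbhs_nbhs (conj oC nKz)) => w nKw; rewrite (cut_out _ nKw).
rewrite /prop_for /continuous_at cut_out//.
exact: (cvg_trans (near_eq_cvg N) (cvg_cst _)).
Qed.

Let hline y : continuous (fun t => t +i* y : R[i]).
Proof. by move=> t; apply/continuous_ReP; split => /=; [exact: cvg_id|exact: cvg_cst]. Qed.

Let vline x : continuous (fun t => x +i* t : R[i]).
Proof. by move=> t; apply/continuous_ReP; split => /=; [exact: cvg_cst|exact: cvg_id]. Qed.

(** Reduces both integrations by parts to the vanishing of the integral of one function, the
    derivative of [h * phi]; integrability makes the subtraction in the extended reals
    legitimate. *)
Let ibp_core (psi : R[i] -> R) : continuous psi -> (forall z, ~ K z -> psi z = 0) ->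
  (\int[dA R]_q ((cut K (fun z => h z * psi z)%R (to_C q))%:E + (cut K (fun z => h' z * phi z)%R (to_C q))%:E) = 0)%E ->
  intC V (fun z => h z * psi z) = (- intC V (fun z => (h' z * phi z)%R))%E.
Proof.
move=> cpsi psi0 I0.
have cphi := test_continuous tphi.
have i1 := integrable_cut oV cK KV Lh cpsi; have i2 := integrable_cut oV cK KV Lh' cphi.
rewrite !(@intC_cut V K)//; last 2 first.
- by move=> z _ /supp0 ->; rewrite mulr0.
- by move=> z _ /psi0 ->; rewrite mulr0.
have f2 := integrable_fin_num measurableT i2.
move: I0; rewrite (integralD measurableT i1 i2) => I0.
by rewrite -[LHS](addeK _ f2) I0 add0e.
Qed.

(* Fubini: all but finitely many of the lines meeting the support of [phi] avoid [Z]. *)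
Lemma ibp_x : (forall z, V z -> ~ Z z -> pdx h z (h' z)) ->
  intC V (fun z => h z * dx phi z) = (- intC V (fun z => (h' z * phi z)%R))%E.
Proof.
move=> dh.
have cdx := test_continuous (test_dx tphi); have cphi := test_continuous tphi.
have i1 := integrable_cut oV cK KV Lh cdx; have i2 := integrable_cut oV cK KV Lh' cphi.
apply: ibp_core => //; first by move=> z; exact: test_dx_supp.
have iF := integrableD measurableT i1 i2.
rewrite -[LHS](integral21_prod_meas1 iF).
have [S [nS HS]] := isolated_lines (@complex.Im R) iZ cK KV.
have [M HM] := compact_bounded_coord cK.
rewrite (ae_eq_integral (cst 0%E))//; last 2 first.
- exact: (measurable_fubini_G iF).
- apply: negligibleS nS => y /= ny; apply: contrapT => Sy; apply: ny => _.
  have good z : complex.Im z = y -> ~ (K z /\ Z z).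
    by move=> zy [Kz Zz]; apply: Sy; rewrite -zy; exact: HS.
  rewrite /fubini_G /=; under eq_integral do rewrite -EFinD.
  apply: (@integral_compact_derivative (fun t => cut K (fun z => h z * phi z) (t +i* y))
    (fun t => cut K (fun z => h z * dx phi z) (t +i* y) + cut K (fun z => h' z * phi z) (t +i* y)) M).
  + move=> t; set z := t +i* y.
    have [Kz|nKz] := pselect (K z); last first.
      rewrite [X in is_derive _ _ _ X](_ : _ = 0); last by rewrite /to_C /= !cut_out// addr0.
      have N : \forall w \near z, 0 = cut K (fun w => h w * phi w) w.
        have oC : open (~` K) by apply: closed_openC; exact: closed_closure.
        by apply: filterS (open_nbhs_nbhs (conj oC nKz)) => w nKw; rewrite (cut_out _ nKw).
      exact: (pdx_near N (pdx0 z)).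
    have E : cut K (fun w => h w * phi w) = fun w => h w * phi w.
      apply/funext => w; have [Kw|nKw] := pselect (K w); first by rewrite cut_in.
      by rewrite (cut_out _ nKw) (supp0 nKw) mulr0.
    rewrite E [X in is_derive _ _ _ X](_ : _ = h z * dx phi z + phi z * h' z); last first.
      by rewrite /to_C /= !cut_in// [phi z * _]mulrC.
    have nZ : ~ Z z by move=> Zz; exact: (good z).
    exact: (is_deriveM (dh z (KV Kz) nZ) (test_pdx tphi z)).
  + move=> t; have gt : ~ (K (t +i* y) /\ Z (t +i* y)) by exact: good.
    have c1 := continuous_product gt ch cdx (@test_dx_supp _ phi).
    have c2 := continuous_product gt ch' cphi (@supp0 _ phi).
    exact: (continuousD (continuous_comp (@hline y t) c1) (continuous_comp (@hline y t) c2)).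
  + move=> t tM; have nK : ~ K (t +i* y) by move=> /HM[/=]; rewrite ltNge tM.
    by rewrite /to_C /= !cut_out// addr0.
exact: integral0.
Qed.

Lemma ibp_y : (forall z, V z -> ~ Z z -> pdy h z (h' z)) ->
  intC V (fun z => h z * dy phi z) = (- intC V (fun z => (h' z * phi z)%R))%E.
Proof.
move=> dh.
have cdy := test_continuous (test_dy tphi); have cphi := test_continuous tphi.
have i1 := integrable_cut oV cK KV Lh cdy; have i2 := integrable_cut oV cK KV Lh' cphi.
apply: ibp_core => //; first by move=> z; exact: test_dy_supp.
have iF := integrableD measurableT i1 i2.
rewrite -[LHS](integral12_prod_meas1 iF).
have [S [nS HS]] := isolated_lines (@complex.Re R) iZ cK KV.
have [M HM] := compact_bounded_coord cK.
rewrite (ae_eq_integral (cst 0%E))//; last 2 first.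
- exact: (measurable_fubini_F iF).
- apply: negligibleS nS => x /= ny; apply: contrapT => Sy; apply: ny => _.
  have good z : complex.Re z = x -> ~ (K z /\ Z z).
    by move=> zy [Kz Zz]; apply: Sy; rewrite -zy; exact: HS.
  rewrite /fubini_F /=; under eq_integral do rewrite -EFinD.
  apply: (@integral_compact_derivative (fun t => cut K (fun z => h z * phi z) (x +i* t))
    (fun t => cut K (fun z => h z * dy phi z) (x +i* t) + cut K (fun z => h' z * phi z) (x +i* t)) M).
  + move=> t; set z := x +i* t.
    have [Kz|nKz] := pselect (K z); last first.
      rewrite [X in is_derive _ _ _ X](_ : _ = 0); last by rewrite /to_C /= !cut_out// addr0.
      have N : \forall w \near z, 0 = cut K (fun w => h w * phi w) w.
        have oC : open (~` K) by apply: closed_openC; exact: closed_closure.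
        by apply: filterS (open_nbhs_nbhs (conj oC nKz)) => w nKw; rewrite (cut_out _ nKw).
      exact: (pdy_near N (pdy0 z)).
    have E : cut K (fun w => h w * phi w) = fun w => h w * phi w.
      apply/funext => w; have [Kw|nKw] := pselect (K w); first by rewrite cut_in.
      by rewrite (cut_out _ nKw) (supp0 nKw) mulr0.
    rewrite E [X in is_derive _ _ _ X](_ : _ = h z * dy phi z + phi z * h' z); last first.
      by rewrite /to_C /= !cut_in// [phi z * _]mulrC.
    have nZ : ~ Z z by move=> Zz; exact: (good z).
    exact: (is_deriveM (dh z (KV Kz) nZ) (test_pdy tphi z)).
  + move=> t; have gt : ~ (K (x +i* t) /\ Z (x +i* t)) by exact: good.
    have c1 := continuous_product gt ch cdy (@test_dy_supp _ phi).
    have c2 := continuous_product gt ch' cphi (@supp0 _ phi).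
    exact: (continuousD (continuous_comp (@vline x t) c1) (continuous_comp (@vline x t) c2)).
  + move=> t tM; have nK : ~ K (x +i* t) by move=> /HM[_ /=]; rewrite ltNge tM.
    by rewrite /to_C /= !cut_out// addr0.
exact: integral0.
Qed.

End ibp.
End integration_by_parts.

(** * Bump functions *)

Section bump.
Variable R : realType.
Implicit Types (z w c : R[i]) (f g h : R[i] -> R) (k n : nat).

Lemma pdx_has (h d d' : R[i] -> R) : (forall z, pdx h z (d z)) -> (forall z, pdy h z (d' z)) ->
  [/\ has_partials h, dx h = d & dy h = d'].
Proof.
move=> hd hd'; split; last 2 first.
- by apply/funext => z; exact: dx_pdx.
- by apply/funext => z; exact: dy_pdy.
by move=> z; split; [have [] := hd z|have [] := hd' z].
Qed.

Lemma has_pdx h : has_partials h -> (forall z, pdx h z (dx h z)) /\ (forall z, pdy h z (dy h z)).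
Proof.
move=> H; split=> z; have [h1 h2] := H z; rewrite /pdx /pdy /dx /dy derive1E.
  exact: (derivableP h1).
exact: (derivableP h2).
Qed.

Lemma C_k_pred k h : C_k k.+1 h -> C_k k h.
Proof.
elim: k h => [|k IH] h; first by move=> [].
by move=> [ch [hp /IH Cx /IH Cy]].
Qed.

Lemma C_k_cst k (c : R) : C_k k (fun=> c : R).
Proof.
elim: k c => [|k IH] c; first by split => // z; exact: cst_continuous.
have [h1 h2 h3] := @pdx_has (fun=> c) (fun=> 0) (fun=> 0) (fun z => is_derive_cst _ _ _) (fun z => is_derive_cst _ _ _).
by split; [move=> z; exact: cst_continuous|rewrite h2 h3].
Qed.

Lemma C_k_add k f g : C_k k f -> C_k k g -> C_k k (fun z => f z + g z).
Proof.
elim: k f g => [|k IH] f g [cf Hf] [cg Hg].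
  by split => // z; exact: (continuousD (cf z) (cg z)).
case: Hf => /has_pdx[fx fy] Cfx Cfy; case: Hg => /has_pdx[gx gy] Cgx Cgy.
have [h1 h2 h3] := @pdx_has (fun z => f z + g z) _ _
  (fun z => is_deriveD (fx z) (gx z)) (fun z => is_deriveD (fy z) (gy z)).
split; first by move=> z; exact: (continuousD (cf z) (cg z)).
by split; rewrite ?h2 ?h3//; exact: IH.
Qed.

Lemma C_k_mul k f g : C_k k f -> C_k k g -> C_k k (fun z => f z * g z).
Proof.
elim: k f g => [|k IH] f g Hf Hg.
  by case: Hf Hg => cf _ [cg _]; split => // z; exact: (continuousM (cf z) (cg z)).
have Cf := C_k_pred Hf; have Cg := C_k_pred Hg.
case: Hf => cf [/has_pdx[fx fy] Cfx Cfy]; case: Hg => cg [/has_pdx[gx gy] Cgx Cgy].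
have ez z : complex.Re z +i* complex.Im z = z by case: z.
have px z : pdx (fun z => f z * g z) z (f z * dx g z + g z * dx f z).
  by have := is_deriveM (fx z) (gx z); rewrite !ez.
have py z : pdy (fun z => f z * g z) z (f z * dy g z + g z * dy f z).
  by have := is_deriveM (fy z) (gy z); rewrite !ez.
have [h1 h2 h3] := pdx_has px py.
split; first by move=> z; exact: (continuousM (cf z) (cg z)).
by split; rewrite ?h2 ?h3//; apply: C_k_add; exact: IH.
Qed.

(** The flat function exp(-1/t), multiplied by t^-n so that the family is closed under
    differentiation up to linear combinations; smoothness then follows by induction on the order. *)
Definition flat n (t : R) : R := if 0 < t then t^-1 ^+ n * expR (- t^-1) else 0.

(** From [x ^ (n + 2) / (n + 2)! <= exp x] at [x = t^-1]. The two extra powers leave [t ^ 2], which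
    yields the derivative 0 at the origin. *)
Lemma flat_le n (t : R) : `|flat n t| <= n.+2`!%:R * `|t| ^+ 2.
Proof.
rewrite /flat; case: ltP => t0; last by rewrite normr0 mulr_ge0// exprn_ge0.
have x0 : 0 < t^-1 by rewrite invr_gt0.
have H : t^-1 ^+ n.+2 / n.+2`!%:R <= expR t^-1.
  by apply: le_trans (expR_ge1Dxn n.+1 (ltW x0)); rewrite lerDr.
rewrite ger0_norm; last by rewrite mulr_ge0 ?exprn_ge0 ?expR_ge0// ltW.
rewrite (ger0_norm (ltW t0)) expRN ler_pdivrMr ?expR_gt0//.
apply: (@le_trans _ _ (n.+2`!%:R * t ^+ 2 * (t^-1 ^+ n.+2 / n.+2`!%:R))); last first.
  by apply: ler_wpM2l => //; rewrite mulr_ge0 ?exprn_ge0// ltW.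
rewrite le_eqVlt; apply/orP; left; apply/eqP; rewrite -addn2 exprD; field.
by rewrite !gt_eqF.
Qed.

Lemma is_derive_flat n (t : R) : is_derive t 1 (flat n) (flat n.+2 t - n%:R * flat n.+1 t).
Proof.
have [t0|t0|->] := ltgtP t 0.
- have -> : flat n.+2 t - n%:R * flat n.+1 t = 0.
    by rewrite /flat ltNge (ltW t0) /= mulr0 subr0.
  apply: (@is_derive_near _ (fun=> 0)).
  near=> s; rewrite /flat ifF//; apply/negbTE; rewrite -leNgt ltW//.
  near: s; exact: lt_nbhsl.
- have dV : is_derive t 1 (fun s => s^-1) (- t ^- 2).
    by have := is_deriveV (lt0r_neq0 t0) (is_derive_id t 1); rewrite /GRing.scale/= mulr1.
  have dX : is_derive t 1 (fun s => s^-1 ^+ n) (- n%:R * t^-1 ^+ n.+1).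
    elim: n => [|n IH]; first by rewrite oppr0 mul0r; exact: is_derive_cst.
    have := is_deriveM dV IH.
    rewrite (_ : (fun s => s^-1) * _ = (fun s => s^-1 ^+ n.+1)); last first.
      by apply/funext => s; rewrite exprS.
    congr (is_derive _ _ _ _); rewrite /GRing.scale/= !exprS -[n.+1%:R]natr1.
    by field; rewrite gt_eqF.
  have dE : is_derive t 1 (fun s => expR (- s^-1)) (expR (- t^-1) * (t^-1 ^+ 2)).
    have := @is_derive1_comp R (@expR R) (fun s => - s^-1) t _ _ (is_derive_expR (- t^-1)) (is_deriveN dV).
    by rewrite /GRing.scale/= opprK exprVn mulrC.
  have := is_deriveM dX dE.
  rewrite [X in is_derive _ _ _ X](_ : _ = flat n.+2 t - n%:R * flat n.+1 t); last first.
    by rewrite /flat t0 /GRing.scale/= !exprS; ring.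
  apply: is_derive_near; near=> s; rewrite /flat ifT//.
  near: s; exact: lt_nbhsr.
- rewrite [X in is_derive _ _ _ X](_ : _ = 0); last by rewrite /flat ltxx mulr0 subr0.
  apply/is_deriveP => e e0.
  pose M : R := n.+2`!%:R; have M0 : 0 < M by rewrite ltr0n fact_gt0.
  exists (e / M); first by rewrite divr_gt0.
  move=> s; rewrite subr0 mul0r subr0 => se.
  have -> : flat n 0 = 0 by rewrite /flat ltxx.
  rewrite subr0; apply: le_trans (flat_le n s) _; rewrite expr2 mulrA.
  by apply: ler_wpM2r => //; rewrite -ler_pdivlMl// mulrC ltW.
Unshelve. all: by end_near. Qed.

Lemma C_k_flat_Re k n (a b : R) : C_k k (fun z => flat n (a * complex.Re z + b)).
Proof.
have cf m : continuous (fun z => flat m (a * complex.Re z + b)).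
  move=> z; apply: (continuous_comp (f := fun z => a * complex.Re z + b)); last first.
    exact: is_derive_continuous (is_derive_flat m _).
  apply: continuousD; last exact: cst_continuous.
  by apply: continuousM; [exact: cst_continuous|exact: continuous_Re].
elim: k n => [|k IH] n; first by split.
have px z : pdx (fun z => flat n (a * complex.Re z + b)) z
   (a * (flat n.+2 (a * complex.Re z + b) + - n%:R * flat n.+1 (a * complex.Re z + b))).
  have d1 : is_derive (complex.Re z) 1 (fun t => a * t + b) a.
    by apply: is_derive_eq; rewrite /GRing.scale/= mulr1 addr0.
  have := @is_derive1_comp R (flat n) (fun t => a * t + b) _ _ _ (is_derive_flat n _) d1.
  by rewrite [_ * a]mulrC mulNr; exact.
have py z : pdy (fun z => flat n (a * complex.Re z + b)) z 0 by rewrite /pdx /pdy /=; exact: is_derive_cst.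
have [h1 h2 h3] := pdx_has px py.
split; first exact: cf.
split; rewrite ?h2 ?h3//; last exact: C_k_cst.
apply: C_k_mul; first exact: C_k_cst.
by apply: C_k_add => //; apply: C_k_mul => //; exact: C_k_cst.
Qed.

Lemma C_k_flat_Im k n (a b : R) : C_k k (fun z => flat n (a * complex.Im z + b)).
Proof.
have cf m : continuous (fun z => flat m (a * complex.Im z + b)).
  move=> z; apply: (continuous_comp (f := fun z => a * complex.Im z + b)); last first.
    exact: is_derive_continuous (is_derive_flat m _).
  apply: continuousD; last exact: cst_continuous.
  by apply: continuousM; [exact: cst_continuous|exact: continuous_Im].
elim: k n => [|k IH] n; first by split.
have py z : pdy (fun z => flat n (a * complex.Im z + b)) z
   (a * (flat n.+2 (a * complex.Im z + b) + - n%:R * flat n.+1 (a * complex.Im z + b))).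
  have d1 : is_derive (complex.Im z) 1 (fun t => a * t + b) a.
    by apply: is_derive_eq; rewrite /GRing.scale/= mulr1 addr0.
  have := @is_derive1_comp R (flat n) (fun t => a * t + b) _ _ _ (is_derive_flat n _) d1.
  by rewrite [_ * a]mulrC mulNr; exact.
have px z : pdx (fun z => flat n (a * complex.Im z + b)) z 0 by rewrite /pdx /pdy /=; exact: is_derive_cst.
have [h1 h2 h3] := pdx_has px py.
split; first exact: cf.
split; rewrite ?h2 ?h3//; first exact: C_k_cst.
apply: C_k_mul; first exact: C_k_cst.
by apply: C_k_add => //; apply: C_k_mul => //; exact: C_k_cst.
Qed.

Definition cbox c (r : R) := [set w : R[i] | `|complex.Re w - complex.Re c| <= r /\ `|complex.Im w - complex.Im c| <= r].

Lemma compact_cbox c r : compact (cbox c r).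
Proof.
have -> : cbox c r = (fun q : R * R => q.1 +i* q.2) @`
   (`[complex.Re c - r, complex.Re c + r]%classic `*` `[complex.Im c - r, complex.Im c + r]%classic).
  apply/seteqP; split=> [[x y] [/= h1 h2]|_ [[x y] [/= h1 h2] <-]].
    by exists (x, y) => //; split; rewrite /= in_itv/= -ler_distl.
  by split; rewrite /= ler_distl; [move: h1|move: h2]; rewrite in_itv.
apply: continuous_compact; last by apply: compact_setX; exact: segment_compact.
apply: continuous_subspaceT => q; apply/continuous_ReP; split => /=; [exact: cvg_fst|exact: cvg_snd].
Qed.

Lemma flat0_bounds (t : R) : 0 <= flat 0 t <= 1.
Proof.
rewrite /flat expr0 mul1r; case: ltP => t0; last by rewrite lexx ler01.
by rewrite expR_ge0 -[leRHS]expR0 ler_expR lerNl oppr0 invr_ge0 ltW.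
Qed.

Lemma flat0_ge (t : R) : 2^-1 <= t -> expR (- 2) <= flat 0 t.
Proof.
move=> t2; have t0 : 0 < t by apply: lt_le_trans t2.
rewrite /flat t0 expr0 mul1r ler_expR lerN2 -[leRHS]invrK lef_pV2 ?posrE//.
Qed.

(** One factor [flat 0] for each side of the box. On the half-size box every argument is at least
    1/2, so each factor is at least exp(-2); this lower bound does not depend on [r], as the
    comparison of different scales requires. *)
Lemma smooth_bump c r : 0 < r -> exists phi : R[i] -> R,
  [/\ forall V, cbox c r `<=` V -> test_function V phi,
      forall z, 0 <= phi z <= 1, forall z, ~ box c r z -> phi z = 0 &
      forall z, box c (r / 2) z -> expR (- 2) ^+ 4 <= phi z].
Proof.
move=> r0.
pose X1 z := flat 0 (r^-1 * complex.Re z + (1 - complex.Re c / r)).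
pose X2 z := flat 0 (- r^-1 * complex.Re z + (1 + complex.Re c / r)).
pose Y1 z := flat 0 (r^-1 * complex.Im z + (1 - complex.Im c / r)).
pose Y2 z := flat 0 (- r^-1 * complex.Im z + (1 + complex.Im c / r)).
pose phi z := (X1 z * X2 z) * (Y1 z * Y2 z).
have rn : r != 0 by rewrite gt_eqF.
have A1 (x y : R) : r^-1 * x + (1 - y / r) = (x - y + r) / r by field.
have A2 (x y : R) : - r^-1 * x + (1 + y / r) = (r - (x - y)) / r by field.
have phi0 z : ~ box c r z -> phi z = 0.
  move=> nb; apply: contrapT => /eqP; rewrite !mulf_eq0 !negb_or => /andP[/andP[x1 x2] /andP[y1 y2]].
  have pos (t : R) : flat 0 t != 0 -> 0 < t by rewrite /flat; case: ltP => //; rewrite eqxx.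
  move: (pos _ x1) (pos _ x2) (pos _ y1) (pos _ y2); rewrite !A1 !A2 !pmulr_lgt0 ?invr_gt0//.
  by move=> ? ? ? ?; apply: nb; split; rewrite ltr_norml; apply/andP; split; lra.
have phib z : 0 <= phi z <= 1.
  have /andP[a1 a2] := flat0_bounds (r^-1 * complex.Re z + (1 - complex.Re c / r)).
  have /andP[b1 b2] := flat0_bounds (- r^-1 * complex.Re z + (1 + complex.Re c / r)).
  have /andP[c1 c2] := flat0_bounds (r^-1 * complex.Im z + (1 - complex.Im c / r)).
  have /andP[d1 d2] := flat0_bounds (- r^-1 * complex.Im z + (1 + complex.Im c / r)).
  rewrite /phi /X1 /X2 /Y1 /Y2; apply/andP; split; first by rewrite !mulr_ge0.
  by apply: mulr_ile1; rewrite ?mulr_ge0//; exact: mulr_ile1.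
exists phi; split => //.
- move=> V cV.
  have sub : supp phi `<=` cbox c r.
    have cc : closed (cbox c r) by apply: compact_closedC; exact: compact_cbox.
    rewrite [cbox c r](closure_id (cbox c r)).1//.
    apply: closure_subset => z /= pz.
    have [zx zy] : box c r z by apply: contrapT => /phi0 p0; move: pz; rewrite p0 eqxx.
    by split; exact: ltW.
  split.
  + move=> k; apply: C_k_mul; apply: C_k_mul; solve [exact: C_k_flat_Re|exact: C_k_flat_Im].
  + apply: subclosed_compact (@compact_cbox c r) sub; exact: closed_closure.
  + exact: subset_trans sub cV.
- move=> z [zx zy]; rewrite /phi /X1 /X2 /Y1 /Y2 !A1 !A2.
  have q (x : R) : `|x| < r / 2 -> 2^-1 <= (x + r) / r /\ 2^-1 <= (r - x) / r.
    by rewrite ltr_norml => /andP[? ?]; split; rewrite ler_pdivlMr//; lra.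
  have [x1 x2] := q _ zx; have [y1 y2] := q _ zy.
  have -> : expR (- 2) ^+ 4 = (expR (- 2) * expR (- 2)) * (expR (- 2) * expR (- 2)) :> R by ring.
  by apply: ler_pM; rewrite ?mulr_ge0//; apply: ler_pM => //; exact: flat0_ge.
Qed.

End bump.

(** * Derivatives of the iterated logarithm *)

Section loglog.
Variable R : realType.
Implicit Types (z w a : R[i]) (n : nat).

(* All of these vanish at the zeros of [f], where [neglog f] is the junk value [- ln 0 = 0] and division by [0] gives [0]. *)
Definition Lx (f : R[i] -> R[i]) z : R := - 2 * complex.Re (lder f z).
Definition Ly (f : R[i] -> R[i]) z : R := 2 * complex.Im (lder f z).
Definition Lxx (f : R[i] -> R[i]) z : R := - 2 * complex.Re (cD (lder f) z).
Definition ux f z : R := Lx f z / neglog f z.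
Definition uy f z : R := Ly f z / neglog f z.
Definition uxx f z : R := Lxx f z / neglog f z - ux f z ^+ 2.
Definition uyy f z : R := - Lxx f z / neglog f z - uy f z ^+ 2.

(* [damp n f] has values in [[0, 1]], tends to 1 and is a multiple of [(neglog f)^-1] near the zeros of [f]: this makes
   the derivatives of [damp n f * ux f], unlike those of [ux f], locally integrable. *)
Definition damp n (f : R[i] -> R[i]) z : R := n.+1%:R / (n.+1%:R + neglog f z).
Definition vx n f z : R := damp n f z * uxx f z - n.+1%:R / (n.+1%:R + neglog f z) ^+ 2 * (Lx f z * ux f z).
Definition vy n f z : R := damp n f z * uyy f z - n.+1%:R / (n.+1%:R + neglog f z) ^+ 2 * (Ly f z * uy f z).

Variables (Omega : set R[i]) (f : R[i] -> R[i]).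
Hypothesis dO : domain Omega.
Hypothesis hf : holomorphic_on Omega f.
Hypothesis nf : nonconstant_on Omega f.
Hypothesis small : forall z, Omega z -> normc (f z) < 10^-1.

Let oO : open Omega. Proof. by case: dO. Qed.
Let U := Omega `&` [set z | f z != 0].
Let oU : open U. Proof. exact: open_nonzero oO hf. Qed.

Lemma neglog_zero z : f z = 0 -> neglog f z = 0.
Proof. by move=> fz; rewrite /neglog fz normc0 expr0n /= ln0 ?oppr0. Qed.

(** The smallness of [f] enters here: [|f| ^ 2 <= 1 / 100 < 1 / 4 <= exp (-1)], the last step from
    [exp (-1 / 2) >= 1 / 2]. Being at least 1, [L] can be divided by and has a nonnegative
    logarithm. *)
Lemma neglog_ge1 z : Omega z -> f z != 0 -> 1 <= neglog f z.
Proof.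
move=> Oz fz; have n0 : 0 < normc (f z) by rewrite normc_gt0.
have s1 : normc (f z) ^+ 2 <= 10^-1 ^+ 2.
  by apply: lerXn2r; rewrite ?nnegrE ?(ltW n0)// ltW// small.
rewrite /neglog lerNr -[leRHS]expRK ler_ln ?posrE ?expR_gt0 ?exprn_gt0//.
apply: le_trans s1 _.
have : expR 1 * expR (- 1) = 1 :> R by rewrite -expRD subrr expR0.
have e2 : expR (- 1 / 2) >= 1 + - 1 / 2 :> R by exact: expR_ge1Dx.
have -> : expR (- 1) = expR (- 1 / 2) ^+ 2 :> R.
  by rewrite expr2 -expRD; congr expR; field.
have : (1 + - 1 / 2) ^+ 2 <= expR (- 1 / 2) ^+ 2 :> R.
  by apply: lerXn2r => //; rewrite nnegrE ?expR_ge0//; lra.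
lra.
Qed.

Let cL z : U z -> {for z, continuous (neglog f)}.
Proof. by move=> [Oz fz]; exact: continuous_neglog hf Oz fz. Qed.

Let cW z : U z -> ccont (lder f) z /\ ccont (cD (lder f)) z.
Proof. by move=> [Oz fz]; exact: (ccont_lder oO hf Oz fz). Qed.

Let cmul (k : R) (h : R[i] -> R) z : {for z, continuous h} -> {for z, continuous (fun w => k * h w)}.
Proof. by move=> ch; exact: (continuousM (@cst_continuous _ _ k z) ch). Qed.

Lemma continuous_Lx z : U z -> {for z, continuous (Lx f)}.
Proof. by move=> /cW[[h _] _]; exact: cmul h. Qed.
Lemma continuous_Ly z : U z -> {for z, continuous (Ly f)}.
Proof. by move=> /cW[[_ h] _]; exact: cmul h. Qed.
Lemma continuous_Lxx z : U z -> {for z, continuous (Lxx f)}.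
Proof. by move=> /cW[_ [h _]]; exact: cmul h. Qed.

Let L_gt0 z : U z -> 0 < neglog f z.
Proof. by move=> [Oz fz]; apply: lt_le_trans (neglog_ge1 Oz fz). Qed.

Let L_neq0 z : U z -> neglog f z != 0.
Proof. by move=> /L_gt0 h; rewrite gt_eqF. Qed.

Let cLV z : U z -> {for z, continuous (fun w => (neglog f w)^-1)}.
Proof. by move=> Uz; exact: (continuousV (L_neq0 Uz) (cL Uz)). Qed.

Lemma continuous_u z : U z -> {for z, continuous (u_of f)}.
Proof.
move=> Uz; apply: (continuous_comp (f := neglog f) (g := @ln R)); first exact: cL.
by apply: continuous_ln; exact: L_gt0.
Qed.

Lemma continuous_ux z : U z -> {for z, continuous (ux f)}.
Proof. by move=> Uz; exact: (continuousM (continuous_Lx Uz) (cLV Uz)). Qed.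
Lemma continuous_uy z : U z -> {for z, continuous (uy f)}.
Proof. by move=> Uz; exact: (continuousM (continuous_Ly Uz) (cLV Uz)). Qed.

Let csqr (h : R[i] -> R) z : {for z, continuous h} -> {for z, continuous (fun w => h w ^+ 2)}.
Proof. by move=> ch; exact: (continuousM ch ch). Qed.

Lemma continuous_uxx z : U z -> {for z, continuous (uxx f)}.
Proof.
move=> Uz; exact: (continuousB (continuousM (continuous_Lxx Uz) (cLV Uz)) (csqr (continuous_ux Uz))).
Qed.
Lemma continuous_uyy z : U z -> {for z, continuous (uyy f)}.
Proof.
by move=> Uz; exact: (continuousB (continuousM (continuousN (continuous_Lxx Uz)) (cLV Uz)) (csqr (continuous_uy Uz))).
Qed.

Let nL n z : U z -> 0 < n.+1%:R + neglog f z.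
Proof. by move=> /L_gt0 h; rewrite addr_gt0. Qed.

Let cnL n z : U z -> {for z, continuous (fun w => n.+1%:R + neglog f w)}.
Proof. by move=> Uz; exact: (continuousD (@cst_continuous _ R (n.+1%:R : R) z) (cL Uz)). Qed.

Lemma continuous_damp n z : U z -> {for z, continuous (damp n f)}.
Proof.
move=> Uz; apply: cmul; apply: continuousV; last exact: cnL.
by rewrite gt_eqF// nL.
Qed.

Let cdamp2 n z : U z -> {for z, continuous (fun w => n.+1%:R / (n.+1%:R + neglog f w) ^+ 2)}.
Proof.
move=> Uz; apply: cmul; apply: continuousV; last exact/csqr/cnL.
by rewrite gt_eqF// exprn_gt0// nL.
Qed.

Lemma continuous_vx n z : U z -> {for z, continuous (vx n f)}.
Proof.
move=> Uz.
have c1 : {for z, continuous (fun w => damp n f w * uxx f w)}.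
  exact: (continuousM (continuous_damp (n := n) Uz) (continuous_uxx Uz)).
have c2 : {for z, continuous (fun w => Lx f w * ux f w)}.
  exact: (continuousM (continuous_Lx Uz) (continuous_ux Uz)).
have c3 : {for z, continuous (fun w => n.+1%:R / (n.+1%:R + neglog f w) ^+ 2 * (Lx f w * ux f w))}.
  exact: (continuousM (cdamp2 (n := n) Uz) c2).
exact: (continuousB c1 c3).
Qed.
Lemma continuous_vy n z : U z -> {for z, continuous (vy n f)}.
Proof.
move=> Uz.
have c1 : {for z, continuous (fun w => damp n f w * uyy f w)}.
  exact: (continuousM (continuous_damp (n := n) Uz) (continuous_uyy Uz)).
have c2 : {for z, continuous (fun w => Ly f w * uy f w)}.
  exact: (continuousM (continuous_Ly Uz) (continuous_uy Uz)).
have c3 : {for z, continuous (fun w => n.+1%:R / (n.+1%:R + neglog f w) ^+ 2 * (Ly f w * uy f w))}.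
  exact: (continuousM (cdamp2 (n := n) Uz) c2).
exact: (continuousB c1 c3).
Qed.

Let dL z : U z -> pdx (neglog f) z (Lx f z) /\ pdy (neglog f) z (Ly f z).
Proof.
move=> [Oz fz]; exact: neglog_partials fz (holomorphic_cdiff hf Oz).
Qed.

Let line_eta z : complex.Re z +i* complex.Im z = z. Proof. by case: z. Qed.

Let dscale (k : R) (h : R -> R) (t d : R) : is_derive t 1 h d -> is_derive t 1 (fun s => k * h s) (k * d).
Proof. by move=> H; have := is_deriveM (is_derive_cst k t (1 : R)) H; rewrite /GRing.scale/= mulr0 addr0. Qed.

Let dLx z : U z -> pdx (Lx f) z (Lxx f z).
Proof.
move=> [Oz fz]; have [h _ _ _] := cdiff_partials (cdiff_lder oO hf Oz fz).
exact: dscale h.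
Qed.
Let dLy z : U z -> pdy (Ly f) z (- Lxx f z).
Proof.
move=> [Oz fz]; have [_ _ _ h] := cdiff_partials (cdiff_lder oO hf Oz fz).
by have := dscale 2 h; rewrite /Lxx mulNr opprK.
Qed.

Let line_ln (h : R -> R) (t d : R) : 0 < h t -> is_derive t 1 h d ->
  is_derive t 1 (fun s => ln (h s)) (d / h t).
Proof.
move=> h0 dh; have := @is_derive1_comp R (@ln R) h t _ _ (is_derive1_ln h0) dh.
by rewrite mulrC.
Qed.

Let line_quot (h k : R -> R) (t d d' : R) : k t != 0 -> is_derive t 1 h d -> is_derive t 1 k d' ->
  is_derive t 1 (fun s => h s / k s) (d / k t - h t * d' / k t ^+ 2).
Proof.
move=> k0 dh dk; have := is_deriveM dh (is_deriveV k0 dk).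
by congr (is_derive _ _ _ _); rewrite /GRing.scale/=; field.
Qed.

Lemma u_pdx z : U z -> pdx (u_of f) z (ux f z) /\ pdy (u_of f) z (uy f z).
Proof.
move=> Uz; have [hx hy] := dL Uz; have L0 := L_gt0 Uz.
by split; [have := line_ln _ hx|have := line_ln _ hy]; rewrite line_eta; exact.
Qed.

Lemma ux_pdx z : U z -> pdx (ux f) z (uxx f z).
Proof.
move=> Uz; have [hx _] := dL Uz; have L0 := L_neq0 Uz.
have := line_quot _ (dLx Uz) hx; rewrite line_eta => /(_ L0).
by congr (is_derive _ _ _ _); rewrite /uxx /ux; field.
Qed.
Lemma uy_pdy z : U z -> pdy (uy f) z (uyy f z).
Proof.
move=> Uz; have [_ hy] := dL Uz; have L0 := L_neq0 Uz.
have := line_quot _ (dLy Uz) hy; rewrite line_eta => /(_ L0).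
by congr (is_derive _ _ _ _); rewrite /uyy /uy; field.
Qed.

Let line_damp n (h : R -> R) (t d : R) : n.+1%:R + h t != 0 -> is_derive t 1 h d ->
  is_derive t 1 (fun s => n.+1%:R / (n.+1%:R + h s)) (- (n.+1%:R / (n.+1%:R + h t) ^+ 2 * d)).
Proof.
move=> h0 dh; have dk : is_derive t 1 (fun s => n.+1%:R + h s) d.
  by have := is_deriveD (is_derive_cst (n.+1%:R : R) t (1 : R)) dh; rewrite add0r.
have := @line_quot (fun=> n.+1%:R) (fun s => n.+1%:R + h s) t 0 d h0 (is_derive_cst (n.+1%:R : R) t (1 : R)) dk.
by congr (is_derive _ _ _ _); rewrite mul0r sub0r mulrAC.
Qed.

Lemma damp_ux_pdx n z : U z -> pdx (fun w => damp n f w * ux f w) z (vx n f z).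
Proof.
move=> Uz; have [hx _] := dL Uz; have L0 := lt0r_neq0 (nL n Uz).
have := line_damp (n := n) _ hx; rewrite line_eta => /(_ L0) h1.
have := is_deriveM h1 (ux_pdx Uz); rewrite line_eta.
by congr (is_derive _ _ _ _); rewrite /vx /damp /GRing.scale/=; ring.
Qed.
Lemma damp_uy_pdy n z : U z -> pdy (fun w => damp n f w * uy f w) z (vy n f z).
Proof.
move=> Uz; have [_ hx] := dL Uz; have L0 := lt0r_neq0 (nL n Uz).
have := line_damp (n := n) _ hx; rewrite line_eta => /(_ L0) h1.
have := is_deriveM h1 (uy_pdy Uz); rewrite line_eta.
by congr (is_derive _ _ _ _); rewrite /vy /damp /GRing.scale/=; ring.
Qed.

(** [neglog f] is harmonic off the zeros, so the terms [Lxx f / neglog f] of [uxx] and [uyy] cancel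
    and only the squared gradient survives. On the zeros both sides vanish by the default values. *)
Lemma g_ofE z : Omega z -> g_of f z = - (ux f z ^+ 2 + uy f z ^+ 2).
Proof.
move=> Oz; rewrite /g_of; case: eqP => [fz|/eqP fz].
  by rewrite /ux /uy neglog_zero// invr0 !mulr0 expr0n addr0 oppr0.
have Uz : U z by split.
have Ex : \forall w \near z, ux f w = dx (u_of f) w.
  by apply: filterS (open_nbhs_nbhs (conj oU Uz)) => w Uw; rewrite (dx_pdx (u_pdx Uw).1).
have Ey : \forall w \near z, uy f w = dy (u_of f) w.
  by apply: filterS (open_nbhs_nbhs (conj oU Uz)) => w Uw; rewrite (dy_pdy (u_pdx Uw).2).
have hx := pdx_near Ex (ux_pdx Uz); have hy := pdy_near Ey (uy_pdy Uz).
rewrite laplacianE; [|by case: hx|by case: hy].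
rewrite /partial /= (dx_pdx hx) (dy_pdy hy) /uxx /uyy.
by field; exact: L_neq0.
Qed.

(** The second derivatives of [neglog f] cancel here too. What remains is [g_of f] times a factor
    bounded by 2 and tending to 1, so the dominating function can be chosen independent of [n]. *)
Lemma vxDvy n z : Omega z -> vx n f z + vy n f z =
  g_of f z * (damp n f z + n.+1%:R * neglog f z / (n.+1%:R + neglog f z) ^+ 2).
Proof.
move=> Oz; rewrite g_ofE//; have [fz|fz] := eqVneq (f z) 0.
  rewrite /vx /vy /uxx /uyy /ux /uy neglog_zero// invr0 !mulr0 expr0n /=; ring.
have Uz : U z by split.
have h1 := L_neq0 Uz; have h2 := lt0r_neq0 (nL n Uz).
rewrite /vx /vy /uxx /uyy /ux /uy /damp; move: (n.+1%:R : R) h2 => x h2; field.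
by rewrite h1 h2.
Qed.

End loglog.

(** * Domination of the gradient and of the damped second derivatives *)

Section loglog_bounds.
Variable R : realType.
Implicit Types (z w a : R[i]) (n m : nat) (h : R[i] -> R).

(** [m * l <= L + C <= (1 + C) * L] because [L >= 1]. The case [m = 0], where [L] need not grow, is
    included. *)
Let weight_le (m : nat) (L l C : R) : 1 <= L -> 0 < l -> 0 < C -> `|L - m%:R * l| <= C -> m%:R / L <= (1 + C) / l.
Proof.
move=> L1 l0 C0; rewrite ler_norml => /andP[H _].
have L0 : 0 < L by apply: lt_le_trans L1.
rewrite ler_pdivrMr// mulrAC ler_pdivlMr//.
have : C <= C * L by rewrite ler_peMr// ltW.
have : m%:R * l <= L + C by lra.
lra.
Qed.

Let sqr_le (x y : R) : (x + y) ^+ 2 <= 2 * x ^+ 2 + 2 * y ^+ 2.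
Proof.
rewrite -subr_ge0 (_ : _ - _ = (x - y) ^+ 2); last by ring.
exact: sqr_ge0.
Qed.

(** To be read with [s = normc (w - a)], [L = neglog f w], [l = ell a w] and [X] a component of
    [lder f w]; the right-hand side is then a multiple of [kap a w] plus a constant. *)
Lemma gradient_le (m : nat) (s L l C X : R) : 1 <= L -> 0 < l -> 0 < s -> 0 < C ->
  `|L - m%:R * l| <= C -> `|X| <= m%:R / s + C ->
  (2 * X / L) ^+ 2 <= 8 * (1 + C) ^+ 2 * (s ^+ 2 * l ^+ 2)^-1 + 8 * C ^+ 2.
Proof.
move=> L1 l0 s0 C0 HL HX.
have L0 : 0 < L by apply: lt_le_trans L1.
have W := weight_le L1 l0 C0 HL.
have H : `|2 * X / L| <= 2 * ((1 + C) / (s * l) + C).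
  rewrite normrM normfV (gtr0_norm L0) normrM (ger0_norm (ler0n _ 2)) -mulrA.
  apply: ler_wpM2l => //; apply: (@le_trans _ _ ((m%:R / s + C) / L)).
    by apply: ler_wpM2r => //; rewrite invr_ge0 ltW.
  rewrite mulrDl; apply: lerD.
    rewrite mulrAC invfM mulrA [_ / s / l]mulrAC; apply: ler_wpM2r => //.
    by rewrite invr_ge0 ltW.
  by rewrite ler_pdivrMr//; apply: ler_peMr => //; exact: ltW.
rewrite -real_normK ?num_real//.
apply: (@le_trans _ _ ((2 * ((1 + C) / (s * l) + C)) ^+ 2)).
  by apply: lerXn2r => //; rewrite nnegrE; apply: le_trans H.
rewrite exprMn; apply: le_trans (ler_wpM2l (sqr_ge0 2) (sqr_le _ _)) _.
rewrite le_eqVlt; apply/orP; left; apply/eqP; field.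
by rewrite !gt_eqF.
Qed.

(** [Y] is a component of [cD (lder f) w]. The denominator is [L ^+ 2], one [L] from the logarithm
    and one from the damping; a single [L] would not give an integrable bound. *)
Lemma hessian_le (m : nat) (s L l C Y : R) : 1 <= L -> 0 < l -> 0 < s -> 0 < C ->
  `|L - m%:R * l| <= C -> `|Y| <= m%:R / s ^+ 2 + C ->
  `|2 * Y| / L ^+ 2 <= 2 * (1 + C) ^+ 2 * (s ^+ 2 * l ^+ 2)^-1 + 2 * C.
Proof.
move=> L1 l0 s0 C0 HL HY.
have L0 : 0 < L by apply: lt_le_trans L1.
have W := weight_le L1 l0 C0 HL.
set K := (s ^+ 2 * l ^+ 2)^-1.
have -> : 2 * (1 + C) ^+ 2 * K + 2 * C = 2 * ((1 + C) ^+ 2 * K + C) by ring.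
rewrite normrM (ger0_norm (ler0n _ 2)) -mulrA; apply: ler_wpM2l => //.
apply: (@le_trans _ _ ((m%:R / s ^+ 2 + C) / L ^+ 2)).
  by apply: ler_wpM2r => //; rewrite invr_ge0 exprn_ge0// ltW.
rewrite mulrDl; apply: lerD; last first.
  rewrite ler_pdivrMr ?exprn_gt0//; apply: ler_peMr; first exact: ltW.
  exact: exprn_ege1.
have -> : (1 + C) ^+ 2 * K = ((1 + C) / l) ^+ 2 / s ^+ 2.
  by rewrite /K; field; rewrite !gt_eqF.
rewrite mulrAC; apply: ler_wpM2r; first by rewrite invr_ge0 exprn_ge0// ltW.
apply: (@le_trans _ _ ((m%:R / L) ^+ 2)).
  rewrite expr_div_n; apply: ler_wpM2r; first by rewrite invr_ge0 exprn_ge0// ltW.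
  (* [m <= m ^ 2] for natural [m] turns the single factor [m] into the square of [m / L]. *)
  by rewrite -natrX ler_nat; case: (m) => // k; rewrite expnS leq_pmulr// expn1.
apply: lerXn2r => //; rewrite nnegrE ?divr_ge0// ?ltW//; lra.
Qed.

(** With [t] the square root of [|w - a|], [ell a w = 4 ln (1 / t) <= 4 / t]; the fourth power of
    this inequality is the claim, with [256 = 4 ^ 4]. *)
Lemma ell_sqr_le a w : box a (4^-1) w -> w != a -> ell a w ^+ 2 <= 256 * kap a w.
Proof.
move=> wb wa; have s0 : 0 < normc (w - a) by rewrite normc_gt0 subr_eq0.
have l0 : 0 < ell a w by apply: lt_le_trans (ell_ge_ln2 wb wa); exact: ln2_gt0.
move: s0 l0; rewrite /kap /ell /neglog; set s := normc (w - a) => s0; set l := - ln (s ^+ 2) => l0.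
pose t := Num.sqrt s; have t0 : 0 < t by rewrite sqrtr_gt0.
have ts : t ^+ 2 = s by rewrite sqr_sqrtr// ltW.
have lt : l <= 4 / t.
  have -> : l = 4 * ln t^-1.
    rewrite /l -ts -exprM lnXn// lnV ?posrE// -mulr_natl; ring.
  apply: ler_wpM2l => //; apply: ltW; apply: ln_sublinear; by rewrite invr_gt0.
rewrite ler_pdivlMr; last by rewrite mulr_gt0 ?exprn_gt0.
have : l ^+ 4 <= (4 / t) ^+ 4 by apply: lerXn2r => //; rewrite nnegrE ltW ?divr_gt0.
have t4 : t ^+ 4 = s ^+ 2 by rewrite -ts -exprM.
have -> : (4 / t) ^+ 4 = 256 / s ^+ 2 by rewrite expr_div_n t4; field; rewrite gt_eqF.
rewrite ler_pdivlMr ?exprn_gt0// => H.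
by have -> : l ^+ 2 * (s ^+ 2 * l ^+ 2) = l ^+ 4 * s ^+ 2 by ring.
Qed.

Lemma kap_dominated_punctured (V : set R[i]) h : (forall a, V a -> exists r C D, 0 < r <= 4^-1 /\
  forall w, box a r w -> w != a -> h w <= C * kap a w + D) -> kap_dominated V h.
Proof.
move=> H a Va; have [r [C [D [hr hD]]]] := H a Va.
exists r, C, (`|D| + `|h a|); split => // w wb _.
have [->|wa] := eqVneq w a.
  by rewrite kap_center mulr0 add0r; apply: le_trans (ler_norm _) _; rewrite lerDr.
apply: le_trans (hD w wb wa) _; rewrite lerD2l; apply: le_trans (ler_norm _) _.
by rewrite lerDl.
Qed.

Variables (Omega : set R[i]) (f : R[i] -> R[i]).
Hypothesis dO : domain Omega.
Hypothesis hf : holomorphic_on Omega f.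
Hypothesis nf : nonconstant_on Omega f.
Hypothesis small : forall z, Omega z -> normc (f z) < 10^-1.

Let oO : open Omega. Proof. by case: dO. Qed.
Let U := Omega `&` [set z | f z != 0].
Let oU : open U. Proof. exact: open_nonzero oO hf. Qed.

Lemma singularity_box a : Omega a -> exists m r C, [/\ 0 < r <= 4^-1, 0 < C, f a = 0 -> (0 < m)%N &
  forall w, box a r w -> w != a -> [/\ U w, 1 <= neglog f w,
     `|neglog f w - m%:R * ell a w| <= C,
     normc (lder f w - m%:R / (w - a)) <= C &
     normc (cD (lder f) w + m%:R / (w - a) ^+ 2) <= C]].
Proof.
move=> Oa; have [m [r [C [r0 C0 m0 H]]]] := log_singularity dO hf nf Oa.
exists m, (Num.min (r / 2) 4^-1), C; split => //.
  by rewrite lt_min divr_gt0//= invr_gt0 ltr0n /= ge_min lexx orbT.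
move=> w [w1 w2] wa; have [|Ow fw h1 h2 h3] := H w.
  rewrite normc_gt0 subr_eq0 wa /=; apply: le_lt_trans (normc_le_abs _) _.
  rewrite [ltRHS]splitr ReB ImB; apply: ltrD.
    by apply: lt_le_trans w1 _; rewrite ge_min lexx.
  by apply: lt_le_trans w2 _; rewrite ge_min lexx.
split => //; exact: (neglog_ge1 small).
Qed.

Lemma isolated_zeros : isolated_in Omega [set z | f z = 0].
Proof.
move=> a /singularity_box[m [r [C [/andP[r0 _] _ _ H]]]]; exists r => // w wb /= fw.
apply: contrapT => /eqP wa; have [[_ /=]] := H w wb wa; rewrite fw => /eqP; exact.
Qed.

Let nkey z w a m (C : R) : normc (z - m%:R / (w - a)) <= C -> normc z <= m%:R / normc (w - a) + C.
Proof.
move=> H; rewrite -(subrK (m%:R / (w - a)) z); apply: le_trans (le_normcD _ _) _.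
rewrite addrC; apply: lerD => //; rewrite normcM normcV.
by rewrite -(rmorph_nat (real_complex R)) normc_real ger0_norm.
Qed.

Lemma grad_dominated : kap_dominated Omega (fun z => ux f z ^+ 2 + uy f z ^+ 2).
Proof.
apply: kap_dominated_punctured => a /singularity_box[m [r [C [hr C0 _ H]]]].
exists r, (8 * (1 + C) ^+ 2 + 8 * (1 + C) ^+ 2), (8 * C ^+ 2 + 8 * C ^+ 2); split => // w wb wa.
have [_ L1 h1 h2 _] := H w wb wa.
have wb4 : box a (4^-1) w.
  by case/andP : hr => _ r4; case: wb => ? ?; split; exact: lt_le_trans r4.
have s0 : 0 < normc (w - a) by rewrite normc_gt0 subr_eq0.
have l0 : 0 < ell a w by apply: lt_le_trans (ell_ge_ln2 wb4 wa); exact: ln2_gt0.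
have k := nkey h2.
have k1 := gradient_le L1 l0 s0 C0 h1 (le_trans (Re_le_normc _) k).
have k2 := gradient_le L1 l0 s0 C0 h1 (le_trans (Im_le_normc _) k).
rewrite mulrDl addrACA; apply: lerD => //.
by apply: le_trans k1; rewrite /ux /Lx !mulNr sqrrN.
Qed.

(** The crude bound [ln L <= L] suffices: [L] is at most a multiple of [ell a w] plus a constant,
    and the square of [ell a w] is dominated by the kernel. *)
Lemma u_dominated : kap_dominated Omega (fun z => u_of f z ^+ 2).
Proof.
apply: kap_dominated_punctured => a /singularity_box[m [r [C [hr C0 _ H]]]].
exists r, (2 * m%:R ^+ 2 * 256), (2 * C ^+ 2); split => // w wb wa.
have [_ L1 h1 _ _] := H w wb wa.
have wb4 : box a (4^-1) w.
  by case/andP : hr => _ r4; case: wb => ? ?; split; exact: lt_le_trans r4.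
have L0 : 0 < neglog f w by apply: lt_le_trans L1.
have l0 : 0 < ell a w by apply: lt_le_trans (ell_ge_ln2 wb4 wa); exact: ln2_gt0.
have e2 := ell_sqr_le wb4 wa.
have u0 : 0 <= u_of f w by exact: ln_ge0.
have uL : u_of f w <= m%:R * ell a w + C.
  apply: (@le_trans _ _ (neglog f w)); first exact: ltW (ln_sublinear L0).
  by move: h1; rewrite ler_norml => /andP[_ ?]; lra.
apply: (@le_trans _ _ ((m%:R * ell a w + C) ^+ 2)).
  by apply: lerXn2r => //; rewrite nnegrE// addr_ge0 ?mulr_ge0// ltW.
apply: le_trans (sqr_le _ _) _; rewrite lerD2r exprMn -!mulrA; apply: ler_wpM2l => //.
by do 2 apply: ler_wpM2l => //.
Qed.

Lemma damp_bounds n z : Omega z -> [/\ 0 <= damp n f z, damp n f z <= 1 &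
  0 <= n.+1%:R * neglog f z / (n.+1%:R + neglog f z) ^+ 2 <= 1].
Proof.
move=> Oz; have L0 : 0 <= neglog f z.
  have [fz|fz] := eqVneq (f z) 0; first by rewrite neglog_zero.
  exact: le_trans (neglog_ge1 small Oz fz).
have n0 : 0 < n.+1%:R :> R by rewrite ltr0n.
rewrite /damp; move: (neglog f z) (n.+1%:R : R) L0 n0 => L x L0 x0.
have xL : 0 < x + L by rewrite ltr_pwDl.
split; first by rewrite divr_ge0// ltW.
  by rewrite ler_pdivrMr// mul1r lerDl.
rewrite divr_ge0 ?mulr_ge0 ?exprn_ge0 ?(ltW x0) ?(ltW xL)//=.
rewrite ler_pdivrMr ?exprn_gt0// mul1r sqrrD.
have : 0 <= x ^+ 2 + L ^+ 2 by rewrite addr_ge0 ?sqr_ge0.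
have : 0 <= x * L by rewrite mulr_ge0// ltW.
by rewrite -mulr_natl; lra.
Qed.

(** Here [x = n + 1], [A] is [Lxx f] up to sign, [q] is [ux f] or [uy f], and [q * L] the matching
    first derivative of [neglog f]. Bounding [x + L] from below by [L] produces the square of [L]
    under [A]. *)
Let vbound (x L A q : R) : 0 < x -> 1 <= L ->
  `|x / (x + L) * (A / L - q ^+ 2) - x / (x + L) ^+ 2 * ((q * L) * q)| <= x * (`|A| / L ^+ 2) + 2 * q ^+ 2.
Proof.
move=> x0 L1; have L0 : 0 < L by apply: lt_le_trans L1.
have xL : 0 < x + L by rewrite addr_gt0.
have q0 : 0 <= q ^+ 2 by exact: sqr_ge0.
have -> : x / (x + L) * (A / L - q ^+ 2) - x / (x + L) ^+ 2 * (q * L * q) =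
  x * (A / (L * (x + L))) - x / (x + L) * q ^+ 2 - x * L / (x + L) ^+ 2 * q ^+ 2.
  by field; rewrite !gt_eqF.
apply: le_trans (ler_normB _ _) _; apply: le_trans (lerD (ler_normB _ _) (lexx _)) _.
rewrite mulr2n mulrDl mul1r addrA; apply: lerD; first apply: lerD.
- rewrite normrM (gtr0_norm x0); apply: ler_wpM2l; first exact: ltW.
  rewrite normrM normfV; apply: ler_wpM2l => //; rewrite gtr0_norm ?mulr_gt0//.
  rewrite lef_pV2 ?posrE ?mulr_gt0 ?exprn_gt0// expr2; apply: ler_wpM2l; first exact: ltW.
  by rewrite lerDr ltW.
- rewrite normrM (ger0_norm q0); apply: ler_piMl => //.
  by rewrite ger0_norm ?divr_ge0 ?(ltW x0) ?(ltW xL)// ler_pdivrMr// mul1r lerDl ltW.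
rewrite normrM (ger0_norm q0); apply: ler_piMl => //.
have xxL : 0 <= x * L by rewrite mulr_ge0// ltW.
rewrite ger0_norm; last by rewrite divr_ge0// exprn_ge0// ltW.
rewrite ler_pdivrMr ?exprn_gt0// mul1r sqrrD.
have := sqr_ge0 x; have := sqr_ge0 L.
by rewrite -mulr_natl; lra.
Qed.

Let v_dominated n (v : R[i] -> R) :
  (forall w, U w -> exists2 q, q ^+ 2 <= ux f w ^+ 2 + uy f w ^+ 2 &
     `|v w| <= n.+1%:R * (`|Lxx f w| / neglog f w ^+ 2) + 2 * q ^+ 2) ->
  kap_dominated Omega (fun z => `|v z|).
Proof.
move=> Hv; apply: kap_dominated_punctured => a Oa.
have [r1 [C1 [D1 [/andP[r10 r14] H1]]]] := grad_dominated Oa.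
have [m [r [C [/andP[r0 r4] C0 _ H]]]] := singularity_box Oa.
exists (Num.min r r1), (n.+1%:R * (2 * (1 + C) ^+ 2) + 2 * C1), (n.+1%:R * (2 * C) + 2 * D1).
split; first by rewrite lt_min r0 r10 ge_min r4.
move=> w [w1 w2] wa.
have wb : box a r w by split; [apply: lt_le_trans w1 _|apply: lt_le_trans w2 _]; rewrite ge_min lexx.
have wb1 : box a r1 w by split; [apply: lt_le_trans w1 _|apply: lt_le_trans w2 _]; rewrite ge_min lexx orbT.
have [Uw L1 h1 _ h3] := H w wb wa.
have wb4 : box a (4^-1) w by case: wb => ? ?; split; exact: lt_le_trans r4.
have s0 : 0 < normc (w - a) by rewrite normc_gt0 subr_eq0.
have l0 : 0 < ell a w by apply: lt_le_trans (ell_ge_ln2 wb4 wa); exact: ln2_gt0.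
have k : normc (cD (lder f) w) <= m%:R / normc (w - a) ^+ 2 + C.
  rewrite -(addrK (m%:R / (w - a) ^+ 2) (cD (lder f) w)); apply: le_trans (le_normcD _ _) _.
  rewrite normcN addrC; apply: lerD => //; rewrite normcM normcV expr2 normcM -expr2.
  by rewrite -(rmorph_nat (real_complex R)) normc_real ger0_norm.
have k1 := hessian_le L1 l0 s0 C0 h1 (le_trans (Re_le_normc _) k).
have [q hq /le_trans] := Hv w Uw; apply.
have k2 := H1 w wb1 (proj1 Uw).
have k3 : `|Lxx f w| / neglog f w ^+ 2 <= 2 * (1 + C) ^+ 2 * kap a w + 2 * C.
  by apply: le_trans k1; rewrite /Lxx mulNr normrN.
have n0 : 0 <= n.+1%:R :> R by [].
have k4 := ler_wpM2l n0 k3.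
apply: le_trans (lerD k4 (ler_wpM2l (ler0n _ 2) (le_trans hq k2))) _.
by rewrite le_eqVlt; apply/orP; left; apply/eqP; ring.
Qed.

Lemma vx_dominated n : kap_dominated Omega (fun z => `|vx n f z|).
Proof.
apply: (v_dominated (n := n)) => w [Ow fw]; exists (ux f w); first by rewrite lerDl sqr_ge0.
have L1 := neglog_ge1 small Ow fw; have L0 : neglog f w != 0 by rewrite gt_eqF//; exact: lt_le_trans L1.
have := @vbound n.+1%:R _ (Lxx f w) (ux f w) (ltr0Sn _ _) L1.
by rewrite {3}/ux divfK.
Qed.

Lemma vy_dominated n : kap_dominated Omega (fun z => `|vy n f z|).
Proof.
apply: (v_dominated (n := n)) => w [Ow fw]; exists (uy f w); first by rewrite lerDr sqr_ge0.
have L1 := neglog_ge1 small Ow fw; have L0 : neglog f w != 0 by rewrite gt_eqF//; exact: lt_le_trans L1.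
have := @vbound n.+1%:R _ (- Lxx f w) (uy f w) (ltr0Sn _ _) L1.
by rewrite normrN {3}/uy divfK.
Qed.

End loglog_bounds.

(** * Sobolev regularity and distributional Laplacian *)

Section regularity.
Variable R : realType.
Implicit Types (z w a : R[i]) (n m : nat) (h : R[i] -> R).

Lemma supp_dx (phi : R[i] -> R) : supp (dx phi) `<=` supp phi.
Proof.
rewrite [supp phi](closure_id (supp phi)).1; last exact: closed_closure.
apply: closure_subset => z /= pz; apply: contrapT => nz.
by move: pz; rewrite test_dx_supp// eqxx.
Qed.

Lemma supp_dy (phi : R[i] -> R) : supp (dy phi) `<=` supp phi.
Proof.
rewrite [supp phi](closure_id (supp phi)).1; last exact: closed_closure.
apply: closure_subset => z /= pz; apply: contrapT => nz.
by move: pz; rewrite test_dy_supp// eqxx.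
Qed.

Lemma integrable_test V K h (psi : R[i] -> R) : open V -> compact K -> K `<=` V -> Lp_loc 1%E V h ->
  continuous psi -> (forall z, ~ K z -> psi z = 0) ->
  (dA R).-integrable (planeset V) (fun q => (h (to_C q) * psi (to_C q))%:E).
Proof.
move=> oV cK KV Lh cpsi psi0; have mV := measurable_open oV.
have := integrable_cut oV cK KV Lh cpsi; move=> /(integrableS measurableT mV (@subsetT _ _)).
apply: eq_integrable => // q _; have [Kq|nKq] := pselect (K (to_C q)); first by rewrite cut_in.
by rewrite cut_out// psi0// mulr0.
Qed.

Lemma intCD V (g h : R[i] -> R) : open V ->
  (dA R).-integrable (planeset V) (fun q => (g (to_C q))%:E) ->
  (dA R).-integrable (planeset V) (fun q => (h (to_C q))%:E) ->
  intC V (fun z => g z + h z) = (intC V g + intC V h)%E.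
Proof.
move=> oV ig ih; rewrite /intC; under eq_integral do rewrite EFinD.
by rewrite (integralD _ ig ih)//; exact: measurable_open.
Qed.

(** Dominated convergence for multipliers [c n]; the bound 2 is dictated by the factor in [vxDvy], a
    sum of two terms of size at most 1. *)
Lemma intC_cvg V (c : nat -> R[i] -> R) G : open V ->
  (dA R).-integrable (planeset V) (fun q => (G (to_C q))%:E) ->
  (forall n, measurable_fun (planeset V) (c n \o @to_C R)) ->
  (forall n z, V z -> `|c n z| <= 2) -> (forall z, V z -> c n z @[n --> \oo] --> (1 : R)) ->
  (intC V (fun z => c n z * G z)) @[n --> \oo] --> intC V G.
Proof.
move=> oV iG mc cb c1; have mV := measurable_open oV.
have mG : measurable_fun (planeset V) (G \o @to_C R).
  by case/integrableP : iG => /measurable_EFinP.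
apply: (@dominated_cvg _ _ _ (dA R) (planeset V) mV _ _ (fun q => (2 * `|G (to_C q)|)%:E)) => //.
- by move=> n; apply/measurable_EFinP; exact: (measurable_funM (mc n) mG).
- move=> q Vq; apply: cvg_EFin; first exact: nearW.
  rewrite -[X in _ --> X]mul1r; apply: cvgM; first exact: c1.
  exact: cvg_cst.
- have := integrableZl mV 2 (integrable_abse iG).
  by apply: eq_integrable => // q _.
- move=> n q Vq; rewrite lee_fin normrM; apply: ler_wpM2r => //; exact: cb.
Qed.

Variables (Omega : set R[i]) (f : R[i] -> R[i]).
Hypothesis dO : domain Omega.
Hypothesis hf : holomorphic_on Omega f.
Hypothesis nf : nonconstant_on Omega f.
Hypothesis small : forall z, Omega z -> normc (f z) < 10^-1.

Let oO : open Omega. Proof. by case: dO. Qed.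
Let U := Omega `&` [set z | f z != 0].
Let oU : open U. Proof. exact: open_nonzero oO hf. Qed.

Let measurable_U h : (forall z, U z -> {for z, continuous h}) -> (forall z, f z = 0 -> h z = 0) ->
  measurable_fun (planeset Omega) (h \o @to_C R).
Proof.
move=> ch h0; apply: (@measurable_off _ _ U _ 0) => // [z []//|z Oz nU].
by apply: h0; apply: contrapT => /eqP fz; apply: nU.
Qed.

Let u0 z : f z = 0 -> u_of f z = 0.
Proof. by move=> fz; rewrite -[u_of f z]/(ln (neglog f z)) neglog_zero// ln0. Qed.
Let ux0 z : f z = 0 -> ux f z = 0.
Proof. by move=> fz; rewrite /ux neglog_zero// invr0 mulr0. Qed.
Let uy0 z : f z = 0 -> uy f z = 0.
Proof. by move=> fz; rewrite /uy neglog_zero// invr0 mulr0. Qed.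
Let vx0 n z : f z = 0 -> vx n f z = 0.
Proof. by move=> fz; rewrite /vx /uxx ux0// neglog_zero// invr0 expr0n /= !(mulr0, subr0). Qed.
Let vy0 n z : f z = 0 -> vy n f z = 0.
Proof. by move=> fz; rewrite /vy /uyy uy0// neglog_zero// invr0 expr0n /= !(mulr0, subr0). Qed.

Let mu_ : measurable_fun (planeset Omega) (u_of f \o @to_C R).
Proof. by apply: measurable_U => // z Uz; exact: continuous_u Uz. Qed.
Let mux : measurable_fun (planeset Omega) (ux f \o @to_C R).
Proof. by apply: measurable_U => // z Uz; exact: continuous_ux Uz. Qed.
Let muy : measurable_fun (planeset Omega) (uy f \o @to_C R).
Proof. by apply: measurable_U => // z Uz; exact: continuous_uy Uz. Qed.

Let sqr_powR (x : R) : `|x| `^ 2 = x ^+ 2.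
Proof. by rewrite powR_mulrn// real_normK ?num_real. Qed.

Let dom_le h h' : (forall z, h z <= h' z) -> kap_dominated Omega h' -> kap_dominated Omega h.
Proof.
move=> hh H a /H[r [C [D [hr hD]]]]; exists r, C, D; split => // w wb Ow.
exact: le_trans (hh w) (hD w wb Ow).
Qed.

Let du2 : kap_dominated Omega (fun z => `|u_of f z| `^ 2).
Proof. by apply: (dom_le _ (u_dominated dO hf nf small)) => z; rewrite sqr_powR. Qed.
Let dux2 : kap_dominated Omega (fun z => `|ux f z| `^ 2).
Proof. by apply: (dom_le _ (grad_dominated dO hf nf small)) => z; rewrite sqr_powR lerDl sqr_ge0. Qed.
Let duy2 : kap_dominated Omega (fun z => `|uy f z| `^ 2).
Proof. by apply: (dom_le _ (grad_dominated dO hf nf small)) => z; rewrite sqr_powR lerDr sqr_ge0. Qed.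

Lemma Lp2_u : Lp_loc 2%:E Omega (u_of f). Proof. exact: Lp_loc_intro. Qed.
Lemma Lp2_ux : Lp_loc 2%:E Omega (ux f). Proof. exact: Lp_loc_intro. Qed.
Lemma Lp2_uy : Lp_loc 2%:E Omega (uy f). Proof. exact: Lp_loc_intro. Qed.
Lemma Lp1_u : Lp_loc 1%E Omega (u_of f).
Proof. by apply: (Lp_loc_intro (p := 1)) => //; exact: kap_dominated_sqr. Qed.
Lemma Lp1_ux : Lp_loc 1%E Omega (ux f).
Proof. by apply: (Lp_loc_intro (p := 1)) => //; exact: kap_dominated_sqr. Qed.
Lemma Lp1_uy : Lp_loc 1%E Omega (uy f).
Proof. by apply: (Lp_loc_intro (p := 1)) => //; exact: kap_dominated_sqr. Qed.

Let mdamp n : measurable_fun (planeset Omega) (damp n f \o @to_C R).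
Proof.
apply: (@measurable_off _ _ U _ 1) => // [z []//|z Uz|z Oz nU]; first exact: continuous_damp Uz.
have fz : f z = 0 by apply: contrapT => /eqP fz; apply: nU.
by rewrite /damp neglog_zero// addr0 divff// pnatr_eq0.
Qed.

Let Lp1_damp n h : measurable_fun (planeset Omega) (h \o @to_C R) -> kap_dominated Omega (fun z => `|h z| `^ 1) ->
  Lp_loc 1%E Omega (fun z => damp n f z * h z).
Proof.
move=> mh dh; apply: (Lp_loc_intro (p := 1)) => //.
  exact: (measurable_funM (mdamp n) mh).
move=> a /dh[r [C [D [hr hD]]]]; exists r, C, D; split => // w wb Ow.
apply: le_trans (hD w wb Ow); rewrite !powRr1// normrM.
have [d0 d1 _] := damp_bounds small n Ow.
by apply: ler_piMl => //; rewrite ger0_norm.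
Qed.

Let Lp1_dux n : Lp_loc 1%E Omega (fun z => damp n f z * ux f z).
Proof. by apply: Lp1_damp => //; exact: kap_dominated_sqr. Qed.
Let Lp1_duy n : Lp_loc 1%E Omega (fun z => damp n f z * uy f z).
Proof. by apply: Lp1_damp => //; exact: kap_dominated_sqr. Qed.

Let Lp1_vx n : Lp_loc 1%E Omega (vx n f).
Proof.
apply: (Lp_loc_intro (p := 1)) => //.
  by apply: measurable_U => [z Uz|z]; [exact: continuous_vx Uz|exact: vx0].
by apply: (dom_le _ (vx_dominated dO hf nf small n)) => z; rewrite powRr1.
Qed.
Let Lp1_vy n : Lp_loc 1%E Omega (vy n f).
Proof.
apply: (Lp_loc_intro (p := 1)) => //.
  by apply: measurable_U => [z Uz|z]; [exact: continuous_vy Uz|exact: vy0].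
by apply: (dom_le _ (vy_dominated dO hf nf small n)) => z; rewrite powRr1.
Qed.

Lemma Lp1_g : Lp_loc 1%E Omega (g_of f).
Proof.
apply: (Lp_loc_intro (p := 1)) => //.
  apply: (eq_measurable_fun ((fun z => - (ux f z ^+ 2 + uy f z ^+ 2)) \o @to_C R)).
    by move=> q; rewrite inE => Oq /=; rewrite (g_ofE dO hf small).
  apply: measurableT_comp => //; apply: measurable_funD; exact: measurable_funX.
move=> a Oa; have [r [C [D [hr hD]]]] := grad_dominated dO hf nf small Oa.
exists r, C, D; split => // w wb Ow; apply: le_trans (hD w wb Ow).
by rewrite powRr1// (g_ofE dO hf small)// normrN ger0_norm// addr_ge0 ?sqr_ge0.
Qed.

Let iZ := isolated_zeros dO hf nf small.
Let Z := [set z | f z = 0].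
Let notZ z : Omega z -> ~ Z z -> U z.
Proof. by move=> Oz Zz; split => //; apply/eqP. Qed.

Let u_x phi : test_function Omega phi ->
  intC Omega (fun z => u_of f z * dx phi z) = (- intC Omega (fun z => (ux f z * phi z)%R))%E.
Proof.
move=> tphi; apply: (ibp_x (Z := Z)) => // [z Oz Zz|z Oz Zz|||z Oz Zz].
- have Uz := notZ Oz Zz; exact: continuous_u Uz.
- have Uz := notZ Oz Zz; exact: continuous_ux Uz.
- exact: Lp1_u.
- exact: Lp1_ux.
- by have [] := u_pdx hf small (notZ Oz Zz).
Qed.

Let u_y phi : test_function Omega phi ->
  intC Omega (fun z => u_of f z * dy phi z) = (- intC Omega (fun z => (uy f z * phi z)%R))%E.
Proof.
move=> tphi; apply: (ibp_y (Z := Z)) => // [z Oz Zz|z Oz Zz|||z Oz Zz].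
- have Uz := notZ Oz Zz; exact: continuous_u Uz.
- have Uz := notZ Oz Zz; exact: continuous_uy Uz.
- exact: Lp1_u.
- exact: Lp1_uy.
- by have [] := u_pdx hf small (notZ Oz Zz).
Qed.

Let dux_x n phi : test_function Omega phi ->
  intC Omega (fun z => damp n f z * ux f z * dx phi z) = (- intC Omega (fun z => (vx n f z * phi z)%R))%E.
Proof.
move=> tphi; apply: (ibp_x (Z := Z) (h := fun z => damp n f z * ux f z)) => // [z Oz Zz|z Oz Zz|z Oz Zz].
- have Uz := notZ Oz Zz; have c1 : {for z, continuous (damp n f)} by exact: continuous_damp Uz.
  have c2 : {for z, continuous (ux f)} by exact: continuous_ux Uz.
  exact: (continuousM c1 c2).
- by have Uz := notZ Oz Zz; exact: continuous_vx Uz.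
- exact: (damp_ux_pdx dO hf small n (notZ Oz Zz)).
Qed.

Let duy_y n phi : test_function Omega phi ->
  intC Omega (fun z => damp n f z * uy f z * dy phi z) = (- intC Omega (fun z => (vy n f z * phi z)%R))%E.
Proof.
move=> tphi; apply: (ibp_y (Z := Z) (h := fun z => damp n f z * uy f z)) => // [z Oz Zz|z Oz Zz|z Oz Zz].
- have Uz := notZ Oz Zz; have c1 : {for z, continuous (damp n f)} by exact: continuous_damp Uz.
  have c2 : {for z, continuous (uy f)} by exact: continuous_uy Uz.
  exact: (continuousM c1 c2).
- by have Uz := notZ Oz Zz; exact: continuous_vy Uz.
- exact: (damp_uy_pdy dO hf small n (notZ Oz Zz)).
Qed.

Lemma loglog_Sobolev12 : Sobolev_loc 1 2%:E Omega (u_of f).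
Proof.
split; first exact: Lp2_u.
case=> [|[|a]] [|[|b]]//= _.
- exists (uy f); last exact: Lp2_uy.
  split; [exact: Lp1_u|exact: Lp1_uy|move=> phi tphi].
  by rewrite /partial /= u_y// expr1 EFinN mulN1e.
- exists (ux f); last exact: Lp2_ux.
  split; [exact: Lp1_u|exact: Lp1_ux|move=> phi tphi].
  by rewrite /partial /= u_x// expr1 EFinN mulN1e.
Qed.

Let neglog_ge0 z : Omega z -> 0 <= neglog f z.
Proof.
move=> Oz; have [fz|fz] := eqVneq (f z) 0; first by rewrite neglog_zero.
exact: le_trans (neglog_ge1 small Oz fz).
Qed.

Let frac_cvg (L : R) : 0 <= L -> n.+1%:R / (n.+1%:R + L) @[n --> \oo] --> (1 : R).
Proof.
move=> L0; apply/cvgrPdist_le => e e0; near=> n.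
have n0 : 0 < n.+1%:R :> R by rewrite ltr0n.
have nL : 0 < n.+1%:R + L by rewrite ltr_pwDl.
have -> : 1 - n.+1%:R / (n.+1%:R + L) = L / (n.+1%:R + L).
  by move: (n.+1%:R : R) nL {n0} => x nL; field; rewrite gt_eqF.
rewrite ger0_norm ?divr_ge0// ?(ltW nL)// ler_pdivrMr//.
apply: (@le_trans _ _ (e * n.+1%:R)); last by rewrite ler_wpM2l ?(ltW e0)// lerDl.
rewrite -ler_pdivrMl//; near: n; exists (Num.bound (e^-1 * L)) => // n /= Nn.
have := archi_boundP (mulr_ge0 (ltW (_ : 0 < e^-1)) L0); rewrite invr_gt0 => /(_ e0) /ltW/le_trans; apply.
by rewrite ler_nat ltnW.
Unshelve. all: by end_near. Qed.

Let frac2_cvg (L : R) : 0 <= L -> n.+1%:R * L / (n.+1%:R + L) ^+ 2 @[n --> \oo] --> (0 : R).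
Proof.
move=> L0; have c1 := frac_cvg L0.
have c2 : (n.+1%:R / (n.+1%:R + L)) * (1 - n.+1%:R / (n.+1%:R + L)) @[n --> \oo] --> (1 * (1 - 1) : R).
  by apply: cvgM => //; apply: cvgB => //; exact: cvg_cst.
move: c2; rewrite subrr mulr0; apply: cvg_trans; apply: near_eq_cvg; apply: nearW => n.
have n0 : 0 < n.+1%:R :> R by rewrite ltr0n.
have nL : 0 < n.+1%:R + L by rewrite ltr_pwDl.
by move: (n.+1%:R : R) nL {n0} => x nL; field; rewrite gt_eqF.
Qed.

Lemma loglog_distributional_laplacian : distributional_laplacian Omega (u_of f) (g_of f).
Proof.
move=> phi tphi; have tx := test_dx tphi; have ty := test_dy tphi.
pose K := supp phi; have cK : compact K := test_compact tphi.
have KO : K `<=` Omega := @test_sub _ _ _ tphi.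
have cphi := test_continuous tphi; have cx := test_continuous tx; have cy := test_continuous ty.
have cxx := test_continuous (test_dx tx); have cyy := test_continuous (test_dy ty).
have p0 z : ~ K z -> phi z = 0 by exact: supp0.
have x0 z : ~ K z -> dx phi z = 0 by exact: test_dx_supp.
have y0 z : ~ K z -> dy phi z = 0 by exact: test_dy_supp.
have xx0 z : ~ K z -> dx (dx phi) z = 0.
  by move=> nK; apply: test_dx_supp => /supp_dx; exact: nK.
have yy0 z : ~ K z -> dy (dy phi) z = 0.
  by move=> nK; apply: test_dy_supp => /supp_dy; exact: nK.
have lapE : (fun z => u_of f z * laplacian phi z) = (fun z => u_of f z * dx (dx phi) z + u_of f z * dy (dy phi) z).
  apply/funext => z; rewrite laplacianE ?mulrDr//.
    by have [] := test_pdx tx z.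
  by have [] := test_pdy ty z.
rewrite lapE intCD//; last 2 first.
- exact: integrable_test oO cK KO Lp1_u cxx xx0.
- exact: integrable_test oO cK KO Lp1_u cyy yy0.
rewrite [X in (X + _)%E](u_x tx) [X in (_ + X)%E](u_y ty).
pose G z := ux f z * dx phi z + uy f z * dy phi z.
have ix := integrable_test oO cK KO Lp1_ux cx x0.
have iy := integrable_test oO cK KO Lp1_uy cy y0.
have ig := integrable_test oO cK KO Lp1_g cphi p0.
have mO := measurable_open oO.
have iG : (dA R).-integrable (planeset Omega) (fun q => (G (to_C q))%:E).
  by have := integrableD mO ix iy; apply: eq_integrable => // q _; rewrite -EFinD.
have GE : intC Omega G = (intC Omega (fun z => ux f z * dx phi z)%R + intC Omega (fun z => uy f z * dy phi z)%R)%E.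
  exact: intCD.
pose rho n z := damp n f z + n.+1%:R * neglog f z / (n.+1%:R + neglog f z) ^+ 2.
(* The second integration by parts is done on the damped gradient, whose derivatives are locally
   integrable for each fixed [n]; both sides are then passed to the limit, the left one to the
   undamped pairing. *)
have E n : intC Omega (fun z => damp n f z * G z) = (- intC Omega (fun z => (rho n z * (g_of f z * phi z))%R))%E.
  have -> : (fun z => damp n f z * G z) = (fun z => damp n f z * ux f z * dx phi z + damp n f z * uy f z * dy phi z).
    by apply/funext => z; rewrite /G mulrDr !mulrA.
  rewrite intCD//; last 2 first.
  - exact: integrable_test oO cK KO (Lp1_dux n) cx x0.
  - exact: integrable_test oO cK KO (Lp1_duy n) cy y0.
  rewrite dux_x// duy_y// -oppeD; last first.
    apply: fin_num_adde_defl; apply: integrable_fin_num => //.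
    exact: integrable_test oO cK KO (Lp1_vy n) cphi p0.
  rewrite -intCD//; last 2 first.
  - exact: integrable_test oO cK KO (Lp1_vx n) cphi p0.
  - exact: integrable_test oO cK KO (Lp1_vy n) cphi p0.
  congr (- _)%E; apply: eq_integral => q; rewrite inE => Oq; congr EFin.
  by rewrite -mulrDl (vxDvy dO hf small)// /rho mulrAC mulrC mulrA.
have lim1 : (intC Omega (fun z => damp n f z * G z)) @[n --> \oo] --> intC Omega G.
  apply: intC_cvg => //.
    move=> n z Oz; have [d0 d1 _] := damp_bounds small n Oz.
    by rewrite ger0_norm//; lra.
  by move=> z Oz; apply: frac_cvg; exact: neglog_ge0.
have lim2 : (intC Omega (fun z => rho n z * (g_of f z * phi z))) @[n --> \oo] --> intC Omega (fun z => g_of f z * phi z).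
  apply: intC_cvg => //.
  - move=> n; apply: (@measurable_off _ _ U _ 1) => // [z []//|z Uz|z Oz nU].
      have L0 := neglog_ge0 (proj1 Uz).
      have c1 : {for z, continuous (damp n f)} by exact: continuous_damp Uz.
      have [Oz fz] := Uz.
      have c2 := continuous_neglog hf Oz fz.
      have c0 : {for z, continuous (fun=> n.+1%:R : R)} by exact: cst_continuous.
      have c3 : {for z, continuous (fun w => n.+1%:R + neglog f w)} by exact: (continuousD c0 c2).
      have nz : n.+1%:R + neglog f z != 0 by rewrite gt_eqF// ltr_pwDl.
      have c4 : {for z, continuous (fun w => ((n.+1%:R + neglog f w) ^+ 2)^-1)}.
        have c3' : {for z, continuous (fun w => (n.+1%:R + neglog f w) ^+ 2)} by exact: (continuousM c3 c3).
        have nz2 : (n.+1%:R + neglog f z) ^+ 2 != 0 by rewrite expf_neq0.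
        by apply: (@continuousV R _ (fun w => (n.+1%:R + neglog f w) ^+ 2) z); [exact: nz2|exact: c3'].
      have c5 : {for z, continuous (fun w => n.+1%:R * neglog f w / (n.+1%:R + neglog f w) ^+ 2)}.
        by exact: (continuousM (continuousM c0 c2) c4).
      exact: (continuousD c1 c5).
    have fz : f z = 0 by apply: contrapT => /eqP fz; apply: nU.
    by rewrite /rho /damp neglog_zero// addr0 divff ?pnatr_eq0// mulr0 mul0r addr0.
  - move=> n z Oz; have [d0 d1 /andP[e0 e1]] := damp_bounds small n Oz.
    by rewrite /rho ger0_norm ?addr_ge0//; lra.
  - move=> z Oz; rewrite -[X in _ --> X]addr0; apply: cvgD.
      by apply: frac_cvg; exact: neglog_ge0.
    by apply: frac2_cvg; exact: neglog_ge0.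
have {E} GE2 : intC Omega G = (- intC Omega (fun z => g_of f z * phi z)%R)%E.
  apply: (@cvg_unique _ (@ereal_hausdorff R) _ _ _ _ lim1).
  by rewrite (funext E); exact: cvgeN.
rewrite -oppeD; last first.
  by apply: fin_num_adde_defl; exact: integrable_fin_num.
by rewrite -GE GE2 oppeK.
Qed.

End regularity.

(** * Blow-up of the derivatives near a zero *)

Section blowup.
Variable R : realType.
Implicit Types (z w a : R[i]) (n m k : nat) (h : R[i] -> R).

(** Bounds for the real parts of 1/z and 1/z^2 on the square [[2s, 3s] x [0, s]]: the numerators are
    at least [2 s] and [3 s^2], and [|z|^2 <= 10 s^2]. The condition [x >= 2 y] is what keeps
    [x^2 - y^2] away from zero. *)
Let quot_ge (x y s : R) : 0 < s -> 2 * s <= x <= 3 * s -> 0 <= y <= s ->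
  [/\ 4 * s ^+ 2 <= x ^+ 2 + y ^+ 2, x ^+ 2 + y ^+ 2 <= 10 * s ^+ 2,
   (5 * s)^-1 <= x / (x ^+ 2 + y ^+ 2) &
   3 / (100 * s ^+ 2) <= (x ^+ 2 - y ^+ 2) / (x ^+ 2 + y ^+ 2) ^+ 2].
Proof.
move=> s0 /andP[x1 x2] /andP[y1 y2].
have p1 : 4 * s ^+ 2 <= x ^+ 2 by have := lerXn2r 2 (_ : 2 * s \is Num.nneg) (_ : x \is Num.nneg) x1;
  rewrite !nnegrE exprMn -natrX; apply; lra.
have p2 : x ^+ 2 <= 9 * s ^+ 2 by have := lerXn2r 2 (_ : x \is Num.nneg) (_ : 3 * s \is Num.nneg) x2;
  rewrite !nnegrE exprMn -natrX; apply; lra.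
have p3 : y ^+ 2 <= s ^+ 2 by apply: lerXn2r => //; rewrite nnegrE; lra.
have s2 : 0 < s ^+ 2 by rewrite exprn_gt0.
have y0 := sqr_ge0 y.
have d0 : 0 < x ^+ 2 + y ^+ 2 by lra.
split; try lra.
  rewrite ler_pdivlMr// mulrC ler_pdivrMr ?mulr_gt0//.
  have : x * (5 * s) = 5 * (x * s) by ring.
  have : 2 * s * s <= x * s by rewrite ler_wpM2r// ltW.
  have -> : 2 * s * s = 2 * s ^+ 2 by ring.
  lra.
rewrite ler_pdivlMr ?exprn_gt0// mulrAC ler_pdivrMr ?mulr_gt0//.
have : (x ^+ 2 + y ^+ 2) ^+ 2 <= (10 * s ^+ 2) ^+ 2 by apply: lerXn2r; rewrite ?nnegrE; lra.
have : 3 * s ^+ 2 * s ^+ 2 <= (x ^+ 2 - y ^+ 2) * s ^+ 2 by apply: ler_wpM2r; [exact: ltW|lra].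
move: (x ^+ 2) (y ^+ 2) (s ^+ 2) => X Y S; lra.
Qed.

(** [10 * C * s <= 1] makes the error [C] at most half of the main term [M / (5 * s)]; dividing by
    [L], of size at most [M * k * (4 + C)], removes the multiplicity [M] from the bound. *)
Let gradient_ge (M s A X L C k : R) : 1 <= M -> 0 < s -> 0 < C -> 10 * C * s <= 1 -> (5 * s)^-1 <= X ->
  `|A - M * X| <= C -> 0 < L -> L <= M * k * (4 + C) -> 0 < k ->
  - 2 * A / L <= - ((5 * (4 + C))^-1 / (k * s)).
Proof.
move=> M1 s0 C0 Cs HX HA L0 HL k0; have M0 : 0 < M by lra.
have e1 : C <= (10 * s)^-1 by rewrite -(ler_pM2r (_ : 0 < 10 * s)) ?mulVf ?gt_eqF; lra.
have e2 : M * (5 * s)^-1 <= M * X by rewrite ler_wpM2l// ltW.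
have e3 : (10 * s)^-1 <= M * (10 * s)^-1 by rewrite ler_peMl// invr_ge0; lra.
have e5 : M / (10 * s) <= A by move: HA; rewrite ler_norml => /andP[? _]; lra.
rewrite mulNr mulNr lerN2 ler_pdivlMr//.
have p0 : 0 <= (5 * (4 + C))^-1 / (k * s) by rewrite divr_ge0 ?invr_ge0 ?mulr_ge0//; lra.
apply: le_trans (ler_wpM2l p0 HL) _.
have -> : (5 * (4 + C))^-1 / (k * s) * (M * k * (4 + C)) = 2 * (M / (10 * s)).
  by field; rewrite !gt_eqF//; lra.
lra.
Qed.

(** In units of [M / (200 * s ^+ 2)]: the main term [- 2 * B] is at least 10 after absorbing [C],
    and the squared gradient costs at most 2 because [L >= 400 * M]. The remaining 8 gives the
    constant [1 / (25 * (4 + C))]. *)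
Let hessian_ge (M s A B X L C k : R) : 1 <= M -> 0 < s -> 0 < C -> 200 * C * s ^+ 2 <= 1 ->
  3 / (100 * s ^+ 2) <= X -> `|B + M * X| <= C -> `|A| <= M / (2 * s) + C -> 2 * C * s <= 1 ->
  400 * M <= L -> L <= M * k * (4 + C) -> 0 < k ->
  ((25 * (4 + C))^-1 / (k * s ^+ 2)) <= - 2 * B / L - (- 2 * A / L) ^+ 2.
Proof.
move=> M1 s0 C0 Cs HX HB HA Cs2 L0 HL k0; have M0 : 0 < M by lra.
have L1 : 0 < L by clear -M0 L0; lra.
have s2 : 0 < s ^+ 2 by rewrite exprn_gt0.
have C4 : 0 < 4 + C by rewrite addr_gt0.
have i1 : 0 <= (200 * s ^+ 2)^-1 by rewrite invr_ge0; clear -s2; lra.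
have i2 : 0 <= (2 * s)^-1 by rewrite invr_ge0 mulr_ge0// ltW.
have e1 : C <= (200 * s ^+ 2)^-1.
  rewrite -[leRHS]mul1r ler_pdivlMr; clear -s2 Cs; lra.
have e2 : M * (3 / (100 * s ^+ 2)) <= M * X by rewrite ler_wpM2l// ltW.
have e3 : (200 * s ^+ 2)^-1 <= M * (200 * s ^+ 2)^-1 by rewrite ler_peMl.
have e5 : 5 * (M * (200 * s ^+ 2)^-1) <= - B by move: HB; rewrite ler_norml => /andP[_ ?]; lra.
have f1 : C <= (2 * s)^-1.
  rewrite -[(2 * s)^-1]mul1r ler_pdivlMr ?mulr_gt0//; clear -Cs2; lra.
have f2 : (2 * s)^-1 <= M * (2 * s)^-1 by rewrite ler_peMl.
have f3 : `|A| <= M / s.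
  have -> : M / s = 2 * (M * (2 * s)^-1) by field; rewrite gt_eqF.
  lra.
have f4 : A ^+ 2 <= M ^+ 2 / s ^+ 2.
  rewrite -[leLHS]real_normK ?num_real// -expr_div_n; apply: lerXn2r => //; rewrite nnegrE//.
  by rewrite divr_ge0// ltW.
have -> : - 2 * B / L - (- 2 * A / L) ^+ 2 = (2 * (- B) - 4 * A ^+ 2 / L) / L.
  by field; rewrite gt_eqF.
have f5 : 4 * A ^+ 2 / L <= 2 * (M * (200 * s ^+ 2)^-1).
  rewrite ler_pdivrMr//.
  have t0 : 0 <= 2 * (M * (200 * s ^+ 2)^-1) by clear -M0 i1; rewrite mulr_ge0// mulr_ge0// ltW.
  apply: le_trans (ler_wpM2l t0 L0).
  have -> : 2 * (M * (200 * s ^+ 2)^-1) * (400 * M) = 4 * (M ^+ 2 / s ^+ 2) by field; rewrite gt_eqF.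
  lra.
rewrite ler_pdivlMr//.
have p0 : 0 <= (25 * (4 + C))^-1 / (k * s ^+ 2) by rewrite divr_ge0 ?invr_ge0 ?mulr_ge0// ltW.
apply: le_trans (ler_wpM2l p0 HL) _.
have -> : (25 * (4 + C))^-1 / (k * s ^+ 2) * (M * k * (4 + C)) = 8 * (M * (200 * s ^+ 2)^-1).
  by field; rewrite !gt_eqF.
lra.
Qed.

Definition ctr a (s : R) : R[i] := (complex.Re a + 5 / 2 * s) +i* (complex.Im a + s / 2).

Lemma cbox_ctr a s w : cbox (ctr a s) (s / 2) w <->
  (2 * s <= complex.Re w - complex.Re a <= 3 * s) /\ (0 <= complex.Im w - complex.Im a <= s).
Proof.
rewrite /cbox /= !ler_distl; split => -[/andP[? ?] /andP[? ?]]; split; apply/andP; split; lra.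
Qed.

Let ReM (m : nat) (z : R[i]) : complex.Re (m%:R * z) = m%:R * complex.Re z.
Proof. by rewrite -(rmorph_nat (real_complex R)); case: z => x y /=; rewrite mul0r subr0. Qed.

Variables (Omega : set R[i]) (f : R[i] -> R[i]).
Hypothesis dO : domain Omega.
Hypothesis hf : holomorphic_on Omega f.
Hypothesis nf : nonconstant_on Omega f.
Hypothesis small : forall z, Omega z -> normc (f z) < 10^-1.

Lemma blowup a : Omega a -> f a = 0 -> exists c d : R, [/\ 0 < c, 0 < d & forall k (s := 2^-1 ^+ k : R), s <= d ->
  (0 < k)%N -> forall w, cbox (ctr a s) (s / 2) w ->
  [/\ f w != 0, ux f w <= - (c / (k%:R * s)) & c / (k%:R * s ^+ 2) <= uxx f w]].
Proof.
move=> Oa fa; have [m [r [C [/andP[r0 r4] C0 /(_ fa) m0 H]]]] := singularity_box dO hf nf small Oa.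
(* [ell a w >= T] gives [neglog f w >= m * T - C >= 400 * m]; it follows from [normc (w - a) ^+ 2 <=
   10 * s ^+ 2 <= 10 * s <= expR (- T)]. The bound [r / 4] keeps the square, which reaches out to
   [3 * s], in the box. *)
pose T : R := 400 + C; pose e := Num.min (r / 4) (expR (- T) / 10).
pose e' := Num.min e (Num.min 1 (200 * C)^-1).
(* The smaller of the constants of [gradient_ge] and [hessian_ge]. In [e'], the bound 1 gives
   [s ^+ 2 <= s] and the other one the absorption of [C]. *)
exists (25 * (4 + C))^-1, e'; split.
- by rewrite invr_gt0 mulr_gt0 ?addr_gt0.
- by rewrite !lt_min !divr_gt0 ?expR_gt0//= ltr01 invr_gt0 mulr_gt0.
move=> k s; rewrite !le_min -!andbA => /and4P[s1 s2 s3 s4] k0 w wb.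
have s0 : 0 < s by rewrite exprn_gt0.
have kR : 0 < k%:R :> R by rewrite ltr0n.
have M1 : 1 <= m%:R :> R by rewrite ler1n.
have [hx hy] := (cbox_ctr a s w).1 wb.
have [q1 q2 q3 q4] := quot_ge s0 hx hy.
have ss : s ^+ 2 <= s by rewrite expr2 ler_piMl// ltW.
have ws : box a r w.
  rewrite /box /= !ltr_distl; clear -hx hy s0 s1; move: hx hy => /andP[? ?] /andP[? ?]; split; apply/andP; split; lra.
have wa : w != a.
  apply/negP => /eqP E; case/andP: hx => h _.
  suff : 0 < complex.Re w - complex.Re a by rewrite E subrr ltxx.
  by apply: lt_le_trans h; rewrite mulr_gt0.

have [[_ fw] L1 h1 h2 h3] := H w ws wa.
have L0 : 0 < neglog f w by apply: lt_le_trans L1.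
have nE : normc (w - a) ^+ 2 = (complex.Re w - complex.Re a) ^+ 2 + (complex.Im w - complex.Im a) ^+ 2.
  by rewrite normc_sqr ReB ImB.
have n2 : 0 < s ^+ 2 by rewrite exprn_gt0.
have n0 : 0 < normc (w - a) ^+ 2 by rewrite nE; lra.
(* On the square [normc (w - a) >= s = 2^-k], so [ell a w <= 2 k ln 2], and [ln 2 <= 2]. *)
have lle : ell a w <= k%:R * 4.
  rewrite /ell /neglog lerNl; apply: (@le_trans _ _ (ln (s ^+ 2))); last first.
    by rewrite ler_ln ?posrE// nE; lra.
  have l2 : ln 2 <= 2 :> R by apply: ltW; exact: ln_sublinear.
  have -> : ln (s ^+ 2) = - (2 * k%:R * ln 2).
    by rewrite /s -exprM lnXn// lnV ?posrE// mulNrn -[ln 2 *+ _]mulr_natl natrM; ring.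
  rewrite lerN2; have := ler_wpM2l (mulr_ge0 (ler0n R 2) (ltW kR)) l2; lra.
have lge : T <= ell a w.
  rewrite /ell /neglog lerNr -[leRHS]expRK ler_ln ?posrE ?expR_gt0// nE.
  by move: s2; rewrite ler_pdivlMr//; lra.
have Lup : neglog f w <= m%:R * k%:R * (4 + C).
  move: h1; rewrite ler_norml => /andP[_ h1].
  have : m%:R * ell a w <= m%:R * (k%:R * 4) by rewrite ler_wpM2l.
  have : C <= m%:R * k%:R * C by rewrite ler_peMl ?(ltW C0)// -natrM ler1n muln_gt0 m0.
  lra.
have Llo : 400 * m%:R <= neglog f w.
  move: h1; rewrite ler_norml => /andP[h1 _].
  have : m%:R * T <= m%:R * ell a w by rewrite ler_wpM2l.
  have : C <= m%:R * C by rewrite ler_peMl// ltW.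
  rewrite /T; lra.
have C4 : 200 * C * s <= 1.
  have C200 : 0 < 200 * C by lra.
  by rewrite mulrC -ler_pdivlMr// mul1r.
have Cs : C * s ^+ 2 <= C * s by rewrite ler_wpM2l// ltW.
have RE : complex.Re (m%:R / (w - a)) = m%:R * ((complex.Re w - complex.Re a) / ((complex.Re w - complex.Re a) ^+ 2 + (complex.Im w - complex.Im a) ^+ 2)).
  by rewrite ReM Re_inv nE ReB.
have RE2 : complex.Re (m%:R / (w - a) ^+ 2) = m%:R * (((complex.Re w - complex.Re a) ^+ 2 - (complex.Im w - complex.Im a) ^+ 2) / ((complex.Re w - complex.Re a) ^+ 2 + (complex.Im w - complex.Im a) ^+ 2) ^+ 2).
  rewrite ReM Re_inv; have -> : normc ((w - a) ^+ 2) = normc (w - a) ^+ 2 by rewrite expr2 normcM.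
  rewrite nE; congr (_ * (_ / _)).
  by rewrite -ReB -ImB; case: (w - a) => x y; rewrite expr2 /=; ring.
have k1 := le_trans (Re_le_normc _) h2; have k2 := le_trans (Re_le_normc _) h3.
have RD z z' : complex.Re (z + z') = complex.Re z + complex.Re z' by case: z z' => ? ? [].
move: k1 k2; rewrite ReB RD RE RE2 => k1 k2.
split => //.
  have Cs1 : 10 * C * s <= 1 by have := mulr_gt0 C0 s0; lra.
  have := gradient_ge M1 s0 C0 Cs1 q3 k1 L0 Lup kR.
  move=> /le_trans; apply; rewrite lerN2; apply: ler_wpM2r; first by rewrite invr_ge0 mulr_ge0// ltW.
  by rewrite lef_pV2 ?posrE ?mulr_gt0 ?addr_gt0//; lra.
have Cs1 : 200 * C * s ^+ 2 <= 1 by lra.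
have Cs2 : 2 * C * s <= 1 by have := mulr_gt0 C0 s0; lra.
apply: (hessian_ge M1 s0 C0 Cs1 q4 k2 _ Cs2 Llo Lup kR).
apply: le_trans (Re_le_normc _) _; rewrite -(subrK (m%:R / (w - a)) (lder f w)).
apply: le_trans (le_normcD _ _) _; rewrite addrC; apply: lerD => //.
rewrite normcM normcV -(rmorph_nat (real_complex R)) normc_real ger0_norm//.
apply: ler_wpM2l => //; rewrite lef_pV2 ?posrE ?mulr_gt0//.
  rewrite -(@ler_pXn2r _ 2)// ?nnegrE ?normc_ge0// ?mulr_ge0 ?(ltW s0)// exprMn -natrX nE.
  exact: q1.
by rewrite normc_gt0 subr_eq0.
Qed.

End blowup.

(** * Mass of weak derivatives *)

Section weak_mass.
Variable R : realType.
Implicit Types (z w a c : R[i]) (n m k : nat) (h v phi : R[i] -> R) (V W K : set R[i]).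

Lemma Lp_loc_continuous W h : open W -> (forall z, W z -> {for z, continuous h}) -> Lp_loc 1%E W h.
Proof.
move=> oW ch; apply: (Lp_loc_intro (p := 1)) => //; first exact: measurable_continuous.
move=> a Wa; have N : nbhs a [set w | `|h w| < `|h a| + 1].
  move/cvgrPdist_lt: (ch a Wa) => /(_ 1 ltr01); apply: filterS => w hw /=.
  by rewrite -(subrK (h a) (h w)) addrC; apply: le_lt_trans (ler_normD _ _) _; rewrite ltrD2l distrC.
have /nbhs_boxP[e e0 He] := N.
exists (Num.min e 4^-1), 0, (`|h a| + 1); split.
  by rewrite lt_min e0 invr_gt0 ltr0n /= ge_min lexx orbT.
move=> w [w1 w2] _; rewrite mul0r add0r powRr1//; apply/ltW/He; split.
  by apply: lt_le_trans w1 _; rewrite ge_min lexx.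
by apply: lt_le_trans w2 _; rewrite ge_min lexx.
Qed.

Lemma intC_supp V K h phi : K `<=` V -> supp phi `<=` K ->
  intC V (fun z => h z * phi z) = intC K (fun z => h z * phi z).
Proof.
move=> KV pK; have p0 z : ~ K z -> h z * phi z = 0.
  by move=> nK; rewrite (@supp0 _ phi z) ?mulr0// => /pK; exact: nK.
by rewrite (intC_cut KV) ?(@intC_cut _ K K)// => z _; exact: p0.
Qed.

Section classical.
Variables (V W : set R[i]) (phi : R[i] -> R).
Hypotheses (oW : open W) (WV : W `<=` V) (tphi : test_function W phi).
Let K := supp phi.
Let KW : K `<=` W := test_sub tphi.
Let KV : K `<=` V := subset_trans KW WV.
Let iso : isolated_in W set0.
Proof. by move=> a _; exists 1. Qed.

Let ibp h hx psi : (forall z, W z -> {for z, continuous h}) -> (forall z, W z -> {for z, continuous hx}) ->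
  (forall z, W z -> pdx h z (hx z)) -> test_function W psi ->
  intC W (fun z => h z * dx psi z) = (- intC W (fun z => (hx z * psi z)%R))%E.
Proof.
move=> ch chx dh tpsi; have L1 := Lp_loc_continuous oW ch; have L2 := Lp_loc_continuous oW chx.
by apply: (ibp_x oW iso _ _ L1 L2 tpsi) => z Wz _; [exact: ch|exact: chx|exact: dh].
Qed.

(** A test function supported in [W], where [h] has a continuous x-derivative, pairs equally with
    the weak and the classical derivative. Integration by parts is used on [W] with an empty
    exceptional set. *)
Lemma weak_dx h hx v : (forall z, W z -> {for z, continuous h}) -> (forall z, W z -> {for z, continuous hx}) ->
  (forall z, W z -> pdx h z (hx z)) -> weak_derivative V 1 0 h v ->
  intC K (fun z => v z * phi z) = intC K (fun z => hx z * phi z).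
Proof.
move=> ch chx dh [_ _ wd]; have tV : test_function V phi by case: tphi => s c _; split.
have := wd _ tV; rewrite /partial /= expr1 EFinN mulN1e.
have -> : intC V (fun z => h z * dx phi z) = intC W (fun z => h z * dx phi z).
  have s := @supp_dx _ phi; rewrite (intC_supp _ KV s) (intC_supp _ KW s)//.
rewrite (ibp ch chx dh tphi).
move/oppe_inj; rewrite (intC_supp _ KV (@subset_refl _ _)) (intC_supp _ KW (@subset_refl _ _)).
by move=> ->.
Qed.

Lemma weak_dxx h hx hxx v : (forall z, W z -> {for z, continuous h}) -> (forall z, W z -> {for z, continuous hx}) ->
  (forall z, W z -> {for z, continuous hxx}) ->
  (forall z, W z -> pdx h z (hx z)) -> (forall z, W z -> pdx hx z (hxx z)) -> weak_derivative V 2 0 h v ->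
  intC K (fun z => v z * phi z) = intC K (fun z => hxx z * phi z).
Proof.
move=> ch chx chxx dh dhx [_ _ wd]; have tV : test_function V phi by case: tphi => s c _; split.
have := wd _ tV; rewrite /partial /= expr2 mulrNN mulr1 mul1e.
have -> : intC V (fun z => h z * dx (dx phi) z) = intC W (fun z => h z * dx (dx phi) z).
  have s : supp (dx (dx phi)) `<=` K by apply: subset_trans (@supp_dx _ _) (@supp_dx _ _).
  by rewrite (intC_supp _ KV s) (intC_supp _ KW s).
rewrite (ibp ch chx dh (test_dx tphi)) (ibp chx chxx dhx tphi).
rewrite oppeK (intC_supp _ KV (@subset_refl _ _)) (intC_supp _ KW (@subset_refl _ _)).
by move=> ->.
Qed.

End classical.

(** [r ^+ 2] is the area of the inner box, on which both factors are bounded below. *)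
Lemma bump_integral_ge c (r b d : R) h phi : 0 <= r -> 0 <= b -> 0 <= d ->
  measurable_fun (planeset (cbox c r)) (h \o @to_C R) -> continuous phi ->
  (forall z, cbox c r z -> b <= h z) -> (forall z, 0 <= phi z) ->
  (forall z, box c (r / 2) z -> d <= phi z) ->
  ((b * d * r ^+ 2)%:E <= intC (cbox c r) (fun z => (h z * phi z)%R))%E.
Proof.
move=> r0 b0 d0 mh cphi hb phi0 phid.
have mK := measurable_compact (@compact_cbox R c r).
have mB := @measurable_box _ c (r / 2).
have BK : planeset (box c (r / 2)) `<=` planeset (cbox c r).
  by move=> q [h1 h2]; split; apply: le_trans (ltW _) _; [exact: h1|lra|exact: h2|lra].
have mphi : measurable_fun (planeset (cbox c r)) (phi \o @to_C R).
  by apply: measurable_funS (measurable_continuous openT (fun z _ => cphi z)); first exact: (measurable_open openT).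
have mf : measurable_fun (planeset (cbox c r)) (fun q => (h (to_C q) * phi (to_C q))%:E).
  by apply/measurable_EFinP; exact: (measurable_funM mh mphi).
have f0 q : planeset (cbox c r) q -> (0 <= (h (to_C q) * phi (to_C q))%:E)%E.
  by move=> Kq; rewrite lee_fin mulr_ge0//; apply: le_trans b0 (hb _ Kq).
have := ge0_subset_integral (dA R) mB mK mf f0 BK; apply: le_trans.
have -> : ((b * d * r ^+ 2)%:E = \int[dA R]_(q in planeset (box c (r / 2))) (b * d)%:E)%E.
  by rewrite integral_cst// dA_box ?divr_ge0// -EFinM; congr EFin; field.
apply: ge0_le_integral => //.
- by move=> q _; rewrite lee_fin mulr_ge0.
- exact: measurable_funS mf.
- move=> q Bq; rewrite lee_fin; apply: ler_pM => //; first exact/hb/BK.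
  exact: phid.
Qed.

Lemma bump_integral_le K v phi : measurable (planeset K) -> measurable_fun (planeset K) (v \o @to_C R) ->
  continuous phi -> (forall z, 0 <= phi z <= 1) ->
  (`|intC K (fun z => (v z * phi z)%R)| <= \int[dA R]_(q in planeset K) `|v (to_C q)|%:E)%E.
Proof.
move=> mK mv cphi phi1.
have mphi : measurable_fun (planeset K) (phi \o @to_C R).
  by apply: measurable_funS (measurable_continuous openT (fun z _ => cphi z)); first exact: (measurable_open openT).
have mf : measurable_fun (planeset K) (fun q => (v (to_C q) * phi (to_C q))%:E).
  by apply/measurable_EFinP; exact: (measurable_funM mv mphi).
apply: le_trans (le_abse_integral _ mK mf) _; apply: ge0_le_integral => //.
- exact: measurableT_comp.
- by apply/measurable_EFinP; exact: measurableT_comp.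
- move=> q _; rewrite lee_fin normrM; have /andP[p0 p1] := phi1 (to_C q).
  by apply: ler_piMr => //; rewrite ger0_norm.
Qed.

End weak_mass.

(** * Mass bounds and growth comparison *)

Section unbounded.
Variable R : realType.
Implicit Types (z w a c : R[i]) (n m k : nat) (h v phi : R[i] -> R) (V W K A : set R[i]).

Definition mass A v : \bar R := (\int[dA R]_(q in planeset A) `|v (to_C q)|%:E)%E.

Lemma mass_le A B v : measurable (planeset A) -> measurable (planeset B) ->
  measurable_fun (planeset B) (v \o @to_C R) -> A `<=` B -> (mass A v <= mass B v)%E.
Proof.
move=> mA mB mv AB; apply: ge0_subset_integral => //.
- by apply/measurable_EFinP; exact: measurableT_comp.
- by move=> q; exact: AB.
Qed.

(** A substitute for Hölder's inequality: where [|v| > t] one has [|v| <= t^(1-p) |v|^p], and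
    elsewhere [|v| <= t]. The factor [(4 * r) ^+ 2] is the area of an open box containing
    [cbox c r]. *)
Lemma mass_box_le (p t : R) c r K v : 1 <= p -> 0 < t -> 0 < r -> cbox c r `<=` K -> measurable (planeset K) ->
  measurable_fun (planeset K) (v \o @to_C R) ->
  (mass (cbox c r) v <= (t * (4 * r) ^+ 2)%:E +
     (t `^ (1 - p))%:E * \int[dA R]_(q in planeset K) (`|v (to_C q)| `^ p)%:E)%E.
Proof.
move=> p1 t0 r0 cK mK mv; have mc := measurable_compact (@compact_cbox R c r).
have sc : planeset (cbox c r) `<=` planeset K by move=> q; exact: cK.
have mvc := measurable_funS mK sc mv.
have mpK : measurable_fun (planeset K) (fun q => (`|v (to_C q)| `^ p)%:E).
  apply/measurable_EFinP; apply: (measurableT_comp (f := fun x : R => x `^ p)); first exact: measurable_powR.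
  exact: measurableT_comp.
have mpc := measurable_funS mK sc mpK.
have tp : 0 <= t `^ (1 - p) by exact: powR_ge0.
apply: (@le_trans _ _ (\int[dA R]_(q in planeset (cbox c r)) (t%:E + (t `^ (1 - p))%:E * (`|v (to_C q)| `^ p)%:E))%E).
  apply: ge0_le_integral => //.
  - by apply/measurable_EFinP; exact: measurableT_comp.
  - by apply: emeasurable_funD => //; exact: measurable_funeM.
  - move=> q _; rewrite -EFinM -EFinD lee_fin; have [vt|tv] := leP `|v (to_C q)| t.
      by apply: le_trans vt _; rewrite lerDl mulr_ge0// powR_ge0.
    move: (v (to_C q)) tv => y ty; have y0 : 0 < `|y| by apply: lt_trans ty.
    apply: (@le_trans _ _ (t `^ (1 - p) * `|y| `^ p)); last by rewrite lerDr ltW.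
    have -> : `|y| `^ p = `|y| * `|y| `^ (p - 1).
      rewrite -[X in _ = X * _]powRr1// -powRD; last by rewrite (gt_eqF y0) implybT.
      by congr (_ `^ _); ring.
    rewrite mulrCA ler_peMr//.
    have -> : 1 - p = - (p - 1) by ring.
    rewrite powRN ler_pdivlMl ?powR_gt0// mulr1.
    by apply: ge0_ler_powR; rewrite ?nnegrE ?subr_ge0// ltW.
rewrite ge0_integralD//; last 3 first.
- by move=> q _; rewrite lee_fin ltW.
- by move=> q _; rewrite mule_ge0// lee_fin powR_ge0.
- exact: measurable_funeM.
apply: leeD.
  rewrite integral_cst// EFinM; apply: lee_wpmul2l; first by rewrite lee_fin ltW.
  have -> : 4 * r = 2 * (2 * r) by ring.
  have E : dA R (planeset (box c (2 * r))) = ((2 * (2 * r)) ^+ 2)%:E by apply: dA_box; lra.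
  rewrite -E; apply: le_measure; rewrite ?inE//; first exact: measurable_box.
  by move=> q [h1 h2]; split; [apply: le_lt_trans h1 _|apply: le_lt_trans h2 _]; lra.
have g0 (q : plane R) : planeset (cbox c r) q -> (0 <= (`|v (to_C q)| `^ p)%:E)%E.
  by rewrite lee_fin powR_ge0.
rewrite (ge0_integralZl_EFin (dA R) mc g0 mpc tp).
apply: lee_wpmul2l; first by rewrite lee_fin.
apply: ge0_subset_integral => //.
Qed.

(** One term of the exponential series of [2 ^ k = exp (k ln 2)]. *)
Lemma exp2_ge n : exists2 b : R, 0 < b & forall k, b * k%:R ^+ n.+1 <= 2 ^+ k.
Proof.
exists (ln 2 ^+ n.+1 / n.+1`!%:R); first by rewrite divr_gt0 ?exprn_gt0 ?ln2_gt0// ltr0n fact_gt0.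
move=> k; have := expR_ge1Dxn n (mulr_ge0 (ler0n R k) (ltW (@ln2_gt0 R))).
rewrite expRM_natl lnK ?posrE// exprMn => H; apply: le_trans H.
by rewrite mulrAC (mulrC (ln 2 ^+ _)) lerDr.
Qed.

Lemma half_exp_le (d : R) : 0 < d -> exists k0, forall k, (k0 <= k)%N -> 2^-1 ^+ k <= d.
Proof.
move=> d0; exists (Num.bound d^-1) => k hk; rewrite exprVn -[leRHS]invrK lef_pV2 ?posrE ?exprn_gt0 ?invr_gt0//.
apply: le_trans (ltW (archi_boundP _)) _; first by rewrite invr_ge0 ltW.
by rewrite -natrX ler_nat; apply: leq_trans hk _; exact/ltnW/ltn_expl.
Qed.

(* With [t] a multiple of [2 ^+ k / k], the right-hand side of the hypothesis stays below the left-hand side once [k] is large. *)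
Lemma half_exp_bound_absurd (B N p : R) k0 : 0 < B -> 2 < p ->
  (forall k t (s := 2^-1 ^+ k : R), (k0 <= k)%N -> (0 < k)%N -> 0 < t ->
     B * s / k%:R <= t * (4 * (s / 2)) ^+ 2 + t `^ (1 - p) * N) -> False.
Proof.
move=> B0 p2 H; pose q := p - 2; have q0 : 0 < q by rewrite /q; lra.
(* [t] grows at least like [k ^ j], hence [t ^ q] at least like [k ^ 3]: two powers of [k] pay for
   the decay of [s ^ 2 * t ^ 2], and the third makes the bound diverge. *)
pose j := Num.bound (3 / q); have jq : 3 <= j%:R * q.
  by rewrite -ler_pdivrMr//; apply/ltW/archi_boundP; rewrite divr_ge0// ltW.
have [b b0 hb] := exp2_ge j.
pose D := B ^+ 2 / 16 * (B / 8 * b) `^ q.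
have D0 : 0 < D by rewrite mulr_gt0 ?powR_gt0 ?divr_gt0 ?mulr_gt0 ?exprn_gt0.
pose k := (k0 + Num.bound (`|N| / D)).+1; pose s : R := 2^-1 ^+ k.
have s0 : 0 < s by rewrite exprn_gt0.
have kR : 1 <= k%:R :> R by rewrite ler1n.
(* With this threshold the first term on the right of the hypothesis is exactly half of the
   left-hand side. *)
pose t := B / 8 / (s * k%:R).
have t0 : 0 < t by rewrite !divr_gt0// mulr_gt0.
have := H k t _ isT t0; rewrite -/s; move=> /(_ (leqW (leq_addr _ _))).
have -> : B * s / k%:R = 2 * (t * (4 * (s / 2)) ^+ 2) by rewrite /t; field; rewrite !gt_eqF.
move=> H1; have {}H1 : t * (4 * (s / 2)) ^+ 2 <= t `^ (1 - p) * N by lra.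
have {}H1 : 4 * s ^+ 2 * t `^ p <= N.
  have tp : 0 <= t `^ (p - 1) by exact: powR_ge0.
  have := ler_wpM2l tp H1; rewrite [X in _ <= X]mulrA -powRD; last by rewrite (gt_eqF t0) implybT.
  have -> : p - 1 + (1 - p) = 0 by ring.
  rewrite powRr0 mul1r; apply: le_trans.
  have -> : t `^ p = t `^ (p - 1) * t.
    rewrite -[X in _ = _ * X]powRr1 ?(ltW t0)// -powRD; last by rewrite (gt_eqF t0) implybT.
    by congr (_ `^ _); ring.
  by rewrite le_eqVlt; apply/orP; left; apply/eqP; field.
have tq : (B / 8 * b) `^ q * k%:R ^+ 3 <= t `^ q.
  have hbt : B / 8 * b * k%:R ^+ j <= t.
    rewrite /t ler_pdivlMr ?mulr_gt0//.
    have := hb k; rewrite exprSr mulrA => hk.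
    have : s * 2 ^+ k = 1 by rewrite /s exprVn mulVf// gt_eqF// exprn_gt0.
    have := ler_wpM2l (ltW s0) hk => hs ss.
    have -> : B / 8 * b * k%:R ^+ j * (s * k%:R) = B / 8 * (s * (b * k%:R ^+ j * k%:R)) by ring.
    by apply: ler_piMr; [rewrite divr_ge0// ltW|rewrite -[leRHS]ss].
  apply: le_trans (ge0_ler_powR (ltW q0) _ _ hbt); rewrite ?nnegrE ?(ltW t0)//; last first.
    by rewrite mulr_ge0 ?exprn_ge0 ?mulr_ge0 ?divr_ge0// ltW.
  rewrite [X in _ <= X]powRM ?exprn_ge0 ?mulr_ge0 ?divr_ge0 ?(ltW B0) ?(ltW b0)//; apply: ler_wpM2l; first exact: powR_ge0.
  rewrite -!powR_mulrn ?ler0n// -powRrM; exact: ler_powR.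
have : D * k%:R <= N.
  apply: le_trans H1; have -> : p = 2 + q by rewrite /q; ring.
  rewrite powRD; last by rewrite (gt_eqF t0) implybT.
  rewrite powR_mulrn ?(ltW t0)//.
  have -> : 4 * s ^+ 2 * (t ^+ 2 * t `^ q) = B ^+ 2 / 16 / k%:R ^+ 2 * t `^ q.
    by rewrite /t; field; rewrite !gt_eqF.
  have -> : D * k%:R = B ^+ 2 / 16 / k%:R ^+ 2 * ((B / 8 * b) `^ q * k%:R ^+ 3).
    by rewrite /D; field; rewrite !gt_eqF.
  by rewrite ler_wpM2l// !divr_ge0// ?exprn_ge0// ltW.
apply/negP; rewrite -ltNge; apply: le_lt_trans (ler_norm N) _.
rewrite mulrC -ltr_pdivrMr//; apply: lt_le_trans (archi_boundP _) _; first by rewrite divr_ge0// ltW.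
by rewrite ler_nat /k -addnS; apply: leq_trans (leqnSn _) _; exact: leq_addl.
Qed.

End unbounded.

(** * Failure of regularity near a zero *)

Section nonmembership.
Variable R : realType.
Implicit Types (z w c : R[i]) (n m k : nat) (h v phi : R[i] -> R) (W K A : set R[i]).
Variables (Omega : set R[i]) (f : R[i] -> R[i]).
Hypothesis dO : domain Omega.
Hypothesis hf : holomorphic_on Omega f.
Hypothesis nf : nonconstant_on Omega f.
Hypothesis small : forall z, Omega z -> normc (f z) < 10^-1.
Variables (a : R[i]) (V : set R[i]).
Hypotheses (fa : f a = 0) (oV : open V) (Va : V a) (VO : V `<=` Omega).

Let oO : open Omega. Proof. by case: dO. Qed.
Let Oa : Omega a := VO Va.
Let W := V `&` (Omega `&` [set z | f z != 0]).
Let oW : open W. Proof. by apply: openI => //; exact: open_nonzero oO hf. Qed.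
Let WV : W `<=` V. Proof. by move=> z []. Qed.

Let cell k := cbox (ctr a (2^-1 ^+ k)) (2^-1 ^+ k / 2).

(** On the k-th cell, of side [s = 2^-k], the pointwise sizes [c / (k s)] of the gradient and
    [c / (k s^2)] of the second derivative are multiplied by an area of order [s^2]. Tested against
    a bump bounded by 1, they bound the mass of any weak derivative from below. *)
Lemma weak_mass_ge : exists (B e : R) k0, [/\ 0 < B, 0 < e, (0 < k0)%N, cbox a e `<=` V & forall k, (k0 <= k)%N ->
  [/\ cell k `<=` cbox a e,
   forall v, weak_derivative V 1 0 (u_of f) v -> ((B * 2^-1 ^+ k / k%:R)%:E <= mass (cell k) v)%E &
   forall v, weak_derivative V 2 0 (u_of f) v -> ((B / k%:R)%:E <= mass (cell k) v)%E]].
Proof.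
have /nbhs_boxP[r r0 rV] : nbhs a V by exact: open_nbhs_nbhs.
have [c [d [c0 d0 H]]] := blowup dO hf nf small Oa fa.
have [k1 hk1] : exists k0, forall k, (k0 <= k)%N -> 2^-1 ^+ k <= Num.min d (r / 8).
  by apply: half_exp_le; rewrite lt_min d0 divr_gt0.
have eV : cbox a (r / 2) `<=` V by move=> w [w1 w2]; apply: rV; split; lra.
pose D : R := expR (- 2) ^+ 4; have D0 : 0 < D by rewrite exprn_gt0 ?expR_gt0.
exists (c * D / 4), (r / 2), k1.+1; split => //; try by rewrite ?divr_gt0 ?mulr_gt0.
move=> k k1k; pose s : R := 2^-1 ^+ k; have s0 : 0 < s by rewrite exprn_gt0.
have kR : 0 < k%:R :> R by rewrite ltr0n; exact: leq_trans k1k.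
have := hk1 k (ltnW k1k); rewrite -/s le_min => /andP[sd sr].
have cK : cell k `<=` cbox a (r / 2).
  move=> w /cbox_ctr[/andP[x1 x2] /andP[y1 y2]]; rewrite -/s in x1 x2 y1 y2.
  by rewrite /cbox /= !ler_norml; split; apply/andP; split; lra.
have cW : cell k `<=` W.
  move=> w cw; have [fw _ _] := H k sd (leq_trans (ltn0Sn _) k1k) w cw.
  have Vw := eV _ (cK _ cw); split => //; split => //; exact: VO.
have sr0 : 0 < s / 2 by rewrite divr_gt0.
have [phi [tphi phi1 phi0 phid]] := @smooth_bump R (ctr a s) _ sr0.
have tW : test_function W phi by apply: tphi; exact: cW.
have sc : supp phi `<=` cell k by apply: test_sub; apply: tphi; exact: subset_refl.
have cphi := test_continuous tW.
have phip z : 0 <= phi z by case/andP : (phi1 z).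
have mc : measurable (planeset (cell k)) := measurable_compact (@compact_cbox R _ _).
have mcell h : (forall z, W z -> {for z, continuous h}) -> measurable_fun (planeset (cell k)) (h \o @to_C R).
  move=> ch; apply: measurable_funS (measurable_continuous oW ch); first exact: measurable_open.
  by move=> q; exact: cW.
have cu z : W z -> {for z, continuous (u_of f)} by move=> [_ Uz]; exact: continuous_u Uz.
have cux z : W z -> {for z, continuous (ux f)} by move=> [_ Uz]; exact: continuous_ux Uz.
have cuxx z : W z -> {for z, continuous (uxx f)} by move=> [_ Uz]; exact: continuous_uxx Uz.
have du z : W z -> pdx (u_of f) z (ux f z) by move=> [_ Uz]; have [] := u_pdx hf small Uz.
have dux z : W z -> pdx (ux f) z (uxx f z) by move=> [_ Uz]; exact: (ux_pdx dO hf small Uz).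
have mv a' b' v : weak_derivative V a' b' (u_of f) v -> measurable_fun (planeset (cell k)) (v \o @to_C R).
  move=> [_ [mV _] _]; apply: measurable_funS mV; first exact: measurable_open.
  by move=> q /cW[].
have key h v (b : R) : measurable_fun (planeset (cell k)) (v \o @to_C R) ->
    measurable_fun (planeset (cell k)) (h \o @to_C R) -> 0 <= b ->
    (forall z, cell k z -> b <= h z) ->
    `|intC (supp phi) (fun z => (v z * phi z)%R)|%E = `|intC (cell k) (fun z => (h z * phi z)%R)|%E ->
    ((b * D * (s / 2) ^+ 2)%:E <= mass (cell k) v)%E.
  move=> mv' mh b0 hb E; apply: le_trans (bump_integral_le mc mv' cphi phi1).
  rewrite (intC_supp _ sc (@subset_refl _ _)) E; apply: le_trans (lee_abs _).
  by apply: bump_integral_ge => //; exact: ltW.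
split => // v wv.
  have -> : c * D / 4 * s / k%:R = c / (k%:R * s) * D * (s / 2) ^+ 2 by field; rewrite !gt_eqF.
  apply: (key (fun z => - ux f z)); first exact: mv wv.
  - exact: measurableT_comp (mcell _ cux).
  - by rewrite divr_ge0 ?mulr_ge0// ltW.
  - by move=> z cz; have [_ + _] := H k sd (leq_trans (ltn0Sn _) k1k) z cz; rewrite lerNr.
  rewrite (weak_dx oW WV tW cu cux du wv) -(intC_supp _ sc (@subset_refl _ _)).
  rewrite -[RHS]abseN; congr (`| _ |)%E; rewrite /intC -integral_ge0N.
    by apply: eq_integral => q _; rewrite -EFinN mulNr opprK.
  move=> q cq; rewrite lee_fin mulr_ge0// oppr_ge0.
  have [_ + _] := H k sd (leq_trans (ltn0Sn _) k1k) _ cq; move/le_trans; apply.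
  by rewrite oppr_le0 divr_ge0 ?mulr_ge0// ltW.
have -> : c * D / 4 / k%:R = c / (k%:R * s ^+ 2) * D * (s / 2) ^+ 2 by field; rewrite !gt_eqF.
apply: (key (uxx f)); [exact: mv wv|exact: mcell| | |].
- by rewrite divr_ge0 ?mulr_ge0 ?exprn_ge0// ltW.
- by move=> z cz; have [_ _] := H k sd (leq_trans (ltn0Sn _) k1k) z cz.
by rewrite (weak_dxx oW WV tW cu cux cuxx du dux wv) -(intC_supp _ sc (@subset_refl _ _)).
Qed.

Lemma not_weak_Lp (p : R) v : 2 < p -> weak_derivative V 1 0 (u_of f) v ->
  (forall K, compact K -> K `<=` V -> (\int[dA R]_(q in planeset K) (`|v (to_C q)| `^ p)%:E < +oo)%E) -> False.
Proof.
move=> p2 wv fin; have [B [e [k0 [B0 e0 _ KV H]]]] := weak_mass_ge.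
pose K := cbox a e; have cK : compact K by exact: compact_cbox.
have mK := measurable_compact cK.
have mv : measurable_fun (planeset K) (v \o @to_C R).
  case: wv => _ [mV _] _; apply: measurable_funS mV; first exact: measurable_open.
  by move=> q /KV.
have I0 : (0 <= \int[dA R]_(q in planeset K) (`|v (to_C q)| `^ p)%:E)%E.
  by apply: integral_ge0 => q _; rewrite lee_fin powR_ge0.
have := fin K cK KV; move: I0.
set I := (\int[dA R]_(q in planeset K) _)%E => I0 Ioo.
have IE : I = (fine I)%:E by rewrite fineK// ge0_fin_numE.
apply: (@half_exp_bound_absurd R B (fine I) p k0 B0 p2) => k t s k0k kp t0.
have [cell_sub /(_ v wv) m1 _] := H k k0k.
have s2 : 0 < s / 2 by rewrite divr_gt0// exprn_gt0.
have m2 := mass_box_le (ltW (lt_trans (ltr1n R 2) p2)) t0 s2 cell_sub mK mv.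
have := le_trans m1 m2; rewrite -/I IE -EFinM -EFinD lee_fin.
exact.
Qed.

Lemma not_Sobolev_1p (p : \bar R) : (2%:E < p)%E -> ~ Sobolev_loc 1 p V (u_of f).
Proof.
move=> p2 [_ /(_ 1%N 0%N isT)[v wv [mv Lv]]].
case: p p2 Lv => [p| |]//; first rewrite lte_fin => p2 Lv.
  apply: (not_weak_Lp p2 wv) => K cK KV.
  apply/Lnorm_lty; [exact: lt_trans p2|exact: measurable_compact|exact: Lv].
(* For [p = +oo], [v] is essentially bounded on compact sets, hence locally in L^3, and the exponent
   3 already exceeds 2. *)
move=> _ Lv; apply: (@not_weak_Lp 3 v _ wv); first by rewrite ltr_nat.
move=> K cK KV; have mK := measurable_compact cK; have := Lv K cK KV.
(* The norm of order [+oo] is the essential supremum only when the whole space has positive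
   measure. *)
have pos : (0 < dA R setT)%E.
  have : (dA R (planeset (box a 1)) <= dA R setT)%E by apply: le_measure; rewrite ?inE//; exact: measurable_box.
  by apply: lt_le_trans; rewrite dA_box// lte_fin exprn_gt0.
rewrite unlock pos; set g := abse \o _ => Eoo; set E := ess_sup _ _ in Eoo.
have aeE := ess_sup_ge (dA R) g; rewrite -/E in aeE.
pose M := Num.max (fine E) 0; have M0 : 0 <= M by rewrite le_max lexx orbT.
have mvK : measurable_fun (planeset K) (v \o @to_C R).
  by apply: measurable_funS mv; [exact: measurable_open|move=> q /KV].
apply: (@le_lt_trans _ _ (\int[dA R]_(q in planeset K) (M ^+ 3)%:E)%E); last first.
  by rewrite integral_cst// lte_mul_pinfty ?lee_fin ?exprn_ge0//; exact: dA_compact.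
apply: ae_ge0_le_integral => //.
- apply/measurable_EFinP; apply: (measurableT_comp (f := fun x : R => x `^ 3)); first exact: measurable_powR.
  exact: measurableT_comp.
- by move=> q _; rewrite lee_fin exprn_ge0.
apply: filterS aeE => q gq Kq; rewrite lee_fin -[3]/(3%:R) powR_mulrn//; apply: lerXn2r => //.
rewrite le_max; apply/orP; left.
have : (`|v (to_C q)|%:E <= E)%E.
  by move: gq; rewrite /g /= indicE mem_set// mulr1.
by case: (E) Eoo => [x _|//|//]; rewrite lee_fin.
Qed.

(* The cells of different levels are disjoint, so that their masses [B / k] add up to a divergent series. *)
Lemma not_Sobolev_21 : ~ Sobolev_loc 2 1%E V (u_of f).
Proof.
move=> [_ /(_ 2%N 0%N isT)[v wv [mV Lv]]].
have [B [e [k0 [B0 e0 k00 KV H]]]] := weak_mass_ge.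
pose K := cbox a e; have cK : compact K by exact: compact_cbox.
have mK := measurable_compact cK.
have mv : measurable_fun (planeset K) (v \o @to_C R).
  by apply: measurable_funS mV; [exact: measurable_open|move=> q /KV].
have mv' : measurable_fun (planeset K) (fun q => `|v (to_C q)|%:E).
  by apply/measurable_EFinP; exact: measurableT_comp.
have Ioo : (mass K v < +oo)%E.
  have /integrableP[_] := Lp_loc1_integrable oV (conj mV Lv) cK KV.
  by under eq_integral do rewrite abse_EFin.
have I0 : (0 <= mass K v)%E by apply: integral_ge0.
have IE : mass K v = (fine (mass K v))%:E by rewrite fineK// ge0_fin_numE.
pose s k : R := 2^-1 ^+ k.
have s0 k : 0 < s k by rewrite exprn_gt0.
(* The part of [K] to the right of the k-th cell. It is disjoint from that cell, and the next one,
   starting at [3 * s / 2], contains both it and the cell, which begins at [2 * s]. *)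
pose A k := K `&` [set w | 3 * s k < complex.Re w - complex.Re a].
have mA k : measurable (planeset (A k)).
  apply: measurableI => //; apply: measurable_open.
  have -> : [set w | 3 * s k < complex.Re w - complex.Re a] = (fun w : R[i] => complex.Re w) @^-1` [set x : R | 3 * s k + complex.Re a < x].
    by apply/seteqP; split=> w; rewrite /= ltrBrDr.
  by have /continuousP := @continuous_Re R; apply; exact: open_gt.
have step n : ((\sum_(0 <= i < n) B / (k0 + i)%:R)%:E <= mass (A (k0 + n)%N) v)%E.
  elim: n => [|n IH]; first by rewrite big_nil; exact: integral_ge0.
  have [cell_sub _ /(_ v wv) m1] := H _ (leq_addr n k0).
  have mc : measurable (planeset (cell (k0 + n))) := measurable_compact (@compact_cbox R _ _).
  have mAc := measurableU _ _ (mA (k0 + n)%N) mc.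
  have AK : planeset (A (k0 + n)%N) `|` planeset (cell (k0 + n)) `<=` planeset K.
    by move=> q [[]//|]; exact: cell_sub.
  rewrite big_nat_recr//= EFinD; apply: le_trans (leeD IH m1) _.
  rewrite /mass -ge0_integral_setU//; last 2 first.
  - exact: measurable_funS mv'.
  - apply/eqP/seteqP; split=> // q [[_ /= h] /cbox_ctr[/andP[_ h'] _]].
    by move: h; rewrite /s ltNge h'.
  apply: ge0_subset_integral => //.
  - by apply: measurable_funS mv' => // q [].
  - have sS : s (k0 + n.+1)%N = s (k0 + n)%N / 2 by rewrite /s addnS exprSr.
    have s1 := s0 (k0 + n)%N.
    move=> q [[Kq /= h]|cq]; split => //=; rewrite ?sS; first by lra.
      exact: cell_sub.
    by case/cbox_ctr: cq => /andP[h _] _; rewrite -/(s _) in h; lra.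
apply: (@dvg_harmonic R); apply: nondecreasing_is_cvgn.
  by apply: nondecreasing_series => n _ _; rewrite invr_ge0.
(* The series starts at [k0]; it is compared with the harmonic one through [k0 + i <= k0 * (i + 1)],
   which accounts for the factor [k0]. *)
exists (fine (mass K v) * k0%:R / B) => _ [n _ <-].
have : (\sum_(0 <= i < n) B / (k0 + i)%:R <= fine (mass K v)).
  rewrite -lee_fin -IE; apply: le_trans (step n) _; apply: mass_le => //.
  by move=> w [].
rewrite ler_pdivlMr// => h; rewrite mulrC -ler_pdivrMr ?ltr0n//.
apply: le_trans h; rewrite /series /= mulr_sumr mulr_suml; apply: ler_sum => i _.
rewrite -mulrA; apply: ler_wpM2l; first exact: ltW.
rewrite -invfM lef_pV2 ?posrE ?mulr_gt0 ?ltr0n ?addn_gt0 ?k00// -natrM ler_nat.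
by rewrite mulSn leq_add2l leq_pmulr.
Qed.

End nonmembership.

Theorem theorem1p4 (R : realType) (Omega : set R[i]) (f : R[i] -> R[i]) :
  domain Omega ->
  holomorphic_on Omega f ->
  nonconstant_on Omega f ->
  zero_set Omega f !=set0 ->
  (forall z, Omega z -> normc (f z) < 10^-1) ->
  [/\ Sobolev_loc 1 2%:E Omega (u_of f) /\
      (forall p : \bar R, (2%:E < p)%E ->
       forall a : R[i], zero_set Omega f a ->
       forall V : set R[i], open V -> V a -> V `<=` Omega ->
         ~ Sobolev_loc 1 p V (u_of f)),
      Lp_loc 1%E Omega (g_of f),
      distributional_laplacian Omega (u_of f) (g_of f) &
      forall a : R[i], zero_set Omega f a ->
      forall V : set R[i], open V -> V a -> V `<=` Omega ->
        ~ Sobolev_loc 2 1%E V (u_of f)].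
Proof.
move=> dO hf nf _ small; split.
- split; first exact: (loglog_Sobolev12 dO hf nf small).
  move=> p p2 a [_ fa] V oV Va VO.
  exact: (not_Sobolev_1p dO hf nf small fa oV Va VO p2).
- exact: (Lp1_g dO hf nf small).
- exact: (loglog_distributional_laplacian dO hf nf small).
move=> a [_ fa] V oV Va VO.
exact: (not_Sobolev_21 dO hf nf small fa oV Va VO).
Qed.
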